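(* Let $M_n=\max_{k\in\mathbb{N}_0}\mathbb{L}_n(k)$ be the width of a binary search tree with $n+1$ external nodes, and set $$\tilde M_n:=4\log n\left(1-\frac{\sqrt{4\pi\log n}\,M_n}{n}\right),\quad n\in\mathbb{N}.$$ With probability $1$, the set of subsequential limits of the sequence $(\tilde M_n)_{n\in\mathbb{N}}$ is the interval $[\chi_2(0)-1/12,\ \chi_2(0)+1/6]$. Furthermore, with $\theta_n=\min_{k\in\mathbb{Z}}|2\log n+\chi_1(0)-1/2-k|$, almost surely $$\lim_{n\to\infty}\left(\tilde M_n-\theta_n^2\right)=\chi_2(0)-\frac1{12}.$$
   Context: Binary search tree (BST) process: at time $n=0$ there is one external node, the root, at depth $0$. At each step one of the existing external nodes is picked uniformly at random (independently of the past given the current tree), declared internal, and connected to two new external nodes, each of depth one larger than that of the picked node. After $n$ steps the tree has $n$ internal and $n+1$ external nodes; the trees for all $n$ are defined on one probability space through this evolution. The depth of a node is its distance to the root. $\mathbb{L}_n(k)$ is the number of external nodes at depth $k$ after $n$ steps; $x_{1,n},\dots,x_{n+1,n}$ are the depths of the external nodes. Let $\beta_-\approx-1.678$ and $\beta_+\approx0.768$ be the solutions of $2e^\beta(1-\beta)=1$, and let $W_n(\beta)=n^{-(2e^\beta-1)}\sum_{i=1}^{n+1}e^{\beta x_{i,n}}$, $\beta\in\mathbb{C}$. There are an open set $\mathscr{D}\subset\mathbb{C}$ containing $(\beta_-,\beta_+)$ and a random analytic function $W_\infty$ on $\mathscr{D}$ such that, almost surely, $W_n\to W_\infty$ uniformly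 on compact subsets of $\mathscr{D}$; one has $W_\infty(0)=1$. Put $\chi_1(0)=(\log W_\infty)'(0)=W_\infty'(0)$ and $\chi_2(0)=(\log W_\infty)''(0)=W_\infty''(0)-(W_\infty'(0))^2$. Equivalently, $\chi_1(0)$ is the a.s. limit of $\frac1{n+1}\sum_ix_{i,n}-2\log n$ and $\chi_2(0)$ is the a.s. limit of $\frac1{n+1}\sum_ix_{i,n}^2-\big(\frac1{n+1}\sum_ix_{i,n}\big)^2-2\log n$. *)

(* Defs.v *)
From HB Require Import structures.
From mathcomp Require Import all_boot all_order all_algebra.
From mathcomp Require Import all_classical all_reals all_analysis.
From mathcomp Require Import complex.
Set Implicit Arguments.
Unset Strict Implicit.
Unset Printing Implicit Defensive.
Import Order.TTheory GRing.Theory Num.Theory.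
Import numFieldNormedType.Exports.
Local Open Scope classical_set_scope.
Local Open Scope ring_scope.
Local Open Scope complex_scope.

(* A node is addressed by the word of left/right moves ([false]/[true]) leading
   to it from the root, so its depth is the length of that word. *)
Definition node := seq bool.
Definition depth (v : node) : nat := size v.

Inductive bst := External | Internal of bst & bst.

Fixpoint externals (t : bst) : seq node :=
  match t with
  | External => [:: [::]]
  | Internal l r =>
      [seq false :: v | v <- externals l] ++ [seq true :: v | v <- externals r]
  end.

(* [bst_expand t v] is only meaningful when [v \in externals t]; the other cases
   return irrelevant values. *)
Fixpoint bst_expand (t : bst) (v : node) : bst :=
  match t, v with
  | External, _ => Internal External External
  | Internal l r, false :: v' => Internal (bst_expand l v') r
  | Internal l r, true :: v' => Internal l (bst_expand r v')
  | Internal _ _, [::] => t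
  end.

Definition profile (t : bst) (k : nat) : nat :=
  count (fun v => depth v == k) (externals t).

(* The maximum of the profile over all k : nat, taken over the depths that
   occur; see [width_max]. *)
Definition width (t : bst) : nat :=
  \max_(v <- externals t) profile t (depth v).

Lemma externals_neq0 (t : bst) : externals t != [::].
Proof. by elim: t => //= l; case: (externals l). Qed.

Lemma width_max (t : bst) :
  (forall k, (profile t k <= width t)%N) /\ (exists k, profile t k = width t).
Proof.
split=> [k|].
  case: (posnP (profile t k)) => [-> //|].
  rewrite -has_count => /hasP[v vt /eqP <-].
  exact: (@leq_bigmax_seq _ (externals t) xpredT (fun v => profile t (depth v))).
rewrite /width; case E : (externals t) => [|v s].
  by have := externals_neq0 t; rewrite E.
elim: s v {E} => [|w s IH] v; rewrite big_cons.
  by exists (depth v); rewrite big_nil maxn0.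
have [k kE] := IH w; have [H|H] := leqP (profile t (depth v)) (profile t k).
  by exists k; rewrite -kE; apply/esym/maxn_idPr.
by exists (depth v); rewrite -kE; apply/esym/maxn_idPl/ltnW.
Qed.

Lemma size_externals_bst_expand (t : bst) (v : node) : v \in externals t ->
  size (externals (bst_expand t v)) = (size (externals t)).+1.
Proof.
elim: t v => [|l IHl r IHr] v //=.
rewrite mem_cat => /orP[] /mapP[w wt ->] /=; rewrite !size_cat !size_map.
  by rewrite IHl.
by rewrite IHr // addnS.
Qed.

(* [T n] is the tree after [n] steps and [V n] the external node picked in step
   [n.+1].  [bst_uniform] says that, conditionally on every possible history
   [T 0 = h 0, .., T n = h n], the node [V n] is uniform on the external nodes
   of [h n]; it is written multiplicatively, so that histories of probability
   zero impose no condition. *)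
Record bst_process (R : realType) (d : measure_display)
    (Omega : measurableType d) (P : probability Omega R)
    (T : nat -> Omega -> bst) (V : nat -> Omega -> node) : Prop := {
  bst_measT : forall n t, measurable (T n @^-1` [set t]);
  bst_measV : forall n v, measurable (V n @^-1` [set v]);
  bst_init : forall w, T 0%N w = External;
  bst_pick : forall n w, V n w \in externals (T n w);
  bst_step : forall n w, T n.+1 w = bst_expand (T n w) (V n w);
  bst_uniform : forall n (h : nat -> bst) (v : node), v \in externals (h n) ->
    P ([set w | forall i, (i <= n)%N -> T i w = h i] `&` [set w | V n w = v])
    = (P [set w | forall i, (i <= n)%N -> T i w = h i]
       * ((size (externals (h n)))%:R^-1)%:E)%E
}.

(* [R[i]^o] is [R[i]] seen as a normed module over itself; the library puts the
   topology of the norm, and hence complex differentiation, on this alias. *)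
Definition cexp (R : realType) (z : R[i]^o) : R[i]^o :=
  (expR (complex.Re z) * cos (complex.Im z))
  +i* (expR (complex.Re z) * sin (complex.Im z)).

(* n ^ (- (2 exp beta - 1)) * \sum_i exp (beta x_i), the x_i being the depths
   of the external nodes of a tree [t] with [n] internal nodes.  As [ln 0 = 0],
   the index n = 0 gives a junk value, which is irrelevant for limits. *)
Definition W_ (R : realType) (n : nat) (t : bst) (beta : R[i]^o) : R[i]^o :=
  cexp (- (2 * cexp beta - 1) * (ln n%:R)%:C)
  * \sum_(v <- externals t) cexp (beta * (depth v)%:R).

(* [Winf] is a random analytic function on the open set [D], which contains the
   real interval (bm, bp), and a.s. W_n --> Winf uniformly on the compact
   subsets of [D].  The values of [Winf] outside [D] are irrelevant. *)
Record W_limit (R : realType) (d : measure_display)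
    (Omega : measurableType d) (P : probability Omega R)
    (T : nat -> Omega -> bst) (bm bp : R) (D : set R[i]^o)
    (Winf : Omega -> R[i]^o -> R[i]^o) : Prop := {
  W_open : open D;
  W_itv : forall b : R, bm < b < bp -> D b%:C;
  W_analytic : forall w z, D z -> derivable (Winf w) z 1;
  W_measRe : forall z, D z ->
    measurable_fun [set: Omega] (fun w => complex.Re (Winf w z));
  W_measIm : forall z, D z ->
    measurable_fun [set: Omega] (fun w => complex.Im (Winf w z));
  W_cvg : {ae P, forall w, forall K : set R[i]^o, compact K -> K `<=` D ->
    {uniform K, (fun n => W_ n (T n w)) @ \oo --> Winf w}}
}.

(* The first two derivatives at 0 of log f for an analytic f with f 0 = 1.  For
   f = W_infty both are a.s. real, so taking the real part changes nothing. *)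
Definition chi1 (R : realType) (f : R[i]^o -> R[i]^o) : R :=
  complex.Re (derive1 f 0).
Definition chi2 (R : realType) (f : R[i]^o -> R[i]^o) : R :=
  complex.Re (derive1n 2 f 0 - (derive1 f 0) ^+ 2).

(* Also a junk value at n = 0. *)
Definition Mtilde (R : realType) (n : nat) (t : bst) : R :=
  4 * ln n%:R
  * (1 - Num.sqrt (4 * pi * ln n%:R) * (width t)%:R / n%:R).

(* The infimum is a minimum; see [dist_int_min]. *)
Definition dist_int (R : realType) (x : R) : R :=
  inf [set `|x - k%:~R| | k in [set: int]].

Lemma dist_int_min (R : realType) (x : R) :
  (forall k : int, dist_int x <= `|x - k%:~R|) /\
  (exists k : int, dist_int x = `|x - k%:~R|).
Proof.
pose A := [set `|x - k%:~R| | k in [set: int]].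
have lbA (y : R) : (forall k : int, y <= `|x - k%:~R|) -> lbound A y.
  by move=> H _ [k _ <-].
have infA k : dist_int x <= `|x - k%:~R|.
  by apply: ge_inf; [exists 0; apply: lbA|exists k].
split=> //; have /andP[fx xf] := floor_itv x.
have lek (k : int) :
    Num.min `|x - (Num.floor x)%:~R| `|x - (Num.floor x + 1)%:~R|
    <= `|x - k%:~R|.
  rewrite ge_min; have [kf|fk] := lerP k (Num.floor x).
    apply/orP; left; have kx : k%:~R <= (Num.floor x)%:~R :> R by rewrite ler_int.
    by rewrite !ger0_norm ?subr_ge0 ?lerB// (le_trans kx).
  apply/orP; right.
  have kx : (Num.floor x + 1)%:~R <= k%:~R :> R by rewrite ler_int lezD1.
  have xf' := ltW xf; rewrite !ler0_norm ?subr_le0 ?(le_trans xf' kx)//.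
  by rewrite lerN2 lerB.
have geA :
    Num.min `|x - (Num.floor x)%:~R| `|x - (Num.floor x + 1)%:~R| <= dist_int x.
  by apply: lb_le_inf; [exists `|x - 0%:~R|; exists 0|exact: lbA].
move: geA; rewrite ge_min => /orP[] H; [exists (Num.floor x)|exists (Num.floor x + 1)];
  by apply/eqP; rewrite eq_le infA.
Qed.

Definition theta (R : realType) (n : nat) (f : R[i]^o -> R[i]^o) : R :=
  dist_int (2 * ln n%:R + chi1 f - 1 / 2).

Definition subseq_limits (R : realType) (u : nat -> R) : set R :=
  [set l | exists phi : nat -> nat,
    (forall j, (phi j < phi j.+1)%N) /\ u (phi j) @[j --> \oo] --> l].

(* Main.v *)
From HB Require Import structures.
Require Import Defs.
From mathcomp Require Import all_boot all_order all_algebra.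
From mathcomp Require Import all_classical all_reals all_analysis.
From mathcomp Require Import measurable_realfun complex.
From mathcomp Require Import ring lra zify.
Import Order.TTheory GRing.Theory Num.Theory.
Import numFieldNormedType.Exports.
Set Implicit Arguments.
Unset Strict Implicit.
Unset Printing Implicit Defensive.
Local Open Scope classical_set_scope.
Local Open Scope ring_scope.

(** The profile of the tree at time [n] is the coefficient sequence of its
    generating function [level_gf], and [W_ n t] is this function at [exp beta],
    divided by [n] times the generating function of the Poisson law with parameter
    [lam n = 2 ln n]. So if [W_ n t] is close to [1 + A beta + ...] near [0], then
    the profile, divided by [n], is close to the Poisson probabilities corrected by
    their first two differences ([edgeworth]), and this up to [O (lam n ^ - 2)]
    uniformly in the level ([local_expansion]). By Stirling's formula the Poisson
    probabilities, multiplied by [sqrt (2 pi lam n)], are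
    [1 - ((k - lam n + 1 / 2) ^ 2 - 1 / 12) / (2 lam n)] up to [O (lam n ^ - 2)]
    for [k] at a bounded distance from [lam n]. With the correction,
    [2 lam n (1 - sqrt (2 pi lam n) L_n (k) / n)] becomes the parabola
    [(k - (lam n + A - 1 / 2)) ^ 2 + 2 B + A - A ^ 2 - 1 / 12] in the level [k], up
    to [o (1)] ([edgeworth_local]), and it is larger than all relevant values of the
    parabola when [k] is far from [lam n] ([edgeworth_far]). Now [Mtilde] is the
    minimum of this quantity over the integers [k], which gives the square of the
    distance from [lam n + A - 1 / 2] to the integers plus the constant
    ([Mtilde_of_parabola], [Mtilde_approx]). In the limit [A] becomes [chi1] and
    [2 B + A - A ^ 2] becomes [chi2] ([coef_limits]). The subsequential limits
    follow, because [2 ln n] is dense modulo 1 ([dist_int_log_dense]).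

    The local expansion is Fourier inversion on the unit circle. It is carried out
    over equidistant points, for which the inversion of polynomials is exact. The
    same device proves Cauchy's estimates for polynomials, and with them the needed
    facts on analytic functions: Euler's limit makes each [W_ n t] a uniform limit
    of polynomials on a disc about [0] ([papprox_W]), and the derivatives of uniform
    limits of polynomials are the limits of the derivatives ([derive1_unif]).

    The uniform convergence of [W_ n] near [0] controls the generating function near
    the point 1 of the circle ([near_zone_approx]). On the rest of the circle its
    second moments are estimated. The node that is expanded is uniform, so the
    second moment satisfies a linear recursion, with the growth exponent
    [4 Re z - 2], which is less than 2 away from [z = 1] ([mean_square_le]). At the
    times [j ^ q], with [q] large, the resulting bounds are summable, so that they
    hold almost surely up to a random constant ([far_mean_square_ae]). Between these
    times a small proportion of the nodes changes ([far_zone_bound]). *)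

Local Notation Re := complex.Re.
Local Notation Im := complex.Im.

(** * Modulus and exponential of complex numbers *)

Section ComplexExponential.
Variable R : realType.
Local Notation C := R[i].
Implicit Types (x y u a b : R) (z w : C) (n m k N : nat).

(** The modulus as a real number; the norm of [R[i]] takes its values in [R[i]]. *)
Definition cabs z : R := Num.sqrt (Re z ^+ 2 + Im z ^+ 2).

Lemma cabsE z : (`|z| = (cabs z)%:C)%C.
Proof. exact: normc_def. Qed.

Lemma cabs_ge0 z : 0 <= cabs z.
Proof. exact: sqrtr_ge0. Qed.

Lemma cabs_sqr z : cabs z ^+ 2 = Re z ^+ 2 + Im z ^+ 2.
Proof. by rewrite sqr_sqrtr// addr_ge0// sqr_ge0. Qed.

Lemma cabsM z w : cabs (z * w) = cabs z * cabs w.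
Proof. by apply: (@complexI R); rewrite rmorphM/= -!cabsE normrM. Qed.

Lemma cabsX z n : cabs (z ^+ n) = cabs z ^+ n.
Proof. by apply: (@complexI R); rewrite rmorphXn/= -!cabsE normrX. Qed.

Lemma cabsD z w : cabs (z + w) <= cabs z + cabs w.
Proof. by rewrite -lecR rmorphD/= -!cabsE ler_normD. Qed.

Lemma cabsN z : cabs (- z) = cabs z.
Proof. by apply: (@complexI R); rewrite -!cabsE normrN. Qed.

Lemma cabsB z w : cabs (z - w) <= cabs z + cabs w.
Proof. by rewrite -(cabsN w) cabsD. Qed.

Lemma cabsBC z w : cabs (z - w) = cabs (w - z).
Proof. by rewrite -cabsN opprB. Qed.

Lemma cabs_dist z v w : cabs (z - w) <= cabs (z - v) + cabs (v - w).
Proof. by rewrite (_ : z - w = (z - v) + (v - w)) ?cabsD //; ring. Qed.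

Lemma cabs0 : cabs 0 = 0.
Proof. by apply: (@complexI R); rewrite -!cabsE normr0. Qed.

Lemma cabs1 : cabs 1 = 1.
Proof. by apply: (@complexI R); rewrite -!cabsE normr1. Qed.

Lemma cabsR x : cabs (x%:C)%C = `|x|.
Proof. by rewrite /cabs /= expr0n addr0 sqrtr_sqr. Qed.

Lemma cabs_nat n : cabs n%:R = n%:R.
Proof. by apply: (@complexI R); rewrite -!cabsE rmorph_nat normr_nat. Qed.

Lemma cabsV z : cabs z^-1 = (cabs z)^-1.
Proof. by apply: (@complexI R); rewrite -!cabsE fmorphV/= -cabsE normfV. Qed.

Lemma cabs_sum (I : Type) (s : seq I) (Q : pred I) (F : I -> C) :
  cabs (\sum_(i <- s | Q i) F i) <= \sum_(i <- s | Q i) cabs (F i).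
Proof.
elim/big_ind2 : _ => [|z x w y zx wy|//]; first by rewrite cabs0.
by rewrite (le_trans (cabsD _ _))// lerD.
Qed.

Lemma cabs_eq0 z : cabs z = 0 -> z = 0.
Proof. by move=> z0; apply/eqP; rewrite -normr_eq0 cabsE z0. Qed.

Lemma le_cabs_Re z : `|Re z| <= cabs z.
Proof. by rewrite -sqrtr_sqr ler_wsqrtr// lerDl sqr_ge0. Qed.

Lemma le_cabs_Im z : `|Im z| <= cabs z.
Proof. by rewrite -sqrtr_sqr ler_wsqrtr// lerDr sqr_ge0. Qed.

Lemma cabs_le_ReIm z : cabs z <= `|Re z| + `|Im z|.
Proof.
rewrite -[leRHS]ger0_norm ?addr_ge0// -sqrtr_sqr ler_wsqrtr//.
rewrite sqrrD !real_normK ?num_real// lerD2r lerDl.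
by rewrite mulrn_wge0// mulr_ge0.
Qed.

Lemma ReD z w : Re (z + w) = Re z + Re w.
Proof. by case: z => ? ?; case: w => ? ?. Qed.

Lemma ReM z w : Re (z * w) = Re z * Re w - Im z * Im w.
Proof. by case: z => ? ?; case: w => ? ?. Qed.

Lemma ImM z w : Im (z * w) = Re z * Im w + Im z * Re w.
Proof. by case: z => ? ?; case: w => ? ?. Qed.

Lemma ReB z w : Re (z - w) = Re z - Re w.
Proof. by case: z => ? ?; case: w => ? ?. Qed.

Lemma Re_sum (I : Type) (s : seq I) (F : I -> C) :
  Re (\sum_(i <- s) F i) = \sum_(i <- s) Re (F i).
Proof. by apply: (big_morph _ ReD). Qed.

Lemma ImD z w : Im (z + w) = Im z + Im w.
Proof. by case: z => ? ?; case: w => ? ?. Qed.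

Lemma Im_sum (I : Type) (s : seq I) (F : I -> C) :
  Im (\sum_(i <- s) F i) = \sum_(i <- s) Im (F i).
Proof. by apply: (big_morph _ ImD). Qed.

(** The values of [cexp] are elements of the normed module [R[i]^o]; here they are
    elements of the field [R[i]]. *)
Definition cex z : C := cexp z.

Lemma cexE x y : cex (x +i* y)%C = (expR x * cos y +i* (expR x * sin y))%C.
Proof. by []. Qed.

Lemma cex0 : cex 0 = 1.
Proof. by rewrite cexE expR0 cos0 sin0 mul1r mul1r. Qed.

Lemma cexD z w : cex (z + w) = cex z * cex w.
Proof.
case: z w => [a b] [c d]; rewrite cexE.
rewrite -[RHS]/((_ +i* _)%C); apply/eqP; rewrite eq_complex /=.
rewrite expRD cosD sinD; apply/andP; split; apply/eqP; ring.
Qed.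

Lemma cex_mulrn z n : cex (z *+ n) = cex z ^+ n.
Proof. by elim: n => [|n IHn]; rewrite ?cex0// mulrS exprS cexD IHn. Qed.

Lemma cabs_cex z : cabs (cex z) = expR (Re z).
Proof.
rewrite /cabs; case: z => a b /=.
rewrite !exprMn -mulrDr cos2Dsin2 mulr1 sqrtr_sqr ger0_norm//; exact: expR_ge0.
Qed.

Lemma cexR x : cex (x%:C)%C = ((expR x)%:C)%C.
Proof. by rewrite cexE cos0 sin0 mulr1 mulr0. Qed.

Definition cis u : C := cex (0 +i* u)%C.

Lemma cisE u : cis u = (cos u +i* sin u)%C.
Proof. by rewrite /cis cexE expR0 !mul1r. Qed.

Lemma cisD u v : cis (u + v) = cis u * cis v.
Proof. by rewrite /cis -cexD; congr cex; apply/eqP; rewrite eq_complex/= addr0 !eqxx. Qed.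

Lemma cis0 : cis 0 = 1. Proof. exact: cex0. Qed.

Lemma cis_mulrn u n : cis (u *+ n) = cis u ^+ n.
Proof. by elim: n => [|n IHn]; rewrite ?cis0// mulrS exprS cisD IHn. Qed.

Lemma cabs_cis u : cabs (cis u) = 1.
Proof. by rewrite cabs_cex expR0. Qed.

Lemma cis_2pi : cis (pi *+ 2) = 1.
Proof. by rewrite cisE cos2pi sin2pi. Qed.

Lemma cisN_mul u : cis u * cis (- u) = 1.
Proof. by rewrite -cisD subrr cis0. Qed.

Lemma cis_neq1 u : 0 < u < pi *+ 2 -> cis u != 1.
Proof.
move=> /andP[u0 u2]; apply/eqP => /(congr1 (@complex.Re R)).
rewrite cisE /= => c1.
have : sin (u / 2) = 0.
  have := cos_mulr2n (u / 2); rewrite (_ : (u / 2) *+ 2 = u); last by rewrite -mulr_natr; field.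
  rewrite c1 cos2sin2 => h; apply/eqP; rewrite -sqrf_eq0; apply/eqP; lra.
have : 0 < sin (u / 2).
  rewrite sin_gt0_pi// divr_gt0//= ltr_pdivrMr//; move: u2; rewrite -mulr_natr; lra.
by move=> /[swap] ->; rewrite ltxx.
Qed.

Lemma expR_taylor1 x : `|x| <= 1 / 2 -> `|expR x - 1 - x| <= 2 * x ^+ 2.
Proof.
move=> /ler_normlP[x1 x2].
have e1 := expR_ge1Dx x; have e2 := expR_ge1Dx (- x).
have e3 := expRxMexpNx_1 x; have e4 := expR_gt0 x.
rewrite ger0_norm; last by lra.
have : expR x * (1 - x) <= 1 by rewrite -[leRHS]e3 ler_pM2l//; lra.
nra.
Qed.

Lemma norm_sin_le u : `|sin u| <= `|u|.
Proof.
wlog u0 : u / 0 <= u => [hw|].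
  have [/hw//|/ltW u0] := leP 0 u.
  by rewrite -normrN -sinN -(normrN u) hw// oppr_ge0.
have [c _] : exists2 c, c \in `[0, u]%R & sin u - sin 0 = cos c * (u - 0).
  apply: MVT_segment => //; apply/continuous_subspaceT => t; exact: continuous_sin.
by rewrite sin0 !subr0 => ->; rewrite normrM ler_piMl// cos_max.
Qed.

Lemma norm_cosB1_le u : `|cos u - 1| <= u ^+ 2 / 2.
Proof.
have := cos_mulr2n (u / 2); rewrite (_ : (u / 2) *+ 2 = u); last by rewrite -mulr_natr; field.
rewrite cos2sin2 => ->; have h := norm_sin_le (u / 2).
have : sin (u / 2) ^+ 2 <= (u / 2) ^+ 2.
  by rewrite -(real_normK (num_real (sin _))) -(real_normK (num_real (u / 2))) lerXn2r ?nnegrE.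
by move=> h2; rewrite ler0_norm; have := sqr_ge0 (sin (u / 2)); lra.
Qed.

Lemma norm_sinB_le u : `|u| <= 1 -> `|sin u - u| <= u ^+ 2.
Proof.
wlog u0 : u / 0 <= u => [hw|].
  have [/hw//|/ltW u0 u1] := leP 0 u.
  by have := hw (- u); rewrite sinN sqrrN -opprD !normrN oppr_ge0; apply.
rewrite ger0_norm// => u1.
have [c] : exists2 c, c \in `[0, u]%R & sin u - sin 0 = cos c * (u - 0).
  apply: MVT_segment => //; apply/continuous_subspaceT => t; exact: continuous_sin.
rewrite sin0 !subr0 in_itv/= => /andP[c0 cu] ->.
rewrite (_ : cos c * u - u = (cos c - 1) * u); last by ring.
rewrite normrM (ger0_norm u0) expr2 ler_wpM2r//.
apply: (le_trans (norm_cosB1_le _)); nra.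
Qed.

Lemma cabs_cisB1 u : cabs (cis u - 1) <= 2 * `|u|.
Proof.
rewrite cisE; apply: (le_trans (cabs_le_ReIm _)) => /=.
rewrite subr0.
have h := norm_sin_le u.
suff : `|cos u - 1| <= `|u| by lra.
have [u1|u1] := leP `|u| 2.
  apply: (le_trans (norm_cosB1_le u)).
  by rewrite -(real_normK (num_real u)); have := normr_ge0 u; nra.
apply: (le_trans (ler_normB _ _)); have := cos_max u; rewrite normr1; lra.
Qed.

Lemma cex_taylor1 z : cabs z <= 1 / 2 -> cabs (cex z - 1 - z) <= 10 * cabs z ^+ 2.
Proof.
move=> z1; have h1 := le_cabs_Re z; have h2 := le_cabs_Im z.
have h3 := cabs_sqr z; have h4 := cabs_ge0 z.
case: z z1 h1 h2 h3 h4 => a b /= z1 h1 h2 h3 h4; set r := cabs _ in z1 h1 h2 h3 h4 *.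
apply: (le_trans (cabs_le_ReIm _)) => /=.
have e1 : `|expR a - 1 - a| <= 2 * a ^+ 2 by apply: expR_taylor1; lra.
have c1 := norm_cosB1_le b; have s1 : `|sin b - b| <= b ^+ 2 by apply: norm_sinB_le; lra.
have a2 := sqr_ge0 a; have b2 := sqr_ge0 b.
have ea : expR a <= 2 by move: e1 => /ler_normlP[_]; move: h1 => /ler_normlP[_]; nra.
have eap := expR_gt0 a.
have -> : expR a * cos b - 1 - a = expR a * (cos b - 1) + (expR a - 1 - a) by ring.
have -> : expR a * sin b - 0 - b = expR a * (sin b - b) + (expR a - 1 - a) * b + a * b by ring.
have q1 : `|expR a * (cos b - 1)| <= b ^+ 2.
  by rewrite normrM (gtr0_norm eap); have := normr_ge0 (cos b - 1); nra.
have q2 : `|expR a * (sin b - b)| <= 2 * b ^+ 2.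
  by rewrite normrM (gtr0_norm eap); have := normr_ge0 (sin b - b); nra.
have q3 : `|(expR a - 1 - a) * b| <= 2 * a ^+ 2.
  by rewrite normrM; have := normr_ge0 (expR a - 1 - a); have := normr_ge0 b; nra.
have q4 : `|a * b| <= r ^+ 2.
  by rewrite normrM expr2 ler_pM.
have t1 := ler_normD (expR a * (cos b - 1)) (expR a - 1 - a).
have t2 := ler_normD (expR a * (sin b - b) + (expR a - 1 - a) * b) (a * b).
have t3 := ler_normD (expR a * (sin b - b)) ((expR a - 1 - a) * b).
lra.
Qed.

Lemma subrX_le z w b n : cabs z <= b -> cabs w <= b ->
  cabs (z ^+ n - w ^+ n) <= n%:R * b ^+ n.-1 * cabs (z - w).
Proof.
move=> zb wb; have b0 : 0 <= b := le_trans (cabs_ge0 z) zb.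
elim: n => [|n IHn]; first by rewrite !expr0 subrr cabs0 !mul0r.
rewrite !exprS (_ : z * z ^+ n - w * w ^+ n = z * (z ^+ n - w ^+ n) + (z - w) * w ^+ n); last by ring.
apply: (le_trans (cabsD _ _)); rewrite !cabsM cabsX.
have h1 : cabs z * cabs (z ^+ n - w ^+ n) <= n%:R * b ^+ n * cabs (z - w).
  case: n IHn => [|n] IHn; first by rewrite !expr0 subrr cabs0 mulr0 !mul0r.
  apply: (le_trans (ler_pM (cabs_ge0 _) (cabs_ge0 _) zb IHn)).
  by rewrite /= exprS le_eqVlt; apply/orP; left; apply/eqP; ring.
have h2 : cabs (z - w) * cabs w ^+ n <= cabs (z - w) * b ^+ n.
  by rewrite ler_wpM2l ?cabs_ge0// lerXn2r ?nnegrE ?cabs_ge0.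
rewrite -natr1 /=; lra.
Qed.

(** Euler's limit with a rate that is uniform on discs; it makes the complex
    exponential, which is given through the real exponential and the trigonometric
    functions, a locally uniform limit of polynomials. *)
Lemma cex_euler rho : exists K, 0 <= K /\ forall N z, cabs z <= rho ->
  2 * rho <= N.+1%:R -> cabs (cex z - (1 + z / N.+1%:R) ^+ N.+1) <= K / N.+1%:R.
Proof.
exists (10 * rho ^+ 2 * expR rho); split.
  by apply: mulr_ge0 (expR_ge0 _); apply: mulr_ge0 (sqr_ge0 _).
move=> N z zr hN; set n := N.+1; have n0 : (0 : R) < n%:R by rewrite ltr0n.
have nC : n%:R != 0 :> C by rewrite pnatr_eq0.
pose w := z / n%:R.
have zE : z = w *+ n by rewrite -mulr_natr /w mulfVK.
have rho0 := le_trans (cabs_ge0 z) zr.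
have wE : cabs w = cabs z / n%:R by rewrite /w cabsM cabsV cabs_nat.
have w1 : cabs w <= 1 / 2 by rewrite wE ler_pdivrMr//; rewrite -/n in hN; lra.
have wr : cabs w <= rho / n%:R by rewrite wE ler_pM2r// invr_gt0.
rewrite -/w {1}zE cex_mulrn.
pose b := expR (rho / n%:R).
have b1 : cabs (cex w) <= b.
  by rewrite cabs_cex ler_expR (le_trans _ wr)// (le_trans (ler_norm _))// le_cabs_Re.
have b2 : cabs (1 + w) <= b.
  by apply: (le_trans (cabsD _ _)); rewrite cabs1 (le_trans _ (expR_ge1Dx _))// lerD2l.
apply: (le_trans (subrX_le _ b1 b2)).
have bN : b ^+ n.-1 <= expR rho.
  rewrite -expRM_natl ler_expR mulrA ler_pdivrMr// mulrC ler_wpM2l// ler_nat.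
  by rewrite /n.
have h : cabs (cex w - (1 + w)) <= 10 * (rho / n%:R) ^+ 2.
  rewrite opprD addrA; apply: (le_trans (cex_taylor1 w1)).
  by rewrite ler_pM2l// lerXn2r ?nnegrE ?cabs_ge0// divr_ge0// ltW.
have hb : n%:R * b ^+ n.-1 <= n%:R * expR rho by rewrite ler_wpM2l// ler0n.
apply: (le_trans (ler_pM _ (cabs_ge0 _) hb h)) => //.
  by rewrite mulr_ge0// exprn_ge0// expR_ge0.
rewrite le_eqVlt; apply/orP; left; apply/eqP; field.
by rewrite gt_eqF.
Qed.

End ComplexExponential.

(** * Fourier coefficients over equidistant points, and Cauchy's estimates *)

Section FourierOnGrid.
Variable R : realType.
Local Notation C := R[i].
Implicit Types (x u a b r : R) (z w : C) (n m k N : nat) (g : R -> C).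

Definition grid N j : R := (pi *+ 2) * j%:R / N%:R.

(** The [k]-th Fourier coefficient of [g] on the unit circle, with the integral
    replaced by the mean over [N] equidistant points. For polynomials of degree
    less than [N] there is no error, by [dft_poly]. *)
Definition dft N k g : C :=
  N%:R^-1 * \sum_(j < N) g (grid N j) * cis (- (grid N j * k%:R)).

Lemma eq_dft N k g h : (forall j, g (grid N j) = h (grid N j)) ->
  dft N k g = dft N k h.
Proof. by move=> gh; congr (_ * _); apply: eq_bigr => j _; rewrite gh. Qed.

Lemma dftD N k g h : dft N k (fun u => g u + h u) = dft N k g + dft N k h.
Proof.
rewrite /dft -mulrDr -big_split/=; congr (_ * _).
by apply: eq_bigr => j _; rewrite mulrDl.
Qed.

Lemma dftZ N k z g : dft N k (fun u => z * g u) = z * dft N k g.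
Proof.
rewrite /dft mulrCA; congr (_ * _); rewrite mulr_sumr.
by apply: eq_bigr => j _; rewrite mulrA.
Qed.

Lemma dftB N k g h : dft N k (fun u => g u - h u) = dft N k g - dft N k h.
Proof.
rewrite -mulN1r -dftZ -dftD; apply: eq_dft => j; ring.
Qed.

Lemma dft_sum N k (I : Type) (s : seq I) (F : I -> R -> C) :
  dft N k (fun u => \sum_(i <- s) F i u) = \sum_(i <- s) dft N k (F i).
Proof.
rewrite /dft -mulr_sumr exchange_big/=; congr (_ * _).
by apply: eq_bigr => j _; rewrite mulr_suml.
Qed.

Lemma dft_cisM N k g : dft N k.+1 (fun u => cis u * g u) = dft N k g.
Proof.
congr (_ * _); apply: eq_bigr => j _.
rewrite -natr1 mulrDr mulr1 opprD cisD.
have := cisN_mul (grid N j); set v := cis (- grid N j); set w := cis (grid N j).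
move=> wv; transitivity (w * v * (g (grid N j) * cis (- (grid N j * k%:R)))); first by ring.
by rewrite wv mul1r.
Qed.

Lemma cabs_dft N k g :
  cabs (dft N k g) <= N%:R^-1 * \sum_(j < N) cabs (g (grid N j)).
Proof.
rewrite cabsM cabsV cabs_nat ler_wpM2l ?invr_ge0//.
apply: (le_trans (cabs_sum _ _ _)); apply: ler_sum => j _.
by rewrite cabsM cabs_cis mulr1.
Qed.

Lemma dft_monomial N m k : (m < N)%N -> (k < N)%N ->
  dft N k (fun u => cis u ^+ m) = (m == k)%:R.
Proof.
move=> mN kN; have N0 : (0 < N)%N by case: N mN {kN}.
have NR : (0 : R) < N%:R by rewrite ltr0n.
have NC : N%:R != 0 :> C by rewrite pnatr_eq0 -lt0n.
have [->|mk] := eqVneq m k.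
  rewrite /dft (eq_bigr (fun=> 1)) => [|j _].
    by rewrite sumr_const card_ord mulVf.
  by rewrite mulr_natr -cis_mulrn cisN_mul.
pose v : R := (pi *+ 2) * (m%:R - k%:R) / N%:R.
have vE j : cis (grid N j) ^+ m * cis (- (grid N j * k%:R)) = cis v ^+ j.
  rewrite -!cis_mulrn -cisD; congr cis.
  by rewrite /grid /v; field; rewrite gt_eqF.
rewrite /dft (eq_bigr (fun j : 'I_N => cis v ^+ j)) => [|j _]; last exact: vE.
have vN : cis v ^+ N = 1.
  have h n : cis ((pi *+ 2) * n%:R : R) = 1 by rewrite mulr_natr cis_mulrn cis_2pi expr1n.
  have -> : cis v ^+ N = cis ((pi *+ 2) * m%:R) * cis (- ((pi *+ 2) * k%:R)).
    rewrite -cis_mulrn -cisD; congr cis; rewrite /v; field.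
    by rewrite gt_eqF.
  by rewrite h mul1r -[RHS](cisN_mul ((pi *+ 2) * k%:R)) h mul1r.
have pi0 : 0 < pi *+ 2 :> R by rewrite mulrn_wgt0// pi_gt0.
have v1 : cis v != 1.
  have [km|mk'] := ltnP k m.
    apply: cis_neq1; rewrite /v -natrB 1?ltnW// divr_gt0 ?mulr_gt0 ?ltr0n ?subn_gt0//=.
    by rewrite ltr_pdivrMr// ltr_pM2l// ltr_nat; lia.
  have km : (m < k)%N by rewrite ltn_neqAle mk.
  apply: contraNneq (@cis_neq1 R (- v) _) => [v1|].
    by have := cisN_mul v; rewrite v1 mul1r => ->.
  rewrite /v -mulNr -mulrN opprB -natrB 1?ltnW// divr_gt0 ?mulr_gt0 ?ltr0n ?subn_gt0//=.
  by rewrite ltr_pdivrMr// ltr_pM2l// ltr_nat; lia.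
have /eqP := subrX1 (cis v) N; rewrite vN subrr eq_sym mulf_eq0 subr_eq0 (negbTE v1)/=.
by move=> /eqP ->; rewrite mulr0.
Qed.

Lemma dft_count N k (s : seq nat) : (k < N)%N -> all (fun m => m < N)%N s ->
  dft N k (fun u => \sum_(m <- s) cis u ^+ m) = (count (pred1 k) s)%:R.
Proof.
move=> kN sN; rewrite dft_sum; elim: s sN => [|m s IHs] /= ; first by rewrite big_nil.
by move=> /andP[mN sN]; rewrite big_cons IHs// dft_monomial// natrD.
Qed.

Lemma dft_poly N k r (p : {poly C}) : (k < N)%N -> (size p <= N)%N ->
  dft N k (fun u => p.[r%:C%C * cis u]) = p`_k * (r%:C%C) ^+ k.
Proof.
move=> kN pN.
rewrite (_ : dft _ _ _ = dft N k (fun u => \sum_(m <- index_iota 0 N) (p`_m * r%:C%C ^+ m) * cis u ^+ m)).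
  rewrite dft_sum big_mkord (bigD1 (Ordinal kN))//= dftZ dft_monomial// eqxx mulr1.
  rewrite big1 ?addr0// => m /negbTE mk.
  by rewrite dftZ dft_monomial// (_ : _ == k = false) ?mulr0//; rewrite -mk.
apply: eq_dft => j; rewrite (horner_coef_wide _ pN) big_mkord.
by apply: eq_bigr => m _; rewrite exprMn mulrA.
Qed.

End FourierOnGrid.

Section PolynomialEstimates.
Variable R : realType.
Local Notation C := R[i].
Implicit Types (x u a b r M e : R) (z w h : C) (n m k N : nat) (p q : {poly C}).

(** Cauchy's estimate: a coefficient of a polynomial is an average over
    sufficiently many equidistant points of a circle, so that no integral is
    needed. *)
Lemma cauchy_estimate p r M k : 0 < r ->
  (forall z, cabs z <= r -> cabs p.[z] <= M) -> cabs p`_k * r ^+ k <= M.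
Proof.
move=> r0 pM; pose N := (size p + k).+1.
have := @dft_poly R N k r p; rewrite /N ltnS leq_addl -addSn ltnW ?ltn_addr//.
rewrite addSn -/N => /(_ isT isT) E.
rewrite -(ger0_norm (exprn_ge0 k (ltW r0))) -cabsR rmorphXn/= -cabsM -E.
apply: (le_trans (cabs_dft _ _ _)).
rewrite mulrC ler_pdivrMr ?ltr0n//.
apply: (le_trans (ler_sum (G := fun=> M) _ _)) => [j _|].
  by apply: pM; rewrite cabsM cabs_cis mulr1 cabsR ger0_norm// ltW.
by rewrite sumr_const card_ord mulr_natr.
Qed.

Lemma geo_tail_le x m n : 0 <= x <= 1 / 2 ->
  \sum_(m <= i < n) x ^+ i <= 2 * x ^+ m.
Proof.
move=> /andP[x0 x1]; have [mn|nm] := leqP m n; last first.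
  by rewrite big_geq 1?ltnW// mulr_ge0// exprn_ge0.
suff : \sum_(m <= i < n) x ^+ i <= 2 * x ^+ m - 2 * x ^+ n.
  by move=> /le_trans; apply; rewrite gerBl mulr_ge0// exprn_ge0.
elim: n mn => [|n IHn] mn; first by move: mn; rewrite leqn0 => /eqP ->; rewrite big_geq// subrr.
have [mn'|nm] := leqP m n; last first.
  by have -> : m = n.+1; [lia|rewrite big_geq// subrr].
rewrite big_nat_recr//=; have := IHn mn'; rewrite exprS.
have := exprn_ge0 n x0; set y := x ^+ n; nra.
Qed.

(** By Cauchy's estimates the omitted terms are dominated by a geometric series. *)
Lemma taylor_remainder p r M K z : 0 < r ->
  (forall z, cabs z <= r -> cabs p.[z] <= M) -> cabs z <= r / 2 ->
  cabs (p.[z] - \sum_(i < K) p`_i * z ^+ i) <= 2 * M * (cabs z / r) ^+ K.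
Proof.
move=> r0 pM zr.
have M0 : 0 <= M by apply: le_trans (cabs_ge0 _) (pM 0 _); rewrite cabs0 ltW.
rewrite (@horner_coef_wide _ (size p + K)) ?leq_addr//.
pose F i := p`_i * z ^+ i; rewrite -(big_mkord xpredT F) -(big_mkord xpredT F).
rewrite (@big_cat_nat _ _ _ K 0 (size p + K))//= ?leq_addl// addrAC subrr add0r.
apply: (le_trans (cabs_sum _ _ _)).
apply: (@le_trans _ _ (\sum_(K <= i < size p + K) M * (cabs z / r) ^+ i)).
  apply: ler_sum => i _; rewrite cabsM cabsX.
  have := cauchy_estimate i r0 pM => h.
  rewrite expr_div_n mulrA mulrAC ler_wpM2r ?exprn_ge0 ?cabs_ge0//.
  by rewrite ler_pdivlMr// exprn_gt0.
rewrite -mulr_sumr [2 * M]mulrC -mulrA ler_wpM2l// geo_tail_le//.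
by rewrite divr_ge0 ?cabs_ge0 ?(ltW r0)//= ler_pdivrMr//; lra.
Qed.

Lemma coef0_comp_XaddC p z : (p \Po ('X + z%:P))`_0 = p.[z].
Proof. by rewrite -horner_coef0 horner_comp !hornerE. Qed.

Lemma coef1_comp_XaddC p z : (p \Po ('X + z%:P))`_1 = p^`().[z].
Proof.
have := coef_deriv (p \Po ('X + z%:P)) 0; rewrite mulr1n => <-.
by rewrite deriv_comp derivD derivX derivC addr0 mulr1 -horner_coef0 horner_comp !hornerE.
Qed.

Lemma horner_comp_XaddC p z w : (p \Po ('X + z%:P)).[w] = p.[z + w].
Proof. by rewrite horner_comp !hornerE addrC. Qed.

(** [taylor_remainder] for the polynomial shifted by [z], which is bounded by [M] on
    the disc of radius [r]. *)
Lemma taylor1 p r M z h : 0 < r ->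
  (forall z, cabs z <= 2 * r -> cabs p.[z] <= M) ->
  cabs z <= r -> cabs h <= r / 2 ->
  cabs (p.[z + h] - p.[z] - h * p^`().[z]) <= 2 * M / r ^+ 2 * cabs h ^+ 2.
Proof.
move=> r0 pM zr hr.
have qM w : cabs w <= r -> cabs (p \Po ('X + z%:P)).[w] <= M.
  move=> wr; rewrite horner_comp_XaddC pM// (le_trans (cabsD _ _))//; lra.
have := taylor_remainder 2 r0 qM hr.
rewrite big_ord_recr big_ord1/= coef0_comp_XaddC coef1_comp_XaddC expr0 mulr1 expr1.
rewrite horner_comp_XaddC expr_div_n [in X in X -> _](mulrC _ h) opprD addrA => /le_trans; apply.
by rewrite mulrA mulrAC.
Qed.

Lemma deriv_bound p r M z : 0 < r ->
  (forall z, cabs z <= 2 * r -> cabs p.[z] <= M) ->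
  cabs z <= r -> cabs p^`().[z] <= M / r.
Proof.
move=> r0 pM zr; rewrite ler_pdivlMr//.
have qM w : cabs w <= r -> cabs (p \Po ('X + z%:P)).[w] <= M.
  move=> wr; rewrite horner_comp_XaddC pM// (le_trans (cabsD _ _))//; lra.
by have := cauchy_estimate 1 r0 qM; rewrite coef1_comp_XaddC.
Qed.

End PolynomialEstimates.

(** * Uniform limits of polynomials *)

Section UniformLimits.
Variable R : realType.
Local Notation C := R[i].
Implicit Types (x u a b r M e : R) (z w h : C) (n m k N : nat) (p q : {poly C}).

Let halfgt0 e : 0 < e -> 0 < e / 2. Proof. lra. Qed.

Lemma complex_complete (s : nat -> C) :
  (forall e, 0 < e -> exists N, forall m n, (N <= m)%N -> (N <= n)%N ->
     cabs (s m - s n) <= e) ->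
  exists l, forall e, 0 < e -> exists N, forall n, (N <= n)%N -> cabs (s n - l) <= e.
Proof.
move=> sC.
have real_case (t : nat -> R) : (forall m n, `|t m - t n| <= cabs (s m - s n)) ->
    exists l, forall e, 0 < e -> exists N, forall n, (N <= n)%N -> `|t n - l| <= e.
  move=> ts.
  have ct : cvgn t.
    apply/cauchy_cvgP/cauchy_ballP => e e0.
    have [N hN] := sC (e / 2) (halfgt0 e0).
    exists (t @` [set n | (N <= n)%N], t @` [set n | (N <= n)%N]).
      by split; exists N => // n /= Nn; exists n.
    move=> [_ _] [/= [m Nm <-] [n Nn <-]]; rewrite /ball/=.
    by rewrite (le_lt_trans (ts _ _))// (le_lt_trans (hN _ _ Nm Nn))//; lra.
  exists (lim (t @ \oo)) => e e0; move/cvgrPdist_le : ct => /(_ e e0)[N _ hN].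
  by exists N => n /hN; rewrite distrC.
have [m n|lr hr] := real_case (fun n => Re (s n)); first by rewrite -ReB le_cabs_Re.
have [m n|li hi] := real_case (fun n => Im (s n)).
  by rewrite (le_trans _ (le_cabs_Im _))//; case: (s m) (s n) => [? ?] [? ?].
exists (lr +i* li)%C => e e0.
have [N1 h1] := hr (e / 2) (halfgt0 e0).
have [N2 h2] := hi (e / 2) (halfgt0 e0).
exists (maxn N1 N2) => n; rewrite geq_max => /andP[/h1 + /h2].
move=> {}h1 {}h2; apply: (le_trans (cabs_le_ReIm _)); move: h1 h2.
by case: (s n) => a b /=; lra.
Qed.

Definition unif_on r (P : nat -> {poly C}) (f : C -> C) :=
  forall e, 0 < e -> exists N, forall n, (N <= n)%N ->
    forall z, cabs z <= r -> cabs ((P n).[z] - f z) <= e.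

Lemma poly_bounded p r : exists M, forall z, cabs z <= r -> cabs p.[z] <= M.
Proof.
exists (\sum_(i < size p) cabs p`_i * `|r| ^+ i) => z zr.
rewrite horner_coef (le_trans (cabs_sum _ _ _))// ler_sum// => i _.
rewrite cabsM cabsX ler_wpM2l ?cabs_ge0// lerXn2r ?nnegrE ?cabs_ge0//.
by rewrite (le_trans zr)// ler_norm.
Qed.

Lemma unif_on_bounded r P f : unif_on r P f ->
  exists M N, forall n, (N <= n)%N -> forall z, cabs z <= r -> cabs (P n).[z] <= M.
Proof.
move=> /(_ 1 ltr01)[N hN]; have [M hM] := poly_bounded (P N) r.
exists (M + 2), N => n Nn z zr.
have h1 := hN n Nn z zr; have h2 := hN N (leqnn N) z zr; have h3 := hM z zr.
have := cabs_dist (P n).[z] (f z) (P N).[z].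
have := cabsD ((P n).[z] - (P N).[z]) (P N).[z].
by rewrite subrK (cabsBC (f z)); lra.
Qed.

Lemma lim_le (s : nat -> C) l x :
  (forall e, 0 < e -> exists N, forall n, (N <= n)%N -> cabs (s n - l) <= e) ->
  (exists N, forall n, (N <= n)%N -> cabs (s n) <= x) -> cabs l <= x.
Proof.
move=> sl [N hN]; apply/ler_addgt0Pr => e e0.
have [N' hN'] := sl e e0.
have := hN _ (leq_maxl N N'); have := hN' _ (leq_maxr N N').
set y := s _; have := cabsB y (y - l); rewrite (_ : y - (y - l) = l); last by ring.
lra.
Qed.

(** Weierstrass's theorem for polynomials. Cauchy's estimate makes the derivatives
    uniformly Cauchy; the first order Taylor bound, which is the same for all
    polynomials of the sequence, passes to the limit and shows that the limit of
    the derivatives is the derivative of the limit. *)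
Lemma derive1_unif (f : R[i]^o -> R[i]^o) P r : 0 < r ->
  unif_on (2 * r) P f -> unif_on r (fun n => (P n)^`()) (derive1 f).
Proof.
move=> r0 Pf; have [M [n0 PM]] := unif_on_bounded Pf.
have Pcauchy e : 0 < e -> exists N, forall m n, (N <= m)%N -> (N <= n)%N ->
    forall z, cabs z <= r -> cabs ((P m)^`().[z] - (P n)^`().[z]) <= e.
  move=> e0; have er0 : 0 < e * r / 2 by rewrite divr_gt0 ?mulr_gt0.
  have [N hN] := Pf _ er0; exists N => m n Nm Nn z zr.
  rewrite -hornerN -hornerD -derivB.
  have := @deriv_bound R (P m - P n) r (e * r) z r0; rewrite mulfK ?gt_eqF//; apply => //.
  move=> w wr; rewrite hornerD hornerN.
  have := cabs_dist (P m).[w] (f w) (P n).[w].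
  have := hN m Nm w wr; have := hN n Nn w wr; rewrite (cabsBC (f w)); lra.
have dP z : cabs z <= r -> forall e, 0 < e -> exists N, forall n, (N <= n)%N ->
    cabs ((P n)^`().[z] - derive1 f z) <= e.
  move=> zr.
  have [e e0|g gP] := @complex_complete (fun n => (P n)^`().[z]).
    by have [N hN] := Pcauchy e e0; exists N => m n Nm Nn; exact: hN.
  suff -> : derive1 f z = g by [].
  set K := 2 * M / r ^+ 2.
  have fK h : cabs h <= r / 2 -> cabs (f (z + h) - f z - h * g) <= K * cabs h ^+ 2.
    move=> hr.
    apply: (@lim_le (fun n => (P n).[z + h] - (P n).[z] - h * (P n)^`().[z])).
      move=> e e0; have e3 : 0 < e / 4 by rewrite divr_gt0.
      have eh : 0 < e / (4 * (1 + cabs h)) by rewrite divr_gt0// mulr_gt0// ltr_wpDr ?cabs_ge0.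
      have [N1 h1] := Pf _ e3; have [N2 h2] := gP _ eh.
      exists (maxn N1 N2) => n; rewrite geq_max => /andP[/h1 {}h1 /h2 {}h2].
      have zh : cabs (z + h) <= 2 * r by rewrite (le_trans (cabsD _ _))//; lra.
      have zr2 : cabs z <= 2 * r by lra.
      have {h1}[q1 q2] := (h1 _ zh, h1 _ zr2).
      rewrite (_ : _ - _ = ((P n).[z + h] - f (z + h)) - ((P n).[z] - f z)
        - h * ((P n)^`().[z] - g)); last by ring.
      apply: (le_trans (cabsB _ _)); rewrite cabsM.
      have := cabsB ((P n).[z + h] - f (z + h)) ((P n).[z] - f z).
      have : cabs h * cabs ((P n)^`().[z] - g) <= cabs h * (e / (4 * (1 + cabs h))).
        by rewrite ler_wpM2l ?cabs_ge0.
      have : cabs h * (e / (4 * (1 + cabs h))) <= e / 4.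
        rewrite mulrA ler_pdivrMr ?mulr_gt0 ?ltr_wpDr ?cabs_ge0//.
        have := cabs_ge0 h; nra.
      lra.
    by exists n0 => n n0n; apply: taylor1 => // w; exact: PM.
  rewrite /derive1; apply: (@cvg_lim _ (@norm_hausdorff _ _)).
  apply/cvgrPdist_le => e e0.
  have eR : e = ((Re e)%:C)%C by case: e e0 => a b; rewrite ltcE/= => /andP[/eqP -> _].
  have e0' : 0 < Re e by move: e0; rewrite ltcE => /andP[].
  have K0 : 0 <= K.
    rewrite /K divr_ge0 ?sqr_ge0// mulr_ge0// (le_trans (cabs_ge0 _) (PM n0 _ 0 _))//.
    by rewrite cabs0; lra.
  pose d := Num.min (r / 2) (Re e / (1 + K)).
  have d0 : 0 < d by rewrite lt_min !divr_gt0// ltr_wpDr.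
  have dC : 0 < d%:C%C :> R[i] by rewrite ltcR.
  near=> h.
  have h0 : h != 0 by near: h; exact: nbhs_dnbhs_neq.
  have hd : cabs h < d.
    by rewrite -ltcR -cabsE; near: h; exact: (dnbhs0_lt dC).
  rewrite eR (_ : `|_| = (cabs (g - h^-1 * (f (h + z) - f z)))%:C%C); last exact: cabsE.
  rewrite lecR.
  have hp : 0 < cabs h.
    by rewrite lt_neqAle cabs_ge0 eq_sym andbT; apply: contra_neq h0; exact: cabs_eq0.
  have -> : g - h^-1 * (f (h + z) - f z) = - (h^-1 * (f (z + h) - f z - h * g)).
    by rewrite addrC [z + h]addrC; field.
  rewrite cabsN cabsM cabsV mulrC ler_pdivrMr//.
  move: hd; rewrite lt_min => /andP[hd1 hd2].
  apply: (le_trans (fK _ _)); first by lra.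
  rewrite expr2 mulrA ler_wpM2r ?cabs_ge0//.
  move: hd2; rewrite ltr_pdivlMr ?ltr_wpDr//; nra.
move=> e e0; have [N hN] := Pcauchy e e0; exists N => n Nn z zr.
rewrite cabsBC; apply: (@lim_le (fun m => (P m)^`().[z] - (P n)^`().[z])).
  move=> e' e'0; have [N' hN'] := dP z zr _ e'0; exists N' => m N'm.
  by rewrite (_ : _ - _ = (P m)^`().[z] - f^`()%classic z); [exact: hN'|ring].
by exists N => m Nm; exact: hN.
Unshelve. all: by end_near. Qed.

End UniformLimits.

Section RealPolynomialApproximation.
Variable R : realType.
Local Notation C := R[i].
Implicit Types (x u a b r M e : R) (z w h : C) (n m k N : nat) (p q : {poly R}).

Definition evalC p z : C := (map_poly (real_complex R) p).[z].

Definition papprox r (f : C -> C) :=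
  forall e, 0 < e -> exists p, forall z, cabs z <= r -> cabs (evalC p z - f z) <= e.

Lemma papprox_poly r p : papprox r (evalC p).
Proof. by move=> e e0; exists p => z _; rewrite subrr cabs0 ltW. Qed.

Lemma papprox_ext r f g : f =1 g -> papprox r f -> papprox r g.
Proof. by move=> fg h e e0; have [p hp] := h e e0; exists p => z; rewrite -fg; exact: hp. Qed.

Lemma papprox_const r x : papprox r (fun=> x%:C%C).
Proof.
apply: papprox_ext (@papprox_poly r x%:P) => z.
by rewrite /evalC map_polyC poly.hornerC.
Qed.

Lemma papprox_id r : papprox r id.
Proof.
apply: papprox_ext (@papprox_poly r 'X) => z.
by rewrite /evalC map_polyX hornerX.
Qed.

Lemma papprox_bounded r f : papprox r f ->
  exists M, 0 <= M /\ forall z, cabs z <= r -> cabs (f z) <= M.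
Proof.
move=> /(_ 1 ltr01)[p hp].
have [M hM] := poly_bounded (map_poly (real_complex R) p) r.
exists (`|M| + 1); split; first by rewrite addr_ge0.
move=> z zr; have := hp z zr; have := hM z zr; have := ler_norm M.
have := cabsB (evalC p z) (evalC p z - f z).
rewrite (_ : _ - (_ - _) = f z); last by ring.
rewrite /evalC; lra.
Qed.

Lemma papproxD r f g : papprox r f -> papprox r g -> papprox r (fun z => f z + g z).
Proof.
move=> hf hg e e0; have e2 : 0 < e / 2 by rewrite divr_gt0.
have [p hp] := hf _ e2; have [q hq] := hg _ e2.
exists (p + q) => z zr; have {}hp := hp z zr; have {}hq := hq z zr.
rewrite (_ : evalC (p + q) z - _ = (evalC p z - f z) + (evalC q z - g z)).
  by apply: (le_trans (cabsD _ _)); lra.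
by rewrite /evalC rmorphD hornerD; ring.
Qed.

Lemma papproxM r f g : papprox r f -> papprox r g -> papprox r (fun z => f z * g z).
Proof.
move=> hf hg e e0; have [M [M0 fM]] := papprox_bounded hf.
have [M' [M'0 gM]] := papprox_bounded hg.
pose d := Num.min 1 (e / (M + M' + 1)).
have d0 : 0 < d by rewrite lt_min ltr01/= divr_gt0//; lra.
have [p hp] := hf _ d0; have [q hq] := hg _ d0.
exists (p * q) => z zr; have {}hp := hp z zr; have {}hq := hq z zr.
have {}fM := fM z zr; have {}gM := gM z zr.
rewrite (_ : evalC (p * q) z - _ = (evalC p z - f z) * (evalC q z - g z)
   + f z * (evalC q z - g z) + (evalC p z - f z) * g z); last first.
  by rewrite /evalC rmorphM hornerM; ring.
have d1 : d <= 1 by rewrite ge_min lexx.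
have de : d * (M + M' + 1) <= e.
  by rewrite -ler_pdivlMr ?ge_min ?lexx ?orbT//; lra.
set A := evalC p z - f z in hp *; set B := evalC q z - g z in hq *.
have := cabsD (A * B + f z * B) (A * g z); have := cabsD (A * B) (f z * B).
rewrite !cabsM; have := cabs_ge0 A; have := cabs_ge0 B.
have := cabs_ge0 (f z); have := cabs_ge0 (g z) => g0 f0 B0 A0.
have h1 : cabs A * cabs B <= d * 1 by apply: ler_pM => //; apply: le_trans hq d1.
have h2 : cabs (f z) * cabs B <= M * d by apply: ler_pM.
have h3 : cabs A * cabs (g z) <= d * M' by apply: ler_pM.
lra.
Qed.

Lemma papproxX r f n : papprox r f -> papprox r (fun z => f z ^+ n).
Proof.
move=> hf; elim: n => [|n IHn]; first exact: papprox_const.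
by apply: papprox_ext (papproxM hf IHn) => z; rewrite exprS.
Qed.

Lemma papprox_lim r f :
  (forall e, 0 < e -> exists2 g, papprox r g &
     forall z, cabs z <= r -> cabs (g z - f z) <= e) -> papprox r f.
Proof.
move=> h e e0; have e2 : 0 < e / 2 by rewrite divr_gt0.
have [g /(_ _ e2)[p hp] gf] := h _ e2; exists p => z zr.
by apply: (le_trans (cabs_dist _ (g z) _)); have := hp z zr; have := gf z zr; lra.
Qed.

Lemma papprox_cex r f : papprox r f -> papprox r (fun z => cex (f z)).
Proof.
move=> hf; apply: papprox_lim => e e0; have [M [M0 fM]] := papprox_bounded hf.
have [K [K0 hK]] := cex_euler M.
pose N := (Num.truncn (2 * M + K / e)).+1.
have hN : 2 * M + K / e <= N.+1%:R by rewrite (le_trans (ltW (truncnS_gt _)))// ler_nat.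
have Ke : 0 <= K / e by rewrite divr_ge0// ltW.
exists (fun z => (1 + f z / N.+1%:R) ^+ N.+1).
  apply: papproxX; apply: papproxD; first exact: papprox_const.
  apply: papproxM hf _; apply: papprox_ext (@papprox_const r N.+1%:R^-1) => z.
  by rewrite fmorphV rmorph_nat.
move=> z zr; rewrite cabsBC (le_trans (hK N _ (fM z zr) _))//; first by lra.
by rewrite ler_pdivrMr ?ltr0n// -ler_pdivrMl// mulrC; lra.
Qed.

Lemma papprox_sum r (I : Type) (s : seq I) (F : I -> C -> C) :
  (forall i, papprox r (F i)) -> papprox r (fun z => \sum_(i <- s) F i z).
Proof.
move=> hF; elim: s => [|i s IHs].
  by apply: papprox_ext (@papprox_const r 0) => z; rewrite big_nil.
by apply: papprox_ext (papproxD (hF i) IHs) => z; rewrite big_cons.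
Qed.

Lemma WE n t z : W_ n t z = cex (- (2 * cex z - 1) * (ln n%:R)%:C%C)
  * \sum_(v <- externals t) cex (z * (depth v)%:R).
Proof. by []. Qed.

(** The approximating polynomials take over the role of [W_ n t]: they have
    coefficients at [0], to which Cauchy's estimates and Weierstrass's theorem
    apply. That these are real makes the derivatives of the limit at [0] real. *)
Lemma papprox_W r n t : papprox r (W_ n t).
Proof.
apply: papprox_ext (fun z => esym (WE n t z)) _; apply: papproxM.
  apply: papprox_cex; apply: papproxM; last exact: papprox_const.
  apply: (@papprox_ext _ (fun z => (-2)%:C%C * cex z + 1%:C%C)) => [z|].
    by rewrite rmorphN rmorph_nat rmorph1; ring.
  by apply: papproxD (papprox_const _ _); apply: papproxM (papprox_const _ _) (papprox_cex (@papprox_id r)).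
apply: papprox_sum => v; apply: papprox_cex; apply: papproxM (@papprox_id r) _.
by apply: papprox_ext (papprox_const r (depth v)%:R) => z; rewrite rmorph_nat.
Qed.

End RealPolynomialApproximation.

(** * Second moments of the profile generating function *)

Section TreeSums.
Variable R : realType.
Local Notation C := R[i].
Implicit Types (t : bst) (v : node) (z : C).

(** The generating polynomial of the profile of [t]. *)
Definition level_gf t z : C := \sum_(v <- externals t) z ^+ depth v.

Lemma uniq_externals t : uniq (externals t).
Proof.
elim: t => //= l IHl r IHr; rewrite cat_uniq !map_inj_uniq ?IHl ?IHr ?andbT//=; last 2 first.
- by move=> x y [].
- by move=> x y [].
by apply/hasPn => _ /mapP[x _ ->]; apply/mapP => -[].
Qed.

Lemma sum_externals_expand (V : nmodType) (F : nat -> V) t v : v \in externals t ->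
  \sum_(u <- externals (bst_expand t v)) F (depth u) + F (depth v)
  = \sum_(u <- externals t) F (depth u) + F (depth v).+1 *+ 2.
Proof.
elim: t v F => [|l IHl r IHr] v F /=.
  rewrite inE => /eqP -> /=; rewrite /depth/= !big_cons !big_nil/= !addr0.
  by rewrite mulr2n addrC.
rewrite mem_cat => /orP[] /mapP[w wt ->] /=; rewrite !big_cat/= !big_map/=.
  have /= := IHl w (F \o S) wt; rewrite /depth/= => IH.
  by rewrite addrAC IH addrAC.
have /= := IHr w (F \o S) wt; rewrite /depth/= => IH.
by rewrite -addrA IH addrA.
Qed.

Lemma level_gf_expand t v z : v \in externals t ->
  level_gf (bst_expand t v) z = level_gf t z + (2 * z - 1) * z ^+ depth v.
Proof.
move=> vt; have := sum_externals_expand (fun k => z ^+ k) vt.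
rewrite -/(level_gf _ z) -/(level_gf t z) => /eqP; rewrite -subr_eq => /eqP.
rewrite -addrA => <-; rewrite exprS; set a := level_gf _ _; set b := z ^+ _; ring.
Qed.

Lemma cabs_sqrD (z w : C) :
  cabs (z + w) ^+ 2 = cabs z ^+ 2 + 2 * (Re z * Re w + Im z * Im w) + cabs w ^+ 2.
Proof. by rewrite !cabs_sqr; case: z w => [? ?] [? ?] /=; ring. Qed.

(** Since the increments of [level_gf] in the possible steps sum up to a multiple
    of [level_gf] itself, the second moment satisfies a linear recursion; its
    growth factor is governed by [4 Re z - 2], which is less than [2] away from
    [z = 1]. *)
Lemma level_gf_sqr_step t z : cabs z = 1 ->
  \sum_(v <- externals t) cabs (level_gf (bst_expand t v) z) ^+ 2 <=
  ((size (externals t))%:R + (4 * Re z - 2)) * cabs (level_gf t z) ^+ 2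
  + 9 * (size (externals t))%:R.
Proof.
move=> z1; set s := level_gf t z.
have w3 : cabs (2 * z - 1) <= 3.
  by apply: (le_trans (cabsB _ _)); rewrite cabsM cabs1 cabs_nat z1; lra.
have -> : \sum_(v <- externals t) cabs (level_gf (bst_expand t v) z) ^+ 2 =
   \sum_(v <- externals t) (cabs s ^+ 2 + 2 * (Re s * Re ((2 * z - 1) * z ^+ depth v)
     + Im s * Im ((2 * z - 1) * z ^+ depth v)) + cabs (2 * z - 1) ^+ 2).
  rewrite big_seq [RHS]big_seq; apply: eq_bigr => v vt.
  by rewrite level_gf_expand// cabs_sqrD (cabsM _ (z ^+ _)) cabsX z1 expr1n mulr1.
have hc x : \sum_(v <- externals t) x = (size (externals t))%:R * x :> R.
  by rewrite big_const_seq count_predT iter_addr_0 mulr_natl.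
rewrite !big_split/= !hc -(mulr_sumr _ _ _ 2) big_split/=.
rewrite -(mulr_sumr _ _ _ (Re s)) -(mulr_sumr _ _ _ (Im s)).
have -> : \sum_(v <- externals t) Re ((2 * z - 1) * z ^+ depth v) = Re ((2 * z - 1) * s).
  by rewrite /s /level_gf mulr_sumr Re_sum.
have -> : \sum_(v <- externals t) Im ((2 * z - 1) * z ^+ depth v) = Im ((2 * z - 1) * s).
  by rewrite /s /level_gf mulr_sumr Im_sum.
have -> : Re s * Re ((2 * z - 1) * s) + Im s * Im ((2 * z - 1) * s) = (2 * Re z - 1) * cabs s ^+ 2.
  rewrite cabs_sqr; case: (s) => a b; case: (z) => c d.
  rewrite ReM ImM ReB ReM /= ; ring.
have := cabs_ge0 (2 * z - 1); set q := cabs (2 * z - 1) in w3 * => q0.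
have : q ^+ 2 <= 9 by nra.
have : (0 : R) <= (size (externals t))%:R by rewrite ler0n.
set m := _%:R; set c := cabs s ^+ 2; nra.
Qed.

Lemma level_gf_expand_dist t v z : cabs z = 1 -> v \in externals t ->
  cabs (level_gf (bst_expand t v) z - level_gf t z) <= 3.
Proof.
move=> z1 vt; rewrite level_gf_expand// addrC addKr cabsM cabsX z1 expr1n mulr1.
by apply: (le_trans (cabsB _ _)); rewrite cabsM cabs1 cabs_nat z1; lra.
Qed.

Fixpoint bst_code t : GenTree.tree unit :=
  match t with
  | External => GenTree.Leaf tt
  | Internal l r => GenTree.Node 0 [:: bst_code l; bst_code r]
  end.

Fixpoint bst_decode (c : GenTree.tree unit) : option bst :=
  match c with
  | GenTree.Leaf _ => Some External
  | GenTree.Node _ [:: c1; c2] =>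
      if (bst_decode c1, bst_decode c2) is (Some l, Some r) then Some (Internal l r)
      else None
  | _ => None
  end.

Lemma bst_codeK : pcancel bst_code bst_decode.
Proof. by elim=> //= l -> r ->. Qed.

End TreeSums.

HB.instance Definition _ := Countable.copy bst (pcan_type bst_codeK).

Section MeanSquare.
Context (R : realType) (d : measure_display) (Omega : measurableType d)
  (P : probability Omega R) (T : nat -> Omega -> bst) (V : nat -> Omega -> node).
Hypothesis hT : bst_process P T V.
Local Notation C := R[i].

Lemma measurable_countable_preimage (I : countType) (X : Omega -> I) (Y : set I) :
  (forall i, measurable (X @^-1` [set i])) -> measurable (X @^-1` Y).
Proof.
move=> mX; rewrite (_ : X @^-1` Y =
    \bigcup_(k in [set: nat]) [set w | Y (X w) /\ pickle (X w) = k]); last first.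
  by apply/seteqP; split => [w Yw|w [k _ []]//]; exists (pickle (X w)).
apply: bigcup_measurable => k _.
have [[i [Yi ik]]|ni] := pselect (exists i, Y i /\ pickle i = k).
  rewrite (_ : [set _ | _] = X @^-1` [set i]) //.
  apply/seteqP; split => w /=; last by move=> ->.
  by move=> [_]; rewrite -ik => /(pcan_inj pickleK).
rewrite (_ : [set _ | _] = set0)//; apply/seteqP; split => // w /= h.
by apply: ni; exists (X w).
Qed.

Lemma measurable_tree (F : bst -> R) n :
  measurable_fun [set: Omega] (fun w => F (T n w)).
Proof.
move=> _ Y mY; rewrite setTI.
exact: (@measurable_countable_preimage _ (T n) (F @^-1` Y) (bst_measT hT n)).
Qed.

Lemma size_externals_process n w : size (externals (T n w)) = n.+1.
Proof.
elim: n => [|n IHn]; first by rewrite (bst_init hT).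
by rewrite (bst_step hT) size_externals_bst_expand ?(bst_pick hT)// IHn.
Qed.

Definition next_mean (F : bst -> R) (t : bst) : R :=
  (size (externals t))%:R^-1 * \sum_(v <- externals t) F (bst_expand t v).

Lemma next_mean_ge0 F t : (forall t, 0 <= F t) -> 0 <= next_mean F t.
Proof. by move=> F0; rewrite mulr_ge0// sumr_ge0. Qed.

Local Open Scope ereal_scope.

Lemma integral_history F n (h : nat -> bst) : (forall t, 0 <= F t)%R ->
  let A := [set w | forall i, (i <= n)%N -> T i w = h i] in
  \int[P]_(w in A) (F (T n.+1 w))%:E = \int[P]_(w in A) (next_mean F (T n w))%:E.
Proof.
move=> F0 A.
have mA : measurable A.
  rewrite (_ : A = \bigcap_(i in [set i | (i <= n)%N]) (T i @^-1` [set h i])).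
    by apply: bigcap_measurableType => i _; exact: (bst_measT hT).
  by apply/seteqP; split => w hw i /=; exact: hw.
have mV v : measurable (V n @^-1` [set v]) by exact: (bst_measV hT).
transitivity (\int[P]_(w in A) \sum_(v <- externals (h n))
    ((F (bst_expand (h n) v))%:E * (\1_(V n @^-1` [set v]) w)%:E)).
  apply: eq_integral => w; rewrite inE => Aw.
  rewrite (bst_step hT) -(Aw n (leqnn n)).
  rewrite (bigD1_seq (V n w)) ?(bst_pick hT) ?uniq_externals//=.
  rewrite indicE mem_set// mule1 big1 ?adde0// => v vV.
  by rewrite indicE memNset ?mule0//= => /esym/eqP; rewrite (negbTE vV).
rewrite ge0_integral_sum//=; last 2 first.
- move=> v; apply: measurable_funeM; apply/measurable_EFinP.
  exact: measurable_indic.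
- by move=> v w _; rewrite -EFinM lee_fin mulr_ge0.
transitivity (\sum_(v <- externals (h n)) ((F (bst_expand (h n) v))%:E *
   (P A * ((size (externals (h n)))%:R^-1)%:E))).
  rewrite big_seq [RHS]big_seq; apply: eq_bigr => v vh.
  rewrite ge0_integralZl_EFin//; last first.
    by apply/measurable_EFinP; exact: measurable_indic.
  rewrite integral_indic// setIC; congr (_ * _).
  exact: bst_uniform hT n h v vh.
transitivity (\int[P]_(w in A) (next_mean F (h n))%:E).
  rewrite integral_cst// /next_mean -(@fineK _ (P A)) ?fin_num_measure//.
  under eq_bigr do rewrite -!EFinM.
  rewrite sumEFin; transitivity ((next_mean F (h n))%:E * (fine (P A))%:E); last first.
    by congr (_ * _); rewrite fineK ?fin_num_measure.
  rewrite -EFinM; congr EFin; rewrite /next_mean mulr_sumr mulr_suml.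
  by apply: eq_bigr => v _; ring.
by apply: eq_integral => w; rewrite inE => Aw; rewrite (Aw n).
Qed.

(** The law of the next step is given for every single history. As there are only
    countably many trees, the space splits into countably many events, each with
    one history up to time [n]. *)
Lemma integral_step F n : (forall t, 0 <= F t)%R ->
  \int[P]_w (F (T n.+1 w))%:E = \int[P]_w (next_mean F (T n w))%:E.
Proof.
move=> F0; pose H w := [seq T i w | i <- iota 0 n.+1].
pose A k := [set w | pickle (H w) = k].
have HP w w' : H w = H w' <-> forall i, (i <= n)%N -> T i w = T i w'.
  split=> [/eq_in_map h i ni|h]; first by apply: h; rewrite mem_iota.
  by apply/eq_in_map => i; rewrite mem_iota => /andP[_]; exact: h.
have AE k w0 : A k w0 -> A k = [set w | forall i, (i <= n)%N -> T i w = T i w0].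
  move=> Ak; apply/seteqP; split => w /=.
    by rewrite /A/= -Ak => /(pcan_inj pickleK)/HP.
  by move=> /HP; rewrite /A/= => ->.
have mA k : measurable (A k).
  have [[w0 Ak]|nA] := pselect (exists w, A k w); last first.
    by rewrite (_ : A k = set0)//; apply/seteqP; split => // w Aw; apply: nA; exists w.
  rewrite (AE _ _ Ak) (_ : [set _ | _] = \bigcap_(i in [set i | (i <= n)%N]) (T i @^-1` [set T i w0])).
    by apply: bigcap_measurableType => i _; exact: (bst_measT hT).
  by apply/seteqP; split => w hw i /=; exact: hw.
have UA : [set: Omega] = \bigcup_k A k.
  by apply/seteqP; split => // w _; exists (pickle (H w)).
have tA : trivIset setT A.
  by apply/trivIsetP => i j _ _ ij; apply/seteqP; split => // w [/= Ai Aj]; case/eqP: ij; rewrite -Ai -Aj.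
rewrite UA !ge0_integral_bigcup//; last 4 first.
- by rewrite -UA; apply/measurable_EFinP; exact: measurable_tree.
- by move=> w _; rewrite lee_fin next_mean_ge0.
- by rewrite -UA; apply/measurable_EFinP; exact: measurable_tree.
- by move=> w _; rewrite lee_fin.
apply: eq_eseriesr => k _.
have [[w0 Ak]|nA] := pselect (exists w, A k w).
  by rewrite (AE _ _ Ak); exact: (@integral_history F n (fun i => T i w0)).
rewrite (_ : A k = set0) ?integral_set0//.
by apply/seteqP; split => // w Aw; apply: nA; exists w.
Qed.

Local Close Scope ereal_scope.

Lemma sum_inv_le_ln n : \sum_(i < n.+1) (i.+1%:R)^-1 <= 1 + ln n.+1%:R :> R.
Proof.
elim: n => [|n IHn]; first by rewrite big_ord1 ln1 addr0 invr1.
rewrite big_ord_recr/= (le_trans (lerD IHn (lexx _)))//.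
rewrite -addrA lerD2l -lerBrDl.
have n1 : (0 : R) < n.+1%:R by rewrite ltr0n.
have n2 : (0 : R) < n.+2%:R by rewrite ltr0n.
have h : ln (1 + - (n.+2%:R)^-1) <= - (n.+2%:R)^-1 :> R.
  by rewrite le_ln1Dx// ltrNr opprK invf_lt1// ltr1n.
move: h; rewrite (_ : 1 + - _ = n.+1%:R / n.+2%:R :> R).
  by rewrite ln_div ?posrE// lerNr opprB.
by rewrite -[in RHS](addrK 1 n.+1%:R) natr1 mulrBl divff ?gt_eqF// mul1r.
Qed.

(** By [level_gf_sqr_step] the second moment is multiplied by about [1 + c / i] in
    step [i], and the product of these factors is of the order [n ^ c]; it is
    important that one may take [c < 2] away from the point 1. *)
Lemma mean_square_le (c : R) (z : C) n : 3 / 2 <= c -> cabs z = 1 -> 4 * Re z - 2 <= c ->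
  (0 < n)%N ->
  (\int[P]_w (cabs (level_gf (T n w) z) ^+ 2)%:E <= (19 * expR (c * (1 + ln n%:R)))%:E)%E.
Proof.
move=> c32 z1 zc.
have PT : P [set: Omega] = 1%E by exact: probability_setT.
pose B n : R := 19 * \prod_(i < n) (1 + c / i.+1%:R) - 18 * n.+1%:R.
(* The term linear in the time absorbs the constant 9 of [level_gf_sqr_step], since
   [18 * c >= 18 + 9]; the factor 19 then fits the initial value 1. *)
have key m : (\int[P]_w (cabs (level_gf (T m w) z) ^+ 2)%:E <= (B m)%:E)%E.
  elim: m => [|m IHm].
    rewrite (eq_integral (cst 1%E)) => [|w _]; last first.
      by rewrite (bst_init hT) /level_gf big_seq1 expr0 cabs1 expr1n.
    rewrite integral_cst// -[X in (_ * X)%E]/(P [set: Omega]) PT mule1 lee_fin /B big_ord0; lra.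
  rewrite (@integral_step (fun t => cabs (level_gf t z) ^+ 2)) => [|t]; last by rewrite sqr_ge0.
  have m0 : (0 : R) < m.+1%:R by rewrite ltr0n.
  pose a : R := 1 + c / m.+1%:R.
  have a0 : 0 <= a by rewrite addr_ge0// divr_ge0//; lra.
  apply: (@le_trans _ _ (\int[P]_w (a%:E * (cabs (level_gf (T m w) z) ^+ 2)%:E + 9%:E))%E).
    apply: ge0_le_integral => //=.
    - by move=> w _; rewrite lee_fin next_mean_ge0// => t; rewrite sqr_ge0.
    - by apply/measurable_EFinP; exact: measurable_tree.
    - apply: emeasurable_funD => //; apply: measurable_funeM; apply/measurable_EFinP.
      exact: (measurable_tree (fun t => cabs (level_gf t z) ^+ 2)).
    - move=> w _; rewrite -EFinM -EFinD lee_fin /next_mean size_externals_process.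
      rewrite mulrC ler_pdivrMr//; apply: (le_trans (level_gf_sqr_step _ z1)).
      rewrite size_externals_process.
      have am : a * m.+1%:R = m.+1%:R + c by rewrite /a; field; rewrite addrC natr1 gt_eqF.
      have -> : (a * cabs (level_gf (T m w) z) ^+ 2 + 9) * m.+1%:R =
          (m.+1%:R + c) * cabs (level_gf (T m w) z) ^+ 2 + 9 * m.+1%:R by rewrite -am; ring.
      by rewrite lerD2r ler_wpM2r ?sqr_ge0// lerD2l.
  rewrite ge0_integralD//=; last 2 first.
  - by move=> w _; rewrite -EFinM lee_fin mulr_ge0// sqr_ge0.
  - apply: measurable_funeM; apply/measurable_EFinP.
    exact: (measurable_tree (fun t => cabs (level_gf t z) ^+ 2)).
  rewrite ge0_integralZl_EFin//=; last 2 first.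
  - by move=> w _; rewrite lee_fin sqr_ge0.
  - by apply/measurable_EFinP; exact: (measurable_tree (fun t => cabs (level_gf t z) ^+ 2)).
  rewrite integral_cst// -[X in (_ + _ * X)%E]/(P [set: Omega]) PT mule1.
  apply: (@le_trans _ _ (a%:E * (B m)%:E + 9%:E)%E); first by rewrite leeD2r// lee_wpmul2l// lee_fin.
  rewrite -EFinM -EFinD lee_fin /B big_ord_recr/= -/a -(natr1 m.+1).
  set p := \prod_(i < m) _.
  have : a * m.+1%:R = m.+1%:R + c by rewrite /a; field; rewrite addrC natr1 gt_eqF.
  nra.
case: n => // n _; apply: (le_trans (key _)); rewrite lee_fin /B.
rewrite (@le_trans _ _ (19 * \prod_(i < n.+1) (1 + c / i.+1%:R)))//.
  by rewrite gerBl mulr_ge0.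
rewrite ler_pM2l//.
have : \prod_(i < n.+1) (1 + c / i.+1%:R) <= \prod_(i < n.+1) expR (c / i.+1%:R).
  apply: ler_prod => i _; rewrite expR_ge1Dx andbT addr_ge0// divr_ge0//; lra.
move=> /le_trans; apply; rewrite -expR_sum ler_expR -mulr_sumr ler_wpM2l//; first by lra.
exact: sum_inv_le_ln.
Qed.

End MeanSquare.

(** * Almost sure bounds away from the real axis *)

Section SummableMeans.
Context (R : realType) (d : measure_display) (Omega : measurableType d)
  (P : probability Omega R).

(** The sum of the [Z j] has a finite mean, so it is finite almost surely, and it
    bounds each of its terms. *)
Lemma ae_bounded_of_summable_means (Z : nat -> Omega -> R) (b : nat -> R) (B : R) :
  (forall j, measurable_fun [set: Omega] (Z j)) -> (forall j w, 0 <= Z j w) ->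
  (forall j, (\int[P]_w (Z j w)%:E <= (b j)%:E)%E) ->
  (forall n, \sum_(0 <= j < n) b j <= B) ->
  {ae P, forall w, exists M, forall j, Z j w <= M}.
Proof.
move=> mZ Z0 Zb bB.
pose f w : \bar R := (\sum_(j <oo) (Z j w)%:E)%E.
have mZE j : measurable_fun [set: Omega] (fun w => (Z j w)%:E).
  by apply/measurable_EFinP.
have mf : measurable_fun [set: Omega] f.
  by apply: ge0_emeasurable_sum => // j w _ _; rewrite lee_fin.
have f0 w : (0 <= f w)%E by apply: nneseries_ge0 => j _ _; rewrite lee_fin.
have intf : P.-integrable [set: Omega] f.
  apply/integrableP; split => //.
  rewrite (eq_integral f) => [|w _]; last by rewrite gee0_abs.
  rewrite integral_nneseries//; last by move=> j w _; rewrite lee_fin.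
  apply: (@le_lt_trans _ _ B%:E); last by rewrite ltry.
  apply: lime_le.
    by apply: is_cvg_nneseries => j _ _; apply: integral_ge0 => w _; rewrite lee_fin.
  apply: nearW => n; apply: (@le_trans _ _ (\sum_(0 <= j < n) (b j)%:E)%E).
    by apply: lee_sum => j _; exact: Zb.
  by rewrite sumEFin lee_fin.
have := integrable_ae measurableT intf.
apply: filterS => w /(_ I) fw; exists (fine (f w)) => j.
rewrite -lee_fin fineK//.
apply: le_trans (@nneseries_lim_ge R (fun j => (Z j w)%:E) xpredT 0 j.+1 _); last first.
  by move=> n _ _; rewrite lee_fin.
rewrite big_nat_recr//= leeDr// sume_ge0// => i _.
by rewrite lee_fin.
Qed.

End SummableMeans.

Section FarZone.
Context (R : realType) (d : measure_display) (Omega : measurableType d)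
  (P : probability Omega R) (T : nat -> Omega -> bst) (V : nat -> Omega -> node).
Hypothesis hT : bst_process P T V.
Local Notation C := R[i].

(** The grid used for the trees with [j.+1 ^ p] to [j.+2 ^ p] internal nodes: it
    has more points than the depth of such a tree. *)
Definition grid_size p j := (j.+2 ^ p).+1.

Definition far_mean_square p (ca : R) j (t : bst) : R :=
  (grid_size p j)%:R^-1 * \sum_(i < grid_size p j | cos (grid R (grid_size p j) i) < ca)
    cabs (level_gf t (cis (grid R (grid_size p j) i))) ^+ 2.

(** The growth exponent [2 - 4 / p] of the second moments, at time [m = j.+1 ^ p],
    turns into a factor [j.+1 ^ - 4] besides [m ^ 2]. *)
Lemma mean_far_mean_square p ca j : (8 <= p)%N -> 4 * ca - 2 <= 2 - 4 / p%:R ->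
  (\int[P]_w (far_mean_square p ca j (T (j.+1 ^ p) w))%:E <=
    (19 * expR 2 * ((j.+1 ^ p)%:R ^+ 2 / j.+1%:R ^+ 4))%:E)%E.
Proof.
move=> p8 hca; set N := grid_size p j; set m := (j.+1 ^ p)%N.
have p0 : (0 : R) < p%:R by rewrite ltr0n; lia.
have N0 : (0 : R) < N%:R by rewrite ltr0n.
have j0 : (0 : R) < j.+1%:R by rewrite ltr0n.
have pR : (8 : R) <= p%:R by rewrite ler_nat.
pose c : R := 2 - 4 / p%:R.
have c32 : 3 / 2 <= c.
  have : 4 / p%:R <= 1 / 2 :> R by rewrite ler_pdivrMr//; lra.
  rewrite /c; lra.
have c2 : c <= 2 by rewrite /c gerBl divr_ge0// ltW.
pose K := 19 * expR (c * (1 + ln m%:R)) : R.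
have m0 : (0 < m)%N by rewrite expn_gt0.
pose X (i : 'I_N) w : \bar R := (cabs (level_gf (T m w) (cis (grid R N i))) ^+ 2)%:E.
have mX i : measurable_fun [set: Omega] (X i).
  apply/measurable_EFinP.
  exact: (measurable_tree hT (fun t => cabs (level_gf t (cis (grid R N i))) ^+ 2)).
have X0 i w : (0 <= X i w)%E by rewrite lee_fin sqr_ge0.
have -> : (\int[P]_w (far_mean_square p ca j (T m w))%:E =
    (N%:R^-1)%:E * \sum_(i <- [seq i : 'I_N <- index_enum 'I_N | (cos (grid R N i) < ca)%R]) \int[P]_w X i w)%E.
  rewrite -ge0_integral_sum// -ge0_integralZl_EFin//; last 2 first.
  - by move=> w _; apply: sume_ge0.
  - by apply: emeasurable_sum.
  by apply: eq_integral => w _; rewrite /far_mean_square -/N EFinM -sumEFin big_filter.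
rewrite big_filter.
apply: (@le_trans _ _ ((N%:R^-1)%:E * (\sum_(i < N) K%:E))%E).
  apply: lee_wpmul2l; first by rewrite lee_fin invr_ge0 ltW.
  rewrite big_mkcond; apply: lee_sum => i _.
  case: ifPn => [ci|_]; last by rewrite lee_fin mulr_ge0// expR_ge0.
  apply: (mean_square_le hT) => //; first exact: cabs_cis.
  by rewrite cisE /=; apply: le_trans hca; lra.
rewrite sumEFin sumr_const card_ord -EFinM lee_fin -[K *+ N]mulr_natl mulKf ?gt_eqF//.
rewrite /K -mulrA ler_pM2l//.
rewrite mulrDr mulr1 expRD ler_pM// ?expR_ge0//; first by rewrite ler_expR.
rewrite ler_pdivlMr ?exprn_gt0// /m natrX lnXn// -exprM.
have eL n : j.+1%:R ^+ n = expR (n%:R * ln j.+1%:R) :> R by rewrite expRM_natl lnK ?posrE.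
rewrite !eL -expRD ler_expR.
have -> : c * (ln j.+1%:R *+ p) = c * p%:R * ln j.+1%:R :> R.
  by rewrite -[_ *+ p]mulr_natl mulrA.
have -> : c * p%:R = 2 * p%:R - 4 :> R by rewrite /c; field; rewrite gt_eqF.
by rewrite natrM le_eqVlt; apply/orP; left; apply/eqP; ring.
Qed.

(** Two of the four powers of [j.+1] make the means summable, and the other two
    remain in the bound. *)
Lemma far_mean_square_ae p ca : (8 <= p)%N -> 4 * ca - 2 <= 2 - 4 / p%:R ->
  {ae P, forall w, exists M, forall j,
    far_mean_square p ca j (T (j.+1 ^ p) w) <= M * ((j.+1 ^ p)%:R / j.+1%:R) ^+ 2}.
Proof.
move=> p8 hca.
pose s j : R := j.+1%:R ^+ 2 / (j.+1 ^ p)%:R ^+ 2.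
have s0 j : 0 < s j by rewrite divr_gt0// exprn_gt0// ltr0n ?expn_gt0.
have F0 j t : 0 <= far_mean_square p ca j t.
  by rewrite mulr_ge0// ?invr_ge0// sumr_ge0// => i _; rewrite sqr_ge0.
have mF j : measurable_fun [set: Omega] (fun w => far_mean_square p ca j (T (j.+1 ^ p) w)).
  exact: measurable_tree hT (far_mean_square p ca j) _.
have h1 j w : 0 <= s j * far_mean_square p ca j (T (j.+1 ^ p) w).
  by rewrite mulr_ge0// ltW.
have h2 j : measurable_fun [set: Omega] (fun w => s j * far_mean_square p ca j (T (j.+1 ^ p) w)).
  by apply: measurable_funM => //; exact: measurable_cst.
pose b j : R := 38 * expR 2 * ((j.+1%:R)^-1 - (j.+2%:R)^-1).
have := @ae_bounded_of_summable_means R d Omega P _ b (38 * expR 2) h2 h1.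
have hb j : (\int[P]_w (s j * far_mean_square p ca j (T (j.+1 ^ p) w))%:E <= (b j)%:E)%E.
  under eq_integral do rewrite EFinM.
  rewrite ge0_integralZl_EFin//; last 3 first.
  - by move=> w _; rewrite lee_fin.
  - by apply/measurable_EFinP.
  - by rewrite ltW.
  apply: (le_trans (lee_wpmul2l _ (mean_far_mean_square j p8 hca))).
    by rewrite lee_fin ltW.
  rewrite -EFinM lee_fin /b /s.
  have j1 : (1 : R) <= j.+1%:R by rewrite ler1n.
  have m0 : (0 : R) < (j.+1 ^ p)%:R by rewrite ltr0n expn_gt0.
  rewrite -[j.+2%:R]natr1; set x := j.+1%:R in j1 *; set m := _%:R in m0 *.
  have x0 : 0 < x by lra.
  have -> : x ^+ 2 / m ^+ 2 * (19 * expR 2 * (m ^+ 2 / x ^+ 4)) = 19 * expR 2 * (1 / x ^+ 2).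
    by field; rewrite !gt_eqF.
  have -> : 38 * expR 2 * (x^-1 - (x + 1)^-1) = 19 * expR 2 * (2 / (x * (x + 1))).
    by field; rewrite !gt_eqF//; lra.
  rewrite ler_wpM2l ?mulr_ge0 ?expR_ge0//.
  rewrite ler_pdivrMr ?exprn_gt0// mulrAC ler_pdivlMr ?mulr_gt0//; last by lra.
  by nra.
have hB n : \sum_(0 <= j < n) b j <= 38 * expR 2.
  rewrite -mulr_sumr ler_piMr ?mulr_ge0 ?expR_ge0//.
  have -> : \sum_(0 <= j < n) ((j.+1%:R)^-1 - (j.+2%:R)^-1) = 1 - (n.+1%:R)^-1 :> R.
    elim: n => [|n IHn]; first by rewrite big_geq// invr1 subrr.
    by rewrite big_nat_recr//= IHn; ring.
  by rewrite gerBl invr_ge0.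
move=> /(_ hb hB); apply: filterS => w [M hM]; exists M => j.
have := hM j; rewrite mulrC -ler_pdivlMr// => /le_trans; apply.
by rewrite /s invf_div expr_div_n.
Qed.

End FarZone.

(** * Exponential tails and Taylor bounds *)

Section ExponentialTails.
Variable R : realType.
Local Notation C := R[i].
Implicit Types (x q u c : R) (z : C) (n m k N M : nat).

Definition exp_partial N x : R := \sum_(k < N) x ^+ k / k`!%:R.

Lemma exp_partial_ge0 N x : 0 <= x -> 0 <= exp_partial N x.
Proof. by move=> x0; apply: sumr_ge0 => k _; rewrite divr_ge0// exprn_ge0. Qed.

Lemma exp_partial_cvg x : exp_partial N x @[N --> \oo] --> expR x.
Proof.
rewrite (_ : (fun N => exp_partial N x) = series (exp_coeff x)).
  exact: is_cvg_series_exp_coeff.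
by apply/funext => N; rewrite /exp_partial /series/= big_mkord.
Qed.

Lemma exp_partial_le N x : 0 <= x -> exp_partial N x <= expR x.
Proof.
move=> x0; have := @exp_partial_cvg x => cv.
rewrite -(cvg_lim (@Rhausdorff R) cv).
apply: (@nondecreasing_cvgn_le _ (fun N => exp_partial N x)); last by apply/cvg_ex; exists (expR x).
apply/nondecreasing_seqP => m; rewrite /exp_partial big_ord_recr/= lerDl.
by rewrite divr_ge0// exprn_ge0.
Qed.

Definition exp_tail N x : R := expR x - exp_partial N x.

(** For [N <= k] one has [x ^ k <= q ^ N * (x / q) ^ k]. *)
Lemma exp_tail_le N x q : 0 <= x -> 0 < q <= 1 -> exp_tail N x <= q ^+ N * expR (x / q).
Proof.
move=> x0 /andP[q0 q1]; rewrite /exp_tail lerBlDr.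
have cv := @exp_partial_cvg x; rewrite -(cvg_lim (@Rhausdorff R) cv).
apply: limr_le; first by apply/cvg_ex; exists (expR x).
exists N => // M /= NM; rewrite addrC -lerBlDl.
apply: (@le_trans _ _ (q ^+ N * exp_partial M (x / q))); last first.
  by rewrite ler_wpM2l ?exprn_ge0 ?exp_partial_le ?divr_ge0// ltW.
rewrite /exp_partial -(big_mkord xpredT (fun k => x ^+ k / k`!%:R)).
rewrite -(big_mkord xpredT (fun k => x ^+ k / k`!%:R)).
rewrite -(big_mkord xpredT (fun k => (x / q) ^+ k / k`!%:R)).
rewrite (@big_cat_nat _ _ _ N 0 M)//= addrAC subrr add0r.
rewrite mulr_sumr [leRHS](@big_cat_nat _ _ _ N 0 M)//= -[leLHS]add0r lerD//.
  apply: sumr_ge0 => k _; rewrite !mulr_ge0// ?exprn_ge0 ?divr_ge0//; exact: ltW.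
rewrite big_nat [leRHS]big_nat; apply: ler_sum => k /andP[Nk _].
rewrite mulrA ler_wpM2r// expr_div_n mulrCA ler_peMr ?exprn_ge0//.
rewrite ler_pdivlMr ?exprn_gt0// mul1r.
by apply: ler_wiXn2l => //; exact: ltW.
Qed.

Lemma exp_tail_ge0 N x : 0 <= x -> 0 <= exp_tail N x.
Proof. by move=> x0; rewrite subr_ge0 exp_partial_le. Qed.

Lemma bin_coef_bounds M k : (0 < M)%N ->
  (1 - k%:R ^+ 2 / M%:R) / k`!%:R <= ('C(M, k)%:R / M%:R ^+ k : R) <= (k`!%:R)^-1.
Proof.
move=> M0; have MR : (0 : R) < M%:R by rewrite ltr0n.
have fk : (0 : R) < k`!%:R by rewrite ltr0n fact_gt0.
have -> : 'C(M, k)%:R / M%:R ^+ k = ((M ^_ k)%:R / M%:R ^+ k) / k`!%:R :> R.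
  by rewrite -bin_ffact natrM mulrAC mulfK ?gt_eqF.
rewrite ler_pM2r ?invr_gt0// -[X in _ && (_ <= X)]mul1r ler_pM2r ?invr_gt0//.
elim: k {fk} => [|k /andP[IH1 IH2]].
  by rewrite ffactn0 expr0 divr1 expr0n/= mul0r subr0 lexx.
have r0 : 0 <= (M ^_ k)%:R / M%:R ^+ k :> R by rewrite divr_ge0// exprn_ge0.
have -> : (M ^_ k.+1)%:R / M%:R ^+ k.+1 = (M ^_ k)%:R / M%:R ^+ k * ((M - k)%:R / M%:R) :> R.
  by rewrite ffactnSr natrM exprSr invfM -!mulrA; congr (_ * _); rewrite mulrCA.
have h1 : (M - k)%:R / M%:R <= 1 :> R by rewrite ler_pdivrMr// mul1r ler_nat leq_subr.
have h0 : 0 <= (M - k)%:R / M%:R :> R by rewrite divr_ge0.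
have h2 : 1 - k%:R / M%:R <= (M - k)%:R / M%:R :> R.
  have -> : 1 - k%:R / M%:R = (M%:R - k%:R) / M%:R :> R by rewrite mulrBl divff ?gt_eqF.
  rewrite ler_pM2r ?invr_gt0//.
  have [kM|/ltnW kM] := leqP k M; first by rewrite natrB.
  by rewrite (_ : (M - k)%N = 0%N) ?subr_le0 ?ler_nat//; apply/eqP.
apply/andP; split; last by apply: mulr_ile1.
have k0 : 0 <= k%:R / M%:R :> R by rewrite divr_ge0.
have -> : k.+1%:R ^+ 2 / M%:R = k%:R ^+ 2 / M%:R + 2 * (k%:R / M%:R) + M%:R^-1 :> R.
  by rewrite -natr1; field; rewrite gt_eqF.
have : 0 < M%:R^-1 :> R by rewrite invr_gt0.
move: IH1 IH2 r0 h1 h0 h2 k0; set r := _ / _ ^+ k; set s := (M - k)%:R / _; set t := k%:R / _.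
set y := k%:R ^+ 2 / _; set i := M%:R^-1; nra.
Qed.

(** The exponential series with the remainder that absolute values give.  Euler's
    limit is expanded by the binomial theorem, and its coefficients are compared
    with those of the series. *)
Lemma cex_series_tail N z :
  cabs (cex z - \sum_(k < N) z ^+ k / k`!%:R) <= exp_tail N (cabs z).
Proof.
set x := cabs z; have x0 : 0 <= x := cabs_ge0 z.
have [K [K0 hK]] := @cex_euler R x.
apply/ler_addgt0Pr => e e0.
pose E := exp_partial N x.
have E0 : 0 <= E by exact: exp_partial_ge0.
pose M0 := (Num.truncn (2 * x + (K + 2 * N%:R ^+ 2 * E) / e) + N).+1.
pose M := M0.+1.
have KE : 0 <= K + 2 * N%:R ^+ 2 * E by rewrite addr_ge0// !mulr_ge0// exprn_ge0.
have KEe : 0 <= (K + 2 * N%:R ^+ 2 * E) / e by rewrite divr_ge0// ltW.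
have hM0 : 2 * x + (K + 2 * N%:R ^+ 2 * E) / e <= M%:R.
  apply: (le_trans (ltW (truncnS_gt _))); by rewrite ler_nat /M /M0 !ltnS leqW// leq_addr.
have MR : (0 : R) < M%:R by rewrite ltr0n.
have h1 : cabs (cex z - (1 + z / M%:R) ^+ M) <= K / M%:R.
  by apply: hK => //; apply: le_trans hM0; rewrite lerDl.
have NM : (N <= M.+1)%N by rewrite /M /M0 !leqW// leq_addl.
pose b k : R := 'C(M, k)%:R / M%:R ^+ k.
pose bC k : C := 'C(M, k)%:R / M%:R ^+ k.
have bCE k : cabs (bC k) = b k by rewrite /bC cabsM cabsV cabsX !cabs_nat.
have binE (V : comUnitRingType) (y : V) : (1 + y / M%:R) ^+ M =
    \sum_(0 <= k < M.+1) 'C(M, k)%:R / M%:R ^+ k * y ^+ k.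
  rewrite exprDn big_mkord; apply: eq_bigr => k _.
  by rewrite expr1n mul1r exprMn exprVn -mulr_natl -mulrA [in RHS](mulrC _ (y ^+ k)).
have hb k : (1 - k%:R ^+ 2 / M%:R) / k`!%:R <= b k <= (k`!%:R)^-1 by exact: bin_coef_bounds.
have b0 k : 0 <= b k by rewrite divr_ge0// exprn_ge0.
have h2 : cabs ((1 + z / M%:R) ^+ M - \sum_(k < N) z ^+ k / k`!%:R) <=
    E - 2 * (\sum_(0 <= k < N) b k * x ^+ k) + expR x.
  rewrite binE (@big_cat_nat _ _ _ N 0 M.+1)//= -(big_mkord xpredT (fun k => z ^+ k / k`!%:R)).
  rewrite addrAC -sumrB; apply: (le_trans (cabsD _ _)).
  have t1 : cabs (\sum_(0 <= k < N) ('C(M, k)%:R / M%:R ^+ k * z ^+ k - z ^+ k / k`!%:R)) <=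
      E - \sum_(0 <= k < N) b k * x ^+ k.
    rewrite /E /exp_partial -(big_mkord xpredT (fun k => x ^+ k / k`!%:R)) -sumrB.
    apply: (le_trans (cabs_sum _ _ _)); apply: ler_sum => k _.
    rewrite [z ^+ k / _]mulrC -mulrBl cabsM cabsX -/x [x ^+ k / _]mulrC -mulrBl.
    rewrite ler_wpM2r ?exprn_ge0//.
    have /andP[_ hbk] := hb k.
    have -> : 'C(M, k)%:R / M%:R ^+ k - (k`!%:R)^-1 = ((b k - (k`!%:R)^-1)%:C)%C :> C.
      by rewrite rmorphB/= fmorphV rmorphM/= fmorphV rmorphXn/= !rmorph_nat.
    by rewrite cabsR ler0_norm ?subr_le0// opprB.
  have t2 : cabs (\sum_(N <= k < M.+1) 'C(M, k)%:R / M%:R ^+ k * z ^+ k) <=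
      expR x - \sum_(0 <= k < N) b k * x ^+ k.
    rewrite lerBrDl; apply: (@le_trans _ _ (\sum_(0 <= k < N) b k * x ^+ k + \sum_(N <= k < M.+1) b k * x ^+ k)).
      rewrite lerD2l; apply: (le_trans (cabs_sum _ _ _)); apply: ler_sum => k _.
      by rewrite cabsM cabsX -bCE.
    rewrite -big_cat_nat//= -binE.
    apply: (@le_trans _ _ (expR (x / M%:R) ^+ M)).
      by rewrite lerXn2r ?nnegrE ?expR_ge0 ?addr_ge0 ?divr_ge0// expR_ge1Dx.
    by rewrite -expRM_natl mulrC divfK ?gt_eqF.
  lra.
have h3 : E - N%:R ^+ 2 / M%:R * E <= \sum_(0 <= k < N) b k * x ^+ k.
  rewrite /E /exp_partial -(big_mkord xpredT (fun k => x ^+ k / k`!%:R)) mulr_sumr -sumrB.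
  rewrite big_nat [leRHS]big_nat; apply: ler_sum => k /andP[_ kN].
  have /andP[hbk _] := hb k.
  apply: le_trans (ler_wpM2r (exprn_ge0 k x0) hbk).
  rewrite -[X in X - _]mul1r -mulrBl [leRHS]mulrAC -[leRHS]mulrA.
  rewrite ler_wpM2r ?divr_ge0 ?exprn_ge0// lerD2l lerN2 ler_pM2r ?invr_gt0//.
  by rewrite lerXn2r ?nnegrE// ler_nat ltnW.
have h4 : (K + 2 * N%:R ^+ 2 * E) / M%:R <= e.
  by rewrite ler_pdivrMr// -ler_pdivrMl// mulrC (le_trans _ hM0)// lerDr mulr_ge0.
apply: (le_trans (cabs_dist _ ((1 + z / M%:R) ^+ M) _)).
rewrite /exp_tail -/E; move: h4.
have -> : (K + 2 * N%:R ^+ 2 * E) / M%:R = K / M%:R + 2 * (N%:R ^+ 2 / M%:R * E) by ring.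
lra.
Qed.

Lemma cis_taylor2 u : `|u| <= 1 ->
  cabs (cis u - (1 + (0 +i* u)%C + (- (u ^+ 2 / 2))%:C%C)) <= expR 1 * `|u| ^+ 3.
Proof.
move=> u1; have [->|u0] := eqVneq u 0.
  rewrite cis0 normr0 !expr0n/= mulr0 mul0r oppr0 rmorph0.
  by rewrite -[(0 +i* 0)%C]/(0 : C) !addr0 subrr cabs0.
have uE : cabs (0 +i* u)%C = `|u| by rewrite /cabs/= expr0n add0r sqrtr_sqr.
have up : 0 < `|u| by rewrite normr_gt0.
have h : exp_tail 3 `|u| <= expR 1 * `|u| ^+ 3.
  have := @exp_tail_le 3 `|u| `|u| (normr_ge0 u); rewrite up u1 divff ?gt_eqF//.
  by rewrite mulrC; apply.
apply: le_trans h; rewrite -uE; apply: le_trans (cex_series_tail 3 _).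
rewrite le_eqVlt; apply/orP; left; apply/eqP; congr (cabs (_ - _)).
rewrite !big_ord_recr big_ord0/= add0r expr0 expr1 !factS fact0 !mul1n !muln1.
rewrite !invr1 !mulr1; congr (_ + _).
have -> : (0 +i* u)%C ^+ 2 = ((- u ^+ 2)%:C)%C :> C.
  by rewrite expr2; apply/eqP; rewrite eq_complex/=; apply/andP; split; apply/eqP; ring.
by rewrite -mulNr rmorphM/= fmorphV rmorph_nat.
Qed.

Lemma cosB1_le u : 4 * expR 1 * `|u| <= 1 -> cos u - 1 <= - (u ^+ 2 / 4).
Proof.
move=> u1; have e1 : 1 <= expR 1 :> R by rewrite -[leLHS]expR0 ler_expR.
have u1' : `|u| <= 1 by have := normr_ge0 u; nra.
have := cis_taylor2 u1'; rewrite cisE => /(le_trans (le_cabs_Re _)) /=.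
move=> /ler_normlP[_]; rewrite addr0.
have := normr_ge0 u; rewrite -(real_normK (num_real u)) exprS => u0.
have : expR 1 * (`|u| * `|u| ^+ 2) <= `|u| ^+ 2 / 4.
  by have := sqr_ge0 `|u|; nra.
lra.
Qed.

Lemma expRN_le x : 0 < x -> expR (- x) <= 2 / x ^+ 2.
Proof.
move=> x0; rewrite expRN -[leRHS]invf_div lef_pV2 ?posrE ?expR_gt0 ?divr_gt0 ?exprn_gt0//.
by have := @expR_ge1Dxn R x 1 (ltW x0); apply: le_trans; rewrite lerDr.
Qed.

End ExponentialTails.

(** * The logarithmic scale, and Gaussian sums over the grid *)

Section LogarithmicScale.
Variable R : realType.
Implicit Types (n m : nat) (K : R).

(** The parameter of the Poisson law that approximates the profile. *)
Definition lam n : R := 2 * ln n%:R.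

Lemma lam_ge K : exists n0, forall n, (n0 <= n)%N -> K <= lam n.
Proof.
exists (Num.truncn (expR (K / 2))).+1 => n hn.
have en : expR (K / 2) <= n%:R by rewrite (le_trans (ltW (truncnS_gt _)))// ler_nat.
have n0 : 0 < n%:R :> R := lt_le_trans (expR_gt0 _) en.
by move: en; rewrite -{1}(lnK (x := n%:R)) ?posrE// ler_expR /lam; lra.
Qed.

Lemma lam_pow_le K m : exists n0, forall n, (n0 <= n)%N -> K * lam n ^+ m <= n%:R.
Proof.
have [n1 hn1] := lam_ge (`|K| * (2 ^+ m.+1 * (m.+1)`!%:R)).
exists (maxn n1 1) => n; rewrite geq_max => /andP[/hn1 {}hn1 n0].
have l0 : 0 <= lam n.
  by apply: le_trans hn1; rewrite !mulr_ge0// exprn_ge0.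
have nE : n%:R = expR (lam n / 2) by rewrite /lam mulrAC divff ?mul1r ?lnK ?posrE ?ltr0n.
rewrite nE; apply: (@le_trans _ _ ((lam n / 2) ^+ m.+1 / (m.+1)`!%:R)); last first.
  by apply: le_trans (expR_ge1Dxn m (divr_ge0 l0 (ler0n R 2))); rewrite lerDr.
have f0 : 0 < (m.+1)`!%:R :> R by rewrite ltr0n fact_gt0.
rewrite ler_pdivlMr// expr_div_n ler_pdivlMr ?exprn_gt0//.
rewrite [in leRHS]exprS.
apply: (@le_trans _ _ (`|K| * (2 ^+ m.+1 * (m.+1)`!%:R) * lam n ^+ m)).
  have -> : K * lam n ^+ m * (m.+1)`!%:R * 2 ^+ m.+1 = K * (2 ^+ m.+1 * (m.+1)`!%:R * lam n ^+ m) by ring.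
  rewrite -[leRHS]mulrA; apply: ler_wpM2r (ler_norm K).
  by rewrite !mulr_ge0// exprn_ge0.
by rewrite ler_wpM2r// exprn_ge0.
Qed.

End LogarithmicScale.

Section GaussianGridSum.
Variable R : realType.
Local Notation C := R[i].
Implicit Types (x a u v s c : R) (n N i : nat).

Lemma telescope_grid_le (dt : R) N : 0 < dt <= 1 ->
  \sum_(i < N) (2 + i%:R * dt)^-1 ^+ 2 <= dt^-1.
Proof.
move=> /andP[d0 d1].
have h i : 0 <= i%:R * dt by rewrite mulr_ge0// ltW.
suff : \sum_(i < N) (2 + i%:R * dt)^-1 ^+ 2 <= dt^-1 * (1 - (1 + N%:R * dt)^-1).
  move=> /le_trans; apply; rewrite ler_piMr ?invr_ge0 ?(ltW d0)//.
  by rewrite gerBl invr_ge0 addr_ge0.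
elim: N => [|N IHN]; first by rewrite big_ord0 mul0r addr0 invr1 subrr mulr0.
rewrite big_ord_recr/= (le_trans (lerD IHN (lexx _)))//.
have := h N; rewrite -(natr1 N) mulrDl mul1r; set y := N%:R * dt => y0.
rewrite -lerBrDl -mulrBr.
have -> : dt^-1 * (1 - (1 + (y + dt))^-1 - (1 - (1 + y)^-1)) = ((1 + y) * (1 + (y + dt)))^-1.
  by field; rewrite !gt_eqF//; lra.
rewrite exprVn lef_pV2 ?posrE ?mulr_gt0 ?exprn_gt0//; try lra.
by rewrite expr2; nra.
Qed.

(** Up to 1 the left side is at most 1; beyond, the cubic term of the exponential
    series suffices. The constant is not optimal. *)
Lemma gauss_cubic_le x : 0 <= x -> x ^+ 3 * expR (- (x ^+ 2 / 4)) <= 9 * 20 ^+ 2 * (2 + x)^-1 ^+ 2.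
Proof.
move=> x0; rewrite expRN exprVn -[leRHS]/(_ / _) ler_pdivrMr ?expR_gt0// mulrAC.
rewrite ler_pdivlMr ?exprn_gt0//; last by lra.
have [x1|x1] := leP x 1.
  have e1 : 1 <= expR (x ^+ 2 / 4) by rewrite -[leLHS]expR0 ler_expR divr_ge0// sqr_ge0.
  apply: (@le_trans _ _ 9); last first.
    have : 0 <= (20 ^+ 2 - 1) * expR (x ^+ 2 / 4) by rewrite mulr_ge0 ?expR_ge0// expr2; lra.
    lra.
  have : x ^+ 3 <= 1 by rewrite exprn_ile1.
  have : 0 <= x ^+ 3 by rewrite exprn_ge0.
  by rewrite (expr2 (2 + x)); nra.
have e3 := @expR_ge1Dxn R (x ^+ 2 / 4) 2 (divr_ge0 (sqr_ge0 x) (ler0n R 4)).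
apply: (@le_trans _ _ (9 * 20 ^+ 2 * ((x ^+ 2 / 4) ^+ 3 / 3`!%:R))); last first.
  apply: ler_wpM2l; first by rewrite mulr_ge0// exprn_ge0.
  by rewrite (le_trans _ e3)// lerDr.
rewrite (_ : 3`! = 6)%N//.
apply: (@le_trans _ _ (x ^+ 3 * (9 * (x * x ^+ 2)))); last first.
  have x6 : 0 <= x ^+ 6 by rewrite exprn_ge0.
  have -> : x ^+ 3 * (9 * (x * x ^+ 2)) = 9 * x ^+ 6 by ring.
  have -> : 9 * 20 ^+ 2 * ((x ^+ 2 / 4) ^+ 3 / 6%:R) = 9 * (x ^+ 6 * (20 ^+ 2 / (4 ^+ 3 * 6))) :> R by field.
  apply: ler_wpM2l => //; apply: ler_peMr => //.
  rewrite ler_pdivlMr ?mulr_gt0 ?exprn_gt0// expr2 !exprS expr0; lra.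
rewrite ler_wpM2l ?exprn_ge0//.
have : 0 <= x ^+ 2 * (x - 1) by rewrite mulr_ge0 ?sqr_ge0//; lra.
by rewrite !expr2; nra.
Qed.

(** The grid runs through [[0, 2 pi]], whereas distances to the real axis are
    measured by angles in [[- pi, pi]]. *)
Lemma grid_angle N i : (i < N)%N -> exists v,
  [/\ cis (grid R N i) = cis v, cos (grid R N i) = cos v, `|v| <= pi &
      `|v| = grid R N i \/ `|v| = pi *+ 2 - grid R N i].
Proof.
move=> iN; set u := grid R N i.
have N0 : (0 : R) < N%:R by rewrite ltr0n; lia.
have p0 := @pi_gt0 R.
have u0 : 0 <= u by rewrite /u /grid !mulr_ge0// ?invr_ge0 ?ltW// mulrn_wgt0.
have u2 : u <= pi *+ 2.
  rewrite /u /grid ler_pdivrMr// ler_wpM2l// ?ler_nat 1?ltnW//.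
  by rewrite mulrn_wge0// ltW.
have [up|up] := leP u pi.
  by exists u; split => //; rewrite ger0_norm//; left.
have w0 : 0 <= pi *+ 2 - u by rewrite subr_ge0.
exists (u - pi *+ 2); rewrite -[X in `|X|]opprB normrN ger0_norm//; split => //.
- have -> : cis u = cis (u - pi *+ 2) * cis (pi *+ 2) by rewrite -cisD subrK.
  by rewrite cis_2pi mulr1.
- have -> : cos u = cos (u - pi *+ 2 + pi *+ 2) by rewrite subrK.
  by rewrite cosD2pi.
- by move: up; rewrite mulr2n; lra.
- by right.
Qed.

(** Averaging over the grid gains a factor [lam ^ (-1/2)] with respect to the
    supremum, as integration would, because the summand lives on the scale
    [lam ^ (-1/2)]; the two telescoping sums account for the two ends of the grid
    [[0, 2 pi]]. *)
Lemma near_zone_sum (G : C -> R) N (l a c0 c1 : R) :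
  (0 < N)%N -> 0 < l -> 2 * pi * Num.sqrt l <= N%:R -> 0 <= a <= pi ->
  0 <= c0 -> 0 <= c1 ->
  (forall v, `|v| <= a -> G (cis v) <= c0 + c1 * (`|v| ^+ 3 * expR (- (l * v ^+ 2 / 4)))) ->
  N%:R^-1 * \sum_(i < N | cos a <= cos (grid R N i)) G (cis (grid R N i))
    <= c0 + 9 * 20 ^+ 2 * c1 / l ^+ 2.
Proof.
move=> N0 l0 hN /andP[a0 api] c00 c10 hG; have p0 := @pi_gt0 R.
have NR : (0 : R) < N%:R by rewrite ltr0n.
set s := Num.sqrt l in hN *; have s0 : 0 < s by rewrite sqrtr_gt0.
have sl : l = s ^+ 2 by rewrite sqr_sqrtr// ltW.
pose h v : R := (2 + s * v)^-1 ^+ 2.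
have h0 v : 0 <= h v by rewrite sqr_ge0.
have c0' : 0 <= 9 * 20 ^+ 2 * c1 by rewrite !mulr_ge0// exprn_ge0.
have key i : (i < N)%N -> cos a <= cos (grid R N i) ->
    G (cis (grid R N i)) <= c0 + 9 * 20 ^+ 2 * c1 / s ^+ 3 * (h (grid R N i) + h (pi *+ 2 - grid R N i)).
  move=> iN ci; have [v [-> cv vp vE]] := grid_angle iN.
  have va : `|v| <= a.
    have [//|av] := leP `|v| a.
    have ai : a \in `[0, pi]%R by rewrite in_itv/= a0 api.
    have vi : `|v| \in `[0, pi]%R by rewrite in_itv/= normr_ge0 vp.
    by move: ci; rewrite cv -(cos_norm v) leNgt (ltr_cos ai vi) av.
  apply: (le_trans (hG v va)); rewrite lerD2l.
  have e1 : `|v| ^+ 3 * expR (- (l * v ^+ 2 / 4)) = (s ^+ 3)^-1 * ((s * `|v|) ^+ 3 * expR (- ((s * `|v|) ^+ 2 / 4))).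
    have -> : (s * `|v|) ^+ 2 = l * v ^+ 2 by rewrite exprMn -sl real_normK ?num_real.
    have -> : (s * `|v|) ^+ 3 = s ^+ 3 * `|v| ^+ 3 by rewrite exprMn.
    by rewrite -[X in _ = _ * X]mulrA mulKf// expf_neq0// gt_eqF.
  rewrite e1.
  have g := gauss_cubic_le (mulr_ge0 (ltW s0) (normr_ge0 v)).
  have hv : h `|v| <= h (grid R N i) + h (pi *+ 2 - grid R N i).
    by case: vE => ->; rewrite ?lerDl ?lerDr.
  apply: (@le_trans _ _ (c1 * ((s ^+ 3)^-1 * (9 * 20 ^+ 2 * h `|v|)))).
    by rewrite ler_wpM2l// ler_wpM2l// invr_ge0 exprn_ge0// ltW.
  have -> : c1 * ((s ^+ 3)^-1 * (9 * 20 ^+ 2 * h `|v|)) = 9 * 20 ^+ 2 * c1 / s ^+ 3 * h `|v| by ring.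
  by rewrite ler_wpM2l// divr_ge0// exprn_ge0// ltW.
pose K := 9 * 20 ^+ 2 * c1 / s ^+ 3.
have K0 : 0 <= K by rewrite divr_ge0// exprn_ge0// ltW.
apply: (@le_trans _ _ (N%:R^-1 * \sum_(i < N) (c0 + K * (h (grid R N i) + h (pi *+ 2 - grid R N i))))).
  rewrite ler_wpM2l ?invr_ge0// big_mkcond; apply: ler_sum => i _.
  case: ifPn => [/(key _ (ltn_ord i))//|_].
  by rewrite addr_ge0// mulr_ge0// addr_ge0.
rewrite big_split/= sumr_const card_ord mulrDr -[c0 *+ N]mulr_natl mulKf ?gt_eqF// lerD2l.
pose dt := 2 * pi * s / N%:R.
have dt0 : 0 < dt by rewrite divr_gt0// !mulr_gt0.
have dt1 : 0 < dt <= 1 by rewrite dt0 ler_pdivrMr// mul1r.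
have E1 (i : nat) : s * grid R N i = i%:R * dt by rewrite /grid /dt -mulr_natl; ring.
have S1 : \sum_(i < N) h (grid R N i) <= dt^-1.
  apply: le_trans (telescope_grid_le N dt1); apply: ler_sum => i _.
  by rewrite /h E1.
have S2 : \sum_(i < N) h (pi *+ 2 - grid R N i) <= dt^-1.
  rewrite (reindex_inj rev_ord_inj)/=; apply: le_trans (telescope_grid_le N dt1).
  apply: ler_sum => i _; rewrite /h.
  have -> : s * (pi *+ 2 - grid R N (N - i.+1)) = i.+1%:R * dt.
    rewrite mulrBr E1 natrB// mulrBl opprB addrCA -[RHS]addr0; congr (_ + _).
    by rewrite /dt -mulr_natl; field; rewrite gt_eqF.
  have i0 : 0 <= i%:R * dt by rewrite mulr_ge0// ltW.
  have b0 : 0 < 2 + i%:R * dt by lra.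
  have ab : 2 + i%:R * dt <= 2 + i.+1%:R * dt.
    by rewrite lerD2l ler_wpM2r ?ler_nat// ltW.
  have b1 := lt_le_trans b0 ab.
  by rewrite !exprVn lef_pV2 ?posrE ?exprn_gt0// lerXn2r ?nnegrE// ltW.
rewrite -mulr_sumr big_split/=.
apply: (@le_trans _ _ (N%:R^-1 * (K * (dt^-1 + dt^-1)))).
  by rewrite ler_wpM2l ?invr_ge0// ler_wpM2l// lerD.
have -> : N%:R^-1 * (K * (dt^-1 + dt^-1)) = 9 * 20 ^+ 2 * c1 / l ^+ 2 / pi.
  rewrite /K /dt sl; move: (pi : R) p0 => q q0; field.
  by rewrite (gt_eqF s0) (gt_eqF q0) (gt_eqF NR).
rewrite ler_pdivrMr// ler_peMr ?divr_ge0 ?sqr_ge0//.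
by have := @pi_ge2 R; lra.
Qed.

End GaussianGridSum.

(** * The generating function near the real axis and elsewhere *)

Section NearZone.
Variable R : realType.
Local Notation C := R[i].
Implicit Types (x a u r M : R) (z y : C) (n k N : nat) (p : {poly R}).

(** The coefficients of a quadratic polynomial in [exp beta - 1] that agrees with
    [1 + p'(0) beta + p''(0)/2 beta ^ 2] up to the order three. *)
Definition lin_coef p : R := p`_1.
Definition quad_coef p : R := p`_2 - p`_1 / 2.

Lemma coef_bound p r M k : 0 < r -> (forall z, cabs z <= r -> cabs (evalC p z) <= M) ->
  `|p`_k| <= M / r ^+ k.
Proof.
move=> r0 pM; have := cauchy_estimate k r0 pM.
by rewrite coef_map/= cabsR ler_pdivlMr// exprn_gt0.
Qed.

(** On the unit circle, the second order Taylor polynomial at [0] in [i u] is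
    rewritten in powers of [exp (i u) - 1]; multiplication by the latter takes
    differences of Fourier coefficients. *)
Lemma taylor_cis p r M u : 0 < r -> (forall z, cabs z <= r -> cabs (evalC p z) <= M) ->
  `|u| <= r / 2 -> 4 * expR 1 * `|u| <= 1 ->
  let y := cis u - 1 in
  cabs (evalC p (0 +i* u)%C
    - ((p`_0)%:C%C + (lin_coef p)%:C%C * y + (quad_coef p)%:C%C * y ^+ 2))
  <= (2 * M / r ^+ 3 + M / r * (expR 1 + 2) + M / r ^+ 2 * 3) * `|u| ^+ 3.
Proof.
move=> r0 pM ur u1 /=; set y := cis u - 1; set w := (0 +i* u)%C.
have e1 : 1 <= expR 1 :> R by rewrite -[leLHS]expR0 ler_expR.
have u0 := normr_ge0 u.
have u1' : `|u| <= 1 by nra.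
have wE : cabs w = `|u| by rewrite /cabs/= expr0n add0r sqrtr_sqr.
have w2 : w ^+ 2 = ((- u ^+ 2)%:C)%C.
  by rewrite expr2; apply/eqP; rewrite eq_complex/=; apply/andP; split; apply/eqP; ring.
have wr : cabs w <= r / 2 by rewrite wE.
have t1 := taylor_remainder 3 r0 pM wr.
rewrite !big_ord_recr big_ord0/= add0r expr0 mulr1 expr1 !coef_map/= in t1.
have y2 : cabs y <= 2 * `|u| by exact: cabs_cisB1.
have y1 : cabs (y - w - (- (u ^+ 2 / 2))%:C%C) <= expR 1 * `|u| ^+ 3.
  have := cis_taylor2 u1'; congr (cabs _ <= _); rewrite /y -/w; ring.
have uu : cabs ((- (u ^+ 2 / 2))%:C%C : C) = `|u| ^+ 2 / 2.
  by rewrite cabsR normrN normrM normrX (ger0_norm (x := 2^-1)).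
have eu : expR 1 * `|u| ^+ 3 <= `|u| ^+ 2 / 4.
  by rewrite exprS; have := sqr_ge0 `|u|; nra.
have yw : cabs (y - w) <= `|u| ^+ 2.
  have := cabsD (y - w - (- (u ^+ 2 / 2))%:C%C) (- (u ^+ 2 / 2))%:C%C.
  by rewrite subrK uu; have := sqr_ge0 `|u|; lra.
have y2w : cabs (y ^+ 2 - w ^+ 2) <= 3 * `|u| ^+ 3.
  rewrite subr_sqr cabsM.
  apply: (@le_trans _ _ (`|u| ^+ 2 * (3 * `|u|))).
    apply: ler_pM (cabs_ge0 _) (cabs_ge0 _) yw _.
    by apply: (le_trans (cabsD _ _)); rewrite wE; lra.
  by rewrite exprS le_eqVlt; apply/orP; left; apply/eqP; ring.
have t2 : cabs (w - y + y ^+ 2 / 2%:R) <= (expR 1 + 2) * `|u| ^+ 3.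
  have -> : w - y + y ^+ 2 / 2%:R = - (y - w - (- (u ^+ 2 / 2))%:C%C) + (y ^+ 2 - w ^+ 2) / 2%:R.
    by rewrite w2 !rmorphN rmorphM/= fmorphV rmorph_nat; field.
  apply: (le_trans (cabsD _ _)); rewrite cabsN cabsM cabsV cabs_nat.
  have : 0 <= `|u| ^+ 3 by rewrite exprn_ge0.
  lra.
have c1 := coef_bound 1 r0 pM; have c2 := coef_bound 2 r0 pM; rewrite expr1 in c1.
have -> : evalC p w - ((p`_0)%:C%C + (lin_coef p)%:C%C * y + (quad_coef p)%:C%C * y ^+ 2) =
   (evalC p w - ((p`_0)%:C%C + (p`_1)%:C%C * w + (p`_2)%:C%C * w ^+ 2))
   + (p`_1)%:C%C * (w - y + y ^+ 2 / 2%:R) - (p`_2)%:C%C * (y ^+ 2 - w ^+ 2).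
  by rewrite /lin_coef /quad_coef rmorphB rmorphM/= fmorphV rmorph_nat; field.
apply: (le_trans (cabsB _ _)).
rewrite mulrDl [X in _ <= X + _]mulrDl; apply: lerD; last first.
  rewrite cabsM cabsR -mulrA; apply: ler_pM => //; exact: cabs_ge0.
apply: (le_trans (cabsD _ _)); apply: lerD; last first.
  rewrite cabsM cabsR -mulrA; apply: ler_pM => //; exact: cabs_ge0.
have -> : 2 * M / r ^+ 3 * `|u| ^+ 3 = 2 * M * (cabs w / r) ^+ 3.
  by rewrite wE; field; rewrite gt_eqF.
exact: t1.
Qed.

(** [n] times the generating function of the Poisson law with parameter [lam n],
    with a quadratic correction. *)
Definition model n p z : C := n%:R * (cex ((lam R n)%:C%C * (z - 1)) *
  (1 + (lin_coef p)%:C%C * (z - 1) + (quad_coef p)%:C%C * (z - 1) ^+ 2)).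

(** The factor in front of [W_ n t] is [n] times the generating function of the
    Poisson law with parameter [lam R n]. *)
Lemma level_gf_W n t z : (0 < n)%N ->
  level_gf t (cex z) = n%:R * (cex ((lam R n)%:C%C * (cex z - 1)) * W_ n t z).
Proof.
move=> n0; rewrite WE.
have -> : \sum_(v <- externals t) cex (z * (depth v)%:R) = level_gf t (cex z).
  by apply: eq_bigr => v _; rewrite mulr_natr cex_mulrn.
rewrite !mulrA -[LHS]mul1r; congr (_ * _).
have -> : n%:R = cex ((ln n%:R)%:C)%C :> C by rewrite cexR lnK ?posrE ?ltr0n// rmorph_nat.
rewrite -!cexD -[LHS]cex0; congr cex.
by rewrite /lam rmorphM/= rmorph_nat; ring.
Qed.

Lemma cabs_cex_lam l u : cabs (cex (l%:C%C * (cis u - 1))) = expR (l * (cos u - 1)).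
Proof. by rewrite cabs_cex cisE /= mul0r subr0. Qed.

(** The Taylor error is damped by the Gaussian decay of the Poisson generating
    function. The summand 3 collects the approximation error, at the given point
    and at [0], and the difference between [W_ n t 0 = n.+1 / n] and 1. *)
Lemma near_zone_approx p t n r M u : (0 < n)%N -> 0 < r -> 0 <= lam R n ->
  size (externals t) = n.+1 ->
  (forall z, cabs z <= r -> cabs (evalC p z) <= M) ->
  (forall z, cabs z <= r -> cabs (evalC p z - W_ n t z) <= (n.+1%:R)^-1) ->
  `|u| <= r / 2 -> 4 * expR 1 * `|u| <= 1 ->
  cabs (level_gf t (cis u) - model n p (cis u)) <=
    3 + n%:R * (2 * M / r ^+ 3 + M / r * (expR 1 + 2) + M / r ^+ 2 * 3)
      * (`|u| ^+ 3 * expR (- (lam R n * u ^+ 2 / 4))).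
Proof.
move=> n0 r0 l0 tn pM pW ur u1; set K := (2 * M / _ + _ + _).
have nR : (0 : R) < n%:R by rewrite ltr0n.
have nS : (n.+1%:R)^-1 <= n%:R^-1 :> R by rewrite lef_pV2 ?posrE// ler_nat.
have -> : level_gf t (cis u) =
  n%:R * (cex ((lam R n)%:C%C * (cis u - 1)) * W_ n t (0 +i* u)%C) by exact: level_gf_W.
rewrite /model -mulrBr -mulrBr.
rewrite !cabsM cabs_nat cabs_cex_lam; set w := (0 +i* u)%C.
set E := expR (lam R n * (cos u - 1)).
have E0 : 0 < E := expR_gt0 _.
have E1 : E <= expR (- (lam R n * u ^+ 2 / 4)).
  by rewrite ler_expR -mulrA -mulrN ler_wpM2l// cosB1_le.
have E2 : E <= 1 by rewrite (le_trans E1)// expR_le1 oppr_le0 divr_ge0// mulr_ge0// sqr_ge0.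
have wE : cabs w = `|u| by rewrite /cabs/= expr0n add0r sqrtr_sqr.
have wr : cabs w <= r by rewrite wE; lra.
have W0 : W_ n t 0 = (n.+1%:R / n%:R : C).
  have h := @level_gf_W n t 0 n0; move: h; rewrite cex0 subrr mulr0 cex0 mul1r /level_gf.
  rewrite (eq_bigr (fun=> 1)) => [|v _]; last by rewrite expr1n.
  rewrite big_const_seq count_predT iter_addr_0 tn => ->.
  by rewrite mulrC mulKf// pnatr_eq0 -lt0n.
have p0 : cabs ((p`_0)%:C%C - 1 : C) <= n%:R^-1 + n%:R^-1.
  have := pW 0; rewrite cabs0 => /(_ (ltW r0)); rewrite W0 /evalC horner_coef0 coef_map/= => h.
  apply: (le_trans (cabs_dist _ (n.+1%:R / n%:R) _)); apply: lerD; first exact: le_trans nS.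
  have -> : n.+1%:R / n%:R - 1 = n%:R^-1 :> C.
    have nC : n%:R != 0 :> C by rewrite pnatr_eq0 -lt0n.
    by rewrite -(natr1 n) mulrDl mul1r divff// addrAC subrr add0r.
  by rewrite cabsV cabs_nat.
have tc := taylor_cis r0 pM ur u1; rewrite /= -/w in tc.
set y := cis u - 1 in tc *.
set Q := (p`_0)%:C%C + _ + _ in tc.
have h : cabs (W_ n t w - (1 + (lin_coef p)%:C%C * y + (quad_coef p)%:C%C * y ^+ 2)) <=
    3 / n%:R + K * `|u| ^+ 3.
  have -> : W_ n t w - (1 + (lin_coef p)%:C%C * y + (quad_coef p)%:C%C * y ^+ 2) =
      - (evalC p w - W_ n t w) + (evalC p w - Q) + ((p`_0)%:C%C - 1).
    by rewrite /Q; ring.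
  have -> : 3 / n%:R + K * `|u| ^+ 3 = (n%:R^-1 + K * `|u| ^+ 3) + (n%:R^-1 + n%:R^-1) by ring.
  apply: (le_trans (cabsD _ _)); apply: lerD p0; apply: (le_trans (cabsD _ _)).
  by rewrite cabsN; apply: lerD tc; exact: le_trans (pW w wr) nS.
have K0 : 0 <= K * `|u| ^+ 3 by apply: le_trans (cabs_ge0 _) tc.
apply: (@le_trans _ _ (n%:R * (E * (3 / n%:R + K * `|u| ^+ 3)))).
  by rewrite ler_wpM2l// ler_wpM2l// ltW.
rewrite mulrDr [leLHS]mulrDr; apply: lerD.
  have -> : n%:R * (E * (3 / n%:R)) = 3 * E by field; rewrite gt_eqF.
  by lra.
have -> : n%:R * K * (`|u| ^+ 3 * expR (- (lam R n * u ^+ 2 / 4))) =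
  n%:R * (expR (- (lam R n * u ^+ 2 / 4)) * (K * `|u| ^+ 3)) by ring.
by rewrite ler_wpM2l// ler_wpM2r.
Qed.

End NearZone.

Section FarZoneBound.
Variable R : realType.
Local Notation C := R[i].
Implicit Types (x a u r M : R) (z y : C) (n k N j q : nat) (t : nat -> bst).

(** The single paths of the binary search tree process. *)
Definition growing t := forall n, exists2 v, v \in externals (t n) & t n.+1 = bst_expand (t n) v.

Lemma depth_lt_size (t : bst) v : v \in externals t -> (depth v < size (externals t))%N.
Proof.
elim: t v => [|l IHl r IHr] v /=; first by rewrite inE => /eqP ->.
rewrite mem_cat size_cat !size_map => /orP[] /mapP[w wt ->] /=.
  have := IHl _ wt; have : (0 < size (externals r))%N by case: (externals r) (externals_neq0 r).
  by move=> r0 h; rewrite -[(depth _).+1]addn1; exact: leq_add h r0.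
have := IHr _ wt; have : (0 < size (externals l))%N by case: (externals l) (externals_neq0 l).
by move=> l0 h; rewrite -[(depth _).+1]add1n; exact: leq_add l0 h.
Qed.

Lemma size_growing t n : t 0%N = External -> growing t -> size (externals (t n)) = n.+1.
Proof.
move=> t0 tg; elim: n => [|n IHn]; first by rewrite t0.
by have [v vt ->] := tg n; rewrite size_externals_bst_expand// IHn.
Qed.

Lemma level_gf_growing t z m n : growing t -> cabs z = 1 -> (m <= n)%N ->
  cabs (level_gf (t n) z) <= cabs (level_gf (t m) z) + 3 * (n - m)%:R.
Proof.
move=> tg z1; elim: n => [|n IHn]; first by rewrite leqn0 => /eqP ->; rewrite mulr0 addr0.
rewrite leq_eqVlt => /orP[/eqP ->|]; first by rewrite subnn mulr0 addr0.
rewrite ltnS => mn; have [v vt ->] := tg n.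
have := level_gf_expand_dist z1 vt; have := IHn mn.
have := cabsD (level_gf (bst_expand (t n) v) z - level_gf (t n) z) (level_gf (t n) z).
by rewrite subrK subSn// -(natr1 (n - m)); lra.
Qed.

Lemma root_exists q n : (0 < q)%N -> (0 < n)%N ->
  exists j, (j.+1 ^ q <= n)%N && (n < j.+2 ^ q)%N.
Proof.
move=> q0; elim: n => // -[_ _|n /(_ isT) [j /andP[j1 j2]] _].
  by exists 0%N; rewrite exp1n/= -{1}(expn0 2) ltn_exp2l.
have [h|h] := ltnP n.+2 (j.+2 ^ q); first by exists j; rewrite h ltnW.
by exists j.+1; rewrite h/= (leq_ltn_trans j2)// ltn_exp2r.
Qed.

Lemma expS_sub_le q j : (j.+2 ^ q - j.+1 ^ q <= q * j.+2 ^ q.-1)%N.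
Proof.
elim: q => // q IHq; rewrite /= !expnS.
have -> : (j.+2 * j.+2 ^ q - j.+1 * j.+1 ^ q = j.+2 ^ q + j.+1 * (j.+2 ^ q - j.+1 ^ q))%N.
  have le : (j.+1 ^ q <= j.+2 ^ q)%N by case: (q) => [|q'] //; rewrite leq_exp2r.
  rewrite mulnBr mulSn; have := leq_mul (leqnn j.+1) le.
  set x := (j.+1 * j.+1 ^ q)%N; set y := (j.+1 * _)%N; set c := (_ ^ q)%N; lia.
rewrite mulSn leq_add2l; apply: (leq_trans (leq_mul (leqnSn j.+1) IHq)).
by case: q {IHq} => [|q]; [rewrite mul0n muln0|rewrite mulnCA -expnS].
Qed.

Lemma ln_sqr_le x : 1 <= x -> ln x ^+ 2 <= 4 * x.
Proof.
move=> x1; have x0 : 0 < x by lra.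
have s0 : 0 < Num.sqrt x by rewrite sqrtr_gt0.
have -> : ln x = 2 * ln (Num.sqrt x) by rewrite -{1}(sqr_sqrtr (ltW x0)) lnXn// mulr_natl.
have := ln_sublinear s0; have s1 : 1 <= Num.sqrt x by rewrite -[leLHS]sqrtr1 ler_wsqrtr.
have := ln_ge0 s1; have := sqr_sqrtr (ltW x0); set s := Num.sqrt x; rewrite !expr2; nra.
Qed.

(** Away from the real axis the bound at the times [j.+1 ^ q] extends to all times
    in between, because in the meantime only a small proportion of the nodes
    changes. *)
Lemma far_zone_bound t q a M : (0 < q)%N -> growing t ->
  (forall j, far_mean_square q (cos a) j (t (j.+1 ^ q)%N) <= M * ((j.+1 ^ q)%:R / j.+1%:R) ^+ 2) ->
  exists K, 0 <= K /\ forall n, (1 < n)%N -> exists2 N, (n < N)%N &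
    N%:R^-1 * \sum_(i < N | cos (grid R N i) < cos a) cabs (level_gf (t n) (cis (grid R N i)))
     <= n%:R * K / lam R n ^+ 2.
Proof.
move=> q0 tg hM; pose K := `|M| + 1 + 3 * q%:R * 2 ^+ q : R.
have K0 : 0 <= K by rewrite !addr_ge0// !mulr_ge0// exprn_ge0.
exists (K * (32 * q%:R ^+ 2)); split; first by rewrite !mulr_ge0// exprn_ge0.
move=> n n1; have [j /andP[j1 j2]] := root_exists q0 (ltnW n1).
have nN : (n < grid_size q j)%N by rewrite /grid_size ltnS ltnW.
exists (grid_size q j) => //; set N := grid_size q j in nN *.
have NR : (0 : R) < N%:R by rewrite ltr0n.
set m := (j.+1 ^ q)%N in j1 *.
have m0 : (0 : R) < m%:R by rewrite ltr0n expn_gt0.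
have j0 : (0 : R) < j.+1%:R by rewrite ltr0n.
pose c : R := m%:R / j.+1%:R; have c0 : 0 < c by rewrite divr_gt0.
pose far i := cos (grid R N i) < cos a.
pose x i := cabs (level_gf (t m) (cis (grid R N i))).
have nm : (n - m)%:R <= q%:R * 2 ^+ q * c :> R.
  have -> : c = (j.+1 ^ q.-1)%:R.
    by rewrite /c /m -{1}(prednK q0) expnS natrM mulrAC divff ?mul1r// gt_eqF.
  rewrite -natrX -!natrM ler_nat -mulnA.
  apply: (@leq_trans (q * j.+2 ^ q.-1)).
    by rewrite (leq_trans _ (expS_sub_le q j))// leq_sub2r// ltnW.
  rewrite leq_mul2l; apply/orP; right.
  apply: (@leq_trans ((2 * j.+1) ^ q.-1)); first by case: (q.-1) => // q'; rewrite leq_exp2r//; lia.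
  by rewrite expnMn leq_mul2r leq_exp2l// leq_pred orbT.
have xS i : cabs (level_gf (t n) (cis (grid R N i))) <= x i ^+ 2 / c + (c + 3 * (q%:R * 2 ^+ q * c)).
  apply: (le_trans (level_gf_growing tg (cabs_cis _) j1)).
  have : x i <= x i ^+ 2 / c + c.
    have xi0 : 0 <= x i := cabs_ge0 _.
    have [xc|xc] := leP (x i) c; first by rewrite (le_trans xc)// lerDr divr_ge0 ?sqr_ge0// ltW.
    rewrite (le_trans _ (_ : x i ^+ 2 / c <= _))//; last by rewrite lerDl ltW.
    by rewrite ler_pdivlMr// expr2 ler_wpM2l// ltW.
  by rewrite /x; lra.
set c' := c + _ in xS; have c'0 : 0 <= c'.
  by rewrite /c' addr_ge0 ?mulr_ge0 ?exprn_ge0// ltW.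
apply: (@le_trans _ _ (far_mean_square q (cos a) j (t m) / c + c')).
  rewrite /far_mean_square -/N -mulrA.
  have -> : c' = N%:R^-1 * \sum_(i < N) c'.
    by rewrite sumr_const card_ord -[c' *+ N]mulr_natl mulKf// gt_eqF.
  rewrite -mulrDr ler_wpM2l ?invr_ge0 ?(ltW NR)// mulr_suml.
  apply: (@le_trans _ _ (\sum_(i < N | far i) (x i ^+ 2 / c) + \sum_(i < N | far i) c')).
    by rewrite -big_split/=; apply: ler_sum => i _; exact: xS.
  rewrite lerD2l big_mkcond; apply: ler_sum => i _; by case: ifP.
apply: (@le_trans _ _ (K * c)).
  have h : far_mean_square q (cos a) j (t m) / c <= `|M| * c.
    rewrite ler_pdivrMr// (le_trans (hM j))// -/c -mulrA -expr2 ler_wpM2r ?sqr_ge0//.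
    exact: ler_norm.
  by rewrite /K /c'; lra.
have ln0 : 0 < ln n%:R :> R by rewrite ln_gt0// ltr1n.
have l0 : 0 < lam R n by rewrite /lam mulr_gt0.
rewrite ler_pdivlMr ?exprn_gt0//.
have l2 : lam R n ^+ 2 <= 32 * q%:R ^+ 2 * j.+1%:R.
  have h1 : ln n%:R <= q%:R * ln j.+2%:R :> R.
    rewrite mulr_natl -lnXn// -natrX ler_ln ?posrE ?ltr0n ?expn_gt0//; last by lia.
    by rewrite ler_nat ltnW.
  have h2 : ln j.+2%:R ^+ 2 <= 4 * j.+2%:R :> R by apply: ln_sqr_le; rewrite ler1n.
  have h3 : j.+2%:R <= 2 * j.+1%:R :> R by rewrite -natrM ler_nat mul2n -addnn addSn ltnS leq_addl.
  have h4 : ln n%:R ^+ 2 <= (q%:R * ln j.+2%:R) ^+ 2 :> R.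
    rewrite lerXn2r ?nnegrE//; first exact: ltW.
    exact: le_trans (ltW ln0) h1.
  rewrite exprMn in h4; rewrite /lam exprMn.
  have q2 : 0 <= q%:R ^+ 2 :> R by rewrite exprn_ge0.
  have : q%:R ^+ 2 * ln j.+2%:R ^+ 2 <= q%:R ^+ 2 * (8 * j.+1%:R) :> R.
    by rewrite ler_wpM2l//; lra.
  by rewrite (expr2 2); lra.
apply: (@le_trans _ _ (K * c * (32 * q%:R ^+ 2 * j.+1%:R))).
  by rewrite ler_wpM2l// mulr_ge0// ltW.
have -> : K * c * (32 * q%:R ^+ 2 * j.+1%:R) = K * (32 * q%:R ^+ 2) * m%:R.
  by rewrite /c; field; rewrite addrC natr1 gt_eqF.
by rewrite [leRHS]mulrC ler_wpM2l ?ler_nat// !mulr_ge0// exprn_ge0.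
Qed.

End FarZoneBound.

(** * Local expansion of the profile *)

Section LocalExpansion.
Variable R : realType.
Local Notation C := R[i].
Implicit Types (x a l r M A B : R) (z y : C) (n k N j q : nat) (p : {poly R}).

Definition pois l k : R := expR (- l) * l ^+ k / k`!%:R.

(** The first [N] terms of the exponential series contribute exactly the [k]-th
    coefficient, and the remainder contributes at most its supremum. *)
Lemma dft_poisson N k l : (k < N)%N -> 0 <= l ->
  cabs (dft N k (fun u => cex (l%:C%C * (cis u - 1))) - (pois l k)%:C%C)
  <= expR (- l) * exp_tail N l.
Proof.
move=> kN l0.
have N0 : (0 : R) < N%:R by rewrite ltr0n; lia.
have E : dft N k (fun u => cex (l%:C%C * (cis u - 1))) =
    (expR (- l))%:C%C * dft N k (fun u => cex (l%:C%C * cis u)).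
  rewrite -dftZ; apply: eq_dft => j; rewrite -cexR -cexD; congr cex.
  by rewrite rmorphN; ring.
have S : dft N k (fun u => \sum_(m < N) (l%:C%C * cis u) ^+ m / m`!%:R) = (l ^+ k / k`!%:R)%:C%C.
  rewrite (@eq_dft R _ _ _ (fun u => \sum_(m <- index_iota 0 N) (l ^+ m / m`!%:R)%:C%C * cis u ^+ m)); last first.
    move=> j; rewrite big_mkord; apply: eq_bigr => m _.
    by rewrite exprMn rmorphM/= rmorphXn fmorphV rmorph_nat mulrAC.
  rewrite dft_sum big_mkord (bigD1 (Ordinal kN))//= dftZ dft_monomial// eqxx mulr1.
  rewrite big1 ?addr0// => m mk.
  by rewrite dftZ dft_monomial// (negbTE (_ : (m : nat) != k)) ?mulr0.
have -> : (pois l k)%:C%C = (expR (- l))%:C%C * (l ^+ k / k`!%:R)%:C%C :> C.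
  by rewrite /pois -mulrA rmorphM.
rewrite E -S -mulrBr -dftB cabsM cabsR ger0_norm ?expR_ge0// ler_wpM2l ?expR_ge0//.
apply: (le_trans (cabs_dft _ _ _)).
rewrite mulrC ler_pdivrMr//.
apply: (le_trans (ler_sum (G := fun=> exp_tail N l) _ _)) => [j _|].
  have := cex_series_tail N (l%:C%C * cis (grid R N j)).
  by rewrite cabsM cabs_cis mulr1 cabsR ger0_norm.
by rewrite sumr_const card_ord mulr_natr.
Qed.

(** The Poisson probabilities corrected by their first two differences, that is,
    the coefficients of the Poisson generating function times
    [1 + A * (z - 1) + B * (z - 1) ^ 2]. The index is shifted by two, since the
    formula involves the two preceding probabilities. *)
Definition edgeworth l A B k : R :=
  (1 - A + B) * pois l k.+2 + (A - 2 * B) * pois l k.+1 + B * pois l k.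

Lemma dft_model N k n p : (k.+2 < N)%N -> 0 <= lam R n ->
  cabs (dft N k.+2 (fun u => model n p (cis u)) -
    (n%:R * edgeworth (lam R n) (lin_coef p) (quad_coef p) k)%:C%C) <=
  n%:R * (1 + 2 * `|lin_coef p| + 4 * `|quad_coef p|) * (expR (- lam R n) * exp_tail N (lam R n)).
Proof.
rewrite /model; move: (lin_coef p) (quad_coef p) => A B kN l0; set l := lam R n in l0 *.
pose D k := dft N k (fun u => cex (l%:C%C * (cis u - 1))).
set X := dft _ _ _; have {X}-> : X =
    n%:R * ((1 - A + B)%:C%C * D k.+2 + (A - 2 * B)%:C%C * D k.+1 + B%:C%C * D k).
  rewrite /X (@eq_dft R _ _ _ (fun u => n%:R * ((1 - A + B)%:C%C * cex (l%:C%C * (cis u - 1)) +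
    ((A - 2 * B)%:C%C * (cis u * cex (l%:C%C * (cis u - 1))) +
     B%:C%C * (cis u * (cis u * cex (l%:C%C * (cis u - 1)))))))); last first.
    move=> j; rewrite -/l !rmorphD !rmorphN rmorphM/= rmorph1 rmorph_nat.
    set e := cex _; set w := cis _; ring.
  by rewrite dftZ !dftD !dftZ !dft_cisM addrA.
have tl k' : (k' < N)%N -> cabs (D k' - (pois l k')%:C%C) <= expR (- l) * exp_tail N l.
  by move=> h; exact: dft_poisson.
set e := _ * exp_tail _ _ in tl *.
have e0 : 0 <= e by rewrite mulr_ge0 ?expR_ge0 ?exp_tail_ge0.
have -> : n%:R * ((1 - A + B)%:C%C * D k.+2 + (A - 2 * B)%:C%C * D k.+1 + B%:C%C * D k)
   - (n%:R * edgeworth l A B k)%:C%C =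
   n%:R * ((1 - A + B)%:C%C * (D k.+2 - (pois l k.+2)%:C%C)
     + (A - 2 * B)%:C%C * (D k.+1 - (pois l k.+1)%:C%C) + B%:C%C * (D k - (pois l k)%:C%C)).
  by rewrite /edgeworth !(rmorphM, rmorphD)/= rmorph_nat; ring.
rewrite cabsM cabs_nat -mulrA ler_wpM2l//.
apply: (le_trans (cabsD _ _)).
apply: (@le_trans _ _ (`|1 - A + B| * e + `|A - 2 * B| * e + `|B| * e)).
  apply: lerD; last by rewrite cabsM cabsR ler_wpM2l// tl//; lia.
  apply: (le_trans (cabsD _ _)); rewrite !cabsM !cabsR.
  by apply: lerD; rewrite ler_wpM2l// tl//; lia.
rewrite -!mulrDl ler_wpM2r//.
have h1 := ler_normD (1 - A) B; have h2 := ler_normB 1 A; have h3 := ler_normB A (2 * B).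
by rewrite normr1 in h2; rewrite normrM (ger0_norm (x := 2)) in h3; lra.
Qed.

Lemma profile_dft (t : bst) N k : (k < N)%N -> (size (externals t) <= N)%N ->
  dft N k (fun u => level_gf t (cis u)) = (profile t k)%:R :> C.
Proof.
move=> kN tN.
rewrite (@eq_dft R _ _ _ (fun u => \sum_(m <- [seq depth v | v <- externals t]) cis u ^+ m)); last first.
  by move=> j; rewrite big_map.
rewrite dft_count//; first by rewrite count_map.
by apply/allP => _ /mapP[v vt ->]; apply: leq_trans tN; exact: depth_lt_size.
Qed.

(** Sufficient control of a growing sequence of trees for the expansion of its
    profile: near the real axis the normalized generating functions are
    approximated by uniformly bounded polynomials, elsewhere they are small. *)
Record controlled (t : nat -> bst) (p : nat -> {poly R}) r M a q Mf n1 : Prop := {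
  ctl_init : t 0%N = External;
  ctl_growing : growing t;
  ctl_r : 0 < r;
  ctl_a : 0 < a;
  ctl_ar : a <= r / 2;
  ctl_a1 : 4 * expR 1 * a <= 1;
  ctl_bounded : forall n, (n1 <= n)%N -> forall z, cabs z <= r -> cabs (evalC (p n) z) <= M;
  ctl_approx : forall n, (n1 <= n)%N -> forall z, cabs z <= r ->
    cabs (evalC (p n) z - W_ n (t n) z) <= (n.+1%:R)^-1;
  ctl_q : (0 < q)%N;
  ctl_far : forall j, far_mean_square q (cos a) j (t (j.+1 ^ q)%N) <= Mf * ((j.+1 ^ q)%:R / j.+1%:R) ^+ 2
}.

(** Fourier inversion over a grid with more points than levels. Near the real axis
    the generating function differs from [model] by a cubic Taylor error on the
    scale [lam R n ^ (- 1 / 2)], which the mean over the grid turns into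
    [lam R n ^ - 2]; elsewhere both functions are small separately. *)
Theorem local_expansion t (p : nat -> {poly R}) r M a q Mf n1 : controlled t p r M a q Mf n1 ->
  exists K n0, 0 <= K /\ forall n, (n0 <= n)%N -> forall k, (k.+2 <= n)%N ->
    `|(profile (t n) k.+2)%:R / n%:R - edgeworth (lam R n) (lin_coef (p n)) (quad_coef (p n)) k|
      <= K / lam R n ^+ 2.
Proof.
case=> t0 tg r0 a0 ar a1 pM pW q0 hfar.
have e1 : 1 <= expR 1 :> R by rewrite -[leLHS]expR0 ler_expR.
have M0 : 0 <= M by apply: le_trans (cabs_ge0 _) (pM n1 (leqnn _) 0 _); rewrite cabs0 ltW.
pose K1 := 2 * M / r ^+ 3 + M / r * (expR 1 + 2) + M / r ^+ 2 * 3.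
have r0' := ltW r0.
have K10 : 0 <= K1.
  have b1 : 0 <= 2 * M / r ^+ 3 by rewrite divr_ge0 ?mulr_ge0 ?exprn_ge0.
  have b2 : 0 <= M / r * (expR 1 + 2) by rewrite mulr_ge0 ?divr_ge0//; lra.
  have b3 : 0 <= M / r ^+ 2 * 3 by rewrite mulr_ge0 ?divr_ge0 ?exprn_ge0.
  by rewrite /K1; lra.
have [K2 [K20 hK2]] := far_zone_bound q0 tg hfar.
pose KQ := 1 + 2 * (M / r) + 4 * (M / r ^+ 2 + M / r).
have Mr : 0 <= M / r by rewrite divr_ge0.
have Mr2 : 0 <= M / r ^+ 2 by rewrite divr_ge0 ?exprn_ge0.
have KQ0 : 0 <= KQ by rewrite /KQ; lra.
have Q_le n : (n1 <= n)%N -> 1 + 2 * `|lin_coef (p n)| + 4 * `|quad_coef (p n)| <= KQ.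
  move=> nn; have b1 := coef_bound 1 r0 (pM n nn); have b2 := coef_bound 2 r0 (pM n nn).
  rewrite expr1 in b1; rewrite /KQ /lin_coef /quad_coef.
  have := ler_normB (p n)`_2 ((p n)`_1 / 2); rewrite normrM (ger0_norm (x := 2^-1))//.
  have := normr_ge0 (p n)`_1; lra.
pose K3 := KQ * (32 / a ^+ 4).
have K30 : 0 <= K3 by rewrite mulr_ge0// divr_ge0// exprn_ge0// ltW.
pose K0 := 9 * 20 ^+ 2 * K1.
have K00 : 0 <= K0 by rewrite mulr_ge0// mulr_ge0// exprn_ge0.
exists (3 + K0 + K2 + K3 + 2 * KQ).
have [m1 hm1] := lam_ge (1 : R).
have [m2 hm2] := lam_pow_le (1 : R) 2.
have [m3 hm3] := lam_pow_le (8 + expR 1 : R) 1.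
exists (maxn (maxn n1 2) (maxn m1 (maxn m2 m3))); split; first by lra.
move=> n; rewrite !geq_max => /andP[/andP[nn1 n2] /andP[/hm1 l1 /andP[/hm2 l2 /hm3 l3]]] k kn.
rewrite mul1r in l2; rewrite expr1 mulrDl in l3.
set l := lam R n in l1 l2 l3 *; have l0 : 0 < l by lra.
have n0 : (0 < n)%N := ltnW n2.
have nR : (0 : R) < n%:R by rewrite ltr0n.
have [N nN farN] := hK2 n n2.
have N0 : (0 < N)%N := leq_ltn_trans (leq0n n) nN.
have NR : (0 : R) < N%:R by rewrite ltr0n.
have sz : size (externals (t n)) = n.+1 by exact: size_growing.
have nNR : n%:R <= N%:R :> R by rewrite ler_nat ltnW.
pose G u := level_gf (t n) (cis u) - model n (p n) (cis u).
have dG : cabs (dft N k.+2 G) <= n%:R * ((3 + K0 + K2 + K3) / l ^+ 2).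
  apply: (le_trans (cabs_dft _ _ _)).
  rewrite (bigID (fun i : 'I_N => cos a <= cos (grid R N i)))/= mulrDr.
  have nearb : N%:R^-1 * \sum_(i < N | cos a <= cos (grid R N i)) cabs (G (grid R N i))
      <= 3 + 9 * 20 ^+ 2 * (n%:R * K1) / l ^+ 2.
    apply: (@near_zone_sum R (fun z => cabs (level_gf (t n) z - model n (p n) z)) N l a) => //.
    - have s1 : Num.sqrt l <= l.
        have := sqr_sqrtr (ltW l0); have : 1 <= Num.sqrt l by rewrite -[leLHS]sqrtr1 ler_wsqrtr.
        set s := Num.sqrt l; rewrite expr2; nra.
      apply: le_trans nNR; have := @pihalf_lt2 R; have := @pi_gt0 R.
      have : 0 <= expR 1 * l by rewrite mulr_ge0// ltW// expR_gt0.
      have := sqrtr_ge0 l; set s := Num.sqrt l in s1 *; nra.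
    - rewrite ltW//=; have := @pi_ge2 R; have : a <= 1 by nra.
      lra.
    - by rewrite mulr_ge0.
    - move=> v va; apply: near_zone_approx => //.
      + exact: ltW.
      + exact: pM.
      + exact: pW.
      + exact: le_trans va ar.
      + by apply: le_trans a1; rewrite ler_pM2l// mulr_gt0// expR_gt0.
  have modelb i : cos (grid R N i) < cos a ->
      cabs (model n (p n) (cis (grid R N i))) <= n%:R * (K3 / l ^+ 2).
    move=> ci; rewrite /model cabsM cabs_nat ler_wpM2l// cabsM cabs_cex_lam -/l.
    have ca := cosB1_le (u := a); rewrite gtr0_norm// in ca; have {}ca := ca a1.
    have -> : K3 / l ^+ 2 = 2 / (l * (a ^+ 2 / 4)) ^+ 2 * KQ.
      by rewrite /K3; field; rewrite !gt_eqF.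
    apply: ler_pM; [exact: expR_ge0|exact: cabs_ge0| |].
      apply: le_trans (expRN_le _); last by rewrite mulr_gt0// divr_gt0// exprn_gt0.
      by rewrite ler_expR -mulrN ler_wpM2l ?(ltW l0)//; lra.
    apply: le_trans (Q_le n nn1).
    set y := cis _ - 1; have y2 : cabs y <= 2.
      by apply: (le_trans (cabsB _ _)); rewrite cabs_cis cabs1.
    apply: (le_trans (cabsD _ _)); apply: lerD.
      apply: (le_trans (cabsD _ _)); rewrite cabs1 cabsM cabsR lerD2l mulrC.
      by rewrite ler_wpM2r.
    rewrite cabsM cabsR cabsX mulrC ler_wpM2r//.
    by have := cabs_ge0 y; rewrite expr2; nra.
  have farb : N%:R^-1 * \sum_(i < N | ~~ (cos a <= cos (grid R N i))) cabs (G (grid R N i))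
      <= n%:R * K2 / l ^+ 2 + n%:R * (K3 / l ^+ 2).
    rewrite (eq_bigl (fun i : 'I_N => cos (grid R N i) < cos a)) => [|i]; last by rewrite ltNge.
    apply: (@le_trans _ _ (N%:R^-1 * \sum_(i < N | cos (grid R N i) < cos a)
        cabs (level_gf (t n) (cis (grid R N i))) + N%:R^-1 * \sum_(i < N) n%:R * (K3 / l ^+ 2))).
      rewrite -mulrDr ler_wpM2l ?invr_ge0//.
      apply: (@le_trans _ _ (\sum_(i < N | cos (grid R N i) < cos a)
        cabs (level_gf (t n) (cis (grid R N i))) + \sum_(i < N | cos (grid R N i) < cos a) n%:R * (K3 / l ^+ 2))).
        rewrite -big_split/=; apply: ler_sum => i ci.
        by apply: (le_trans (cabsB _ _)); rewrite lerD2l modelb.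
      rewrite lerD2l big_mkcond; apply: ler_sum => i _; case: ifP => // _.
      by rewrite mulr_ge0// divr_ge0// sqr_ge0.
    apply: lerD => //.
    by rewrite sumr_const card_ord -[X in _^-1 * X]mulr_natl mulKf// gt_eqF.
  apply: (le_trans (lerD nearb farb)).
  have h3 : 3 <= n%:R * (3 / l ^+ 2).
    by rewrite mulrA ler_pdivlMr ?exprn_gt0// mulrC ler_wpM2r.
  have -> : n%:R * ((3 + K0 + K2 + K3) / l ^+ 2) = n%:R * (3 / l ^+ 2) +
     9 * 20 ^+ 2 * (n%:R * K1) / l ^+ 2 + (n%:R * K2 / l ^+ 2 + n%:R * (K3 / l ^+ 2)).
    by rewrite /K0; ring.
  by rewrite lerD2r lerD2r.
have tailb : expR (- l) * exp_tail N l <= 2 / l ^+ 2.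
  apply: le_trans (expRN_le l0); rewrite ler_piMr ?expR_ge0//.
  have q1 : 0 < (expR (-1) : R) <= 1 by rewrite expR_gt0 expR_le1 lerN10.
  apply: (le_trans (exp_tail_le N (ltW l0) q1)).
  rewrite expRN invrK -expRN -expRM_natl -expRD expR_le1.
  have : 0 <= 8 * l by lra.
  lra.
have kN : (k.+2 < N)%N := leq_ltn_trans kn nN.
have mb : cabs (dft N k.+2 (fun u => model n (p n) (cis u)) -
    (n%:R * edgeworth l (lin_coef (p n)) (quad_coef (p n)) k)%:C%C) <= n%:R * (2 * KQ / l ^+ 2).
  apply: (le_trans (dft_model (p n) kN (ltW l0))).
  rewrite -[leLHS]mulrA ler_wpM2l// -/l.
  have -> : 2 * KQ / l ^+ 2 = KQ * (2 / l ^+ 2) by ring.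
  apply: ler_pM tailb; last exact: Q_le.
    by rewrite addr_ge0 ?mulr_ge0// addr_ge0 ?mulr_ge0.
  by rewrite mulr_ge0 ?expR_ge0 ?exp_tail_ge0// ltW.
set Ed := edgeworth _ _ _ _ in mb *.
rewrite -(ler_pM2l nR).
have -> : n%:R * `|(profile (t n) k.+2)%:R / n%:R - Ed| = cabs ((profile (t n) k.+2)%:R - (n%:R * Ed)%:C%C : C).
  have -> : (profile (t n) k.+2)%:R - (n%:R * Ed)%:C%C =
      (n%:R * ((profile (t n) k.+2)%:R / n%:R - Ed))%:C%C :> C.
    by rewrite mulrBr mulrCA divff ?gt_eqF// mulr1 rmorphB/= rmorph_nat.
  by rewrite cabsR normrM gtr0_norm.
have szN : (size (externals (t n)) <= N)%N by rewrite sz.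
rewrite -(profile_dft kN szN).
apply: (le_trans (cabs_dist _ (dft N k.+2 (fun u => model n (p n) (cis u))) _)).
rewrite -dftB; apply: (le_trans (lerD dG mb)).
by rewrite -mulrDr -mulrDl.
Qed.

End LocalExpansion.

(** * Stirling's formula to the second order *)

Section Stirling.
Variable R : realType.
Implicit Types (x y : R) (n m k : nat).

Lemma ge0_of_derive (f df : R -> R) (b : R) : 0 <= b -> f 0 = 0 ->
  (forall x, 0 <= x <= b -> is_derive x 1 f (df x)) ->
  (forall x, 0 <= x <= b -> 0 <= df x) -> 0 <= f b.
Proof.
move=> b0 f0 fd df0.
have [c] : exists2 c, c \in `[0, b]%R & f b - f 0 = df c * (b - 0).
  apply: MVT_segment => // [x|].
    by rewrite in_itv/= => /andP[/ltW x0 /ltW xb]; apply: fd; rewrite x0 xb.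
  apply: derivable_within_continuous => x; rewrite in_itv/= => xb.
  by apply: ex_derive; exact: fd.
rewrite in_itv/= f0 !subr0 => cb ->; apply: mulr_ge0 => //; exact: df0.
Qed.

Lemma is_derive_add (f g : R -> R) x df dg : is_derive x 1 f df -> is_derive x 1 g dg ->
  is_derive x 1 (fun y => f y + g y) (df + dg).
Proof. exact: is_deriveD. Qed.

Lemma is_derive_sub (f g : R -> R) x df dg : is_derive x 1 f df -> is_derive x 1 g dg ->
  is_derive x 1 (fun y => f y - g y) (df - dg).
Proof. exact: is_deriveB. Qed.

Lemma is_derive_mul (f g : R -> R) x df dg : is_derive x 1 f df -> is_derive x 1 g dg ->
  is_derive x 1 (fun y => f y * g y) (df * g x + f x * dg).
Proof.
move=> hf hg; apply: (is_derive_eq (is_deriveM hf hg)).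
by rewrite /GRing.scale/= addrC [df * _]mulrC.
Qed.

Lemma is_derive_scale c (f : R -> R) x df : is_derive x 1 f df -> is_derive x 1 (fun y => c * f y) (c * df).
Proof. by move=> hf; exact: (is_deriveZ c). Qed.

Lemma is_derive_expn (f : R -> R) n x df : is_derive x 1 f df ->
  is_derive x 1 (fun y => f y ^+ n) (n%:R * f x ^+ n.-1 * df).
Proof.
move=> hf; have := is_deriveX n hf.
by rewrite (_ : f ^+ n = (fun y => f y ^+ n))//; apply/funext => y; rewrite exprfctE.
Qed.

Lemma is_derive_inv (f : R -> R) x df : f x != 0 -> is_derive x 1 f df ->
  is_derive x 1 (fun y => (f y)^-1) (- df / f x ^+ 2).
Proof.
move=> fx hf; apply: (is_derive_eq (is_deriveV fx hf)).
by rewrite /GRing.scale/= mulNr mulNr mulrC.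
Qed.

Lemma is_derive_const (c : R) x : is_derive x 1 (fun=> c) 0.
Proof. exact: is_derive_cst. Qed.

Lemma is_derive_ident x : is_derive x 1 (fun y => y) 1.
Proof. exact: is_derive_id. Qed.

Lemma is_derive_ln_onePx x : -1 < x -> is_derive x 1 (fun y => ln (1 + y)) (1 + x)^-1.
Proof.
move=> x1.
have h : is_derive (1 + x) 1 (@ln R) (1 + x)^-1 by apply: is_derive1_ln; lra.
by apply: (is_derive_eq (is_derive1_comp h (is_derive_add (is_derive_const 1 x) (is_derive_ident x)))); rewrite add0r mulr1.
Qed.

Lemma is_derive_ln_oneBx x : x < 1 -> is_derive x 1 (fun y => ln (1 - y)) (- (1 - x)^-1).
Proof.
move=> x1.
have h : is_derive (1 - x) 1 (@ln R) (1 - x)^-1 by apply: is_derive1_ln; lra.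
have hb : is_derive x 1 (fun y : R => 1 - y) (0 - 1) := is_derive_sub (is_derive_const 1 x) (is_derive_ident x).
have := @is_derive1_comp R (@ln R) (fun y => 1 - y) x _ _ h hb.
by rewrite sub0r mulrN1.
Qed.

Lemma ln_ratio_ge x : 0 <= x < 1 -> 2 * x + 2 / 3 * x ^+ 3 <= ln (1 + x) - ln (1 - x).
Proof.
move=> /andP[x0 x1]; rewrite -subr_ge0.
apply: (@ge0_of_derive (fun y => ln (1 + y) - ln (1 - y) - (2 * y + 2 / 3 * y ^+ 3))
  (fun y => (1 + y)^-1 + (1 - y)^-1 - (2 + 2 * y ^+ 2)) x x0).
- by rewrite addr0 subr0 ln1 expr0n/= !mulr0; ring.
- move=> y /andP[y0 yx].
  have h1 : is_derive y 1 (fun y => ln (1 + y)) (1 + y)^-1 by apply: is_derive_ln_onePx; lra.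
  have h2 : is_derive y 1 (fun y => ln (1 - y)) (- (1 - y)^-1) by apply: is_derive_ln_oneBx; lra.
  have h3 := is_derive_add (is_derive_scale 2 (is_derive_ident y)) (is_derive_scale (2 / 3) (is_derive_expn 3 (is_derive_ident y))).
  apply: (is_derive_eq (is_derive_sub (is_derive_sub h1 h2) h3)) => /=; field.
  by rewrite !gt_eqF//; lra.
- move=> y /andP[y0 yx].
  have -> : (1 + y)^-1 + (1 - y)^-1 - (2 + 2 * y ^+ 2) = 2 * y ^+ 4 / ((1 + y) * (1 - y)).
    by field; rewrite !gt_eqF//; lra.
  by rewrite divr_ge0 ?mulr_ge0 ?exprn_ge0//; lra.
Qed.

Lemma ln_ratio_le x : 0 <= x < 1 ->
  ln (1 + x) - ln (1 - x) <= 2 * x + 2 / 3 * x ^+ 3 / (1 - x ^+ 2).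
Proof.
move=> /andP[x0 x1]; rewrite -subr_ge0.
apply: (@ge0_of_derive (fun y => 2 * y + 2 / 3 * y ^+ 3 / (1 - y ^+ 2) - (ln (1 + y) - ln (1 - y)))
  (fun y => 2 + 2 / 3 * (3 * y ^+ 2 - y ^+ 4) / (1 - y ^+ 2) ^+ 2 - ((1 + y)^-1 + (1 - y)^-1)) x x0).
- by rewrite addr0 subr0 ln1 expr0n/= !mulr0; ring.
- move=> y /andP[y0 yx].
  have h1 : is_derive y 1 (fun y => ln (1 + y)) (1 + y)^-1 by apply: is_derive_ln_onePx; lra.
  have h2 : is_derive y 1 (fun y => ln (1 - y)) (- (1 - y)^-1) by apply: is_derive_ln_oneBx; lra.
  have y2 : 1 - y ^+ 2 != 0 by rewrite gt_eqF//; nra.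
  have h3 := @is_derive_inv (fun z => 1 - z ^+ 2) y _ y2 (is_derive_sub (is_derive_const 1 y) (is_derive_expn 2 (is_derive_ident y))).
  have h4 := is_derive_add (is_derive_scale 2 (is_derive_ident y)) (is_derive_mul (is_derive_scale (2 / 3) (is_derive_expn 3 (is_derive_ident y))) h3).
  apply: (is_derive_eq (is_derive_sub h4 (is_derive_sub h1 h2))) => /=; field.
  by rewrite y2 !gt_eqF//; lra.
- move=> y /andP[y0 yx].
  have y2 : 1 - y ^+ 2 != 0 by rewrite gt_eqF//; nra.
  have -> : 2 + 2 / 3 * (3 * y ^+ 2 - y ^+ 4) / (1 - y ^+ 2) ^+ 2 - ((1 + y)^-1 + (1 - y)^-1)
     = 4 / 3 * y ^+ 4 / (1 - y ^+ 2) ^+ 2.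
    by field; rewrite y2 !gt_eqF//; lra.
  by rewrite divr_ge0 ?mulr_ge0 ?exprn_ge0//; nra.
Qed.

(** The logarithm of [k! / ((k / e) ^ k sqrt k)]. *)
Definition stirling k : R := ln (k`!%:R) - (k%:R + 1 / 2) * ln k%:R + k%:R.

(** With [x = (2 k + 1)^-1] the ratio [(1 + x) / (1 - x)] is [(k + 1) / k]. *)
Lemma stirling_step k : (0 < k)%N ->
  (12 * k%:R * (k%:R + 1) + 3)^-1 <= stirling k - stirling k.+1 <= (12 * k%:R * (k%:R + 1))^-1.
Proof.
move=> k0; have kR : (0 : R) < k%:R by rewrite ltr0n.
have E : stirling k - stirling k.+1 = (k%:R + 1 / 2) * (ln k.+1%:R - ln k%:R) - 1.
  rewrite /stirling factS natrM lnM ?posrE ?ltr0n ?fact_gt0// -(natr1 k); ring.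
have {E}-> : stirling k - stirling k.+1 = (k%:R + 1 / 2) * (ln (k%:R + 1) - ln k%:R) - 1.
  by rewrite E natr1.
set y := k%:R in kR *.
pose x := (2 * y + 1)^-1.
have y1 : 0 < 2 * y + 1 by lra.
have x0 : 0 <= x by rewrite invr_ge0 ltW.
have x1 : x < 1 by rewrite invf_lt1//; lra.
have e1 : 1 + x = (y + 1) * (2 * x) by rewrite /x; field; rewrite gt_eqF.
have e2 : 1 - x = y * (2 * x) by rewrite /x; field; rewrite gt_eqF.
have x2 : 0 < 2 * x by rewrite mulr_gt0 ?invr_gt0.
have L : ln (1 + x) - ln (1 - x) = ln (y + 1) - ln y.
  rewrite e1 e2 !lnM ?posrE//; try lra.
have y12 : 0 < y + 1 / 2 by lra.
have xr : 0 <= x < 1 by rewrite x0 x1.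
have := ln_ratio_ge xr; have := ln_ratio_le xr; rewrite L => hu hl.
apply/andP; split.
  have := ler_wpM2l (ltW y12) hl.
  have -> : (y + 1 / 2) * (2 * x + 2 / 3 * x ^+ 3) = 1 + (12 * y * (y + 1) + 3)^-1.
    by rewrite /x; field; rewrite !gt_eqF//; nra.
  lra.
have := ler_wpM2l (ltW y12) hu.
have -> : (y + 1 / 2) * (2 * x + 2 / 3 * x ^+ 3 / (1 - x ^+ 2)) = 1 + (12 * y * (y + 1))^-1.
  rewrite /x; field.
  by rewrite !gt_eqF//; nra.
lra.
Qed.

(** Thus [stirling k - (12 k)^-1] increases, and by [stirling_upper_step] it
    decreases after the addition of a term of the next order. *)
Lemma stirling_lower_step k : (0 < k)%N ->
  stirling k - (12 * k%:R)^-1 <= stirling k.+1 - (12 * k.+1%:R)^-1.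
Proof.
move=> k0; have kR : (0 : R) < k%:R by rewrite ltr0n.
have /andP[_] := stirling_step k0; rewrite -(natr1 k); set y := k%:R in kR *.
have -> : (12 * y * (y + 1))^-1 = (12 * y)^-1 - (12 * (y + 1))^-1.
  by field; rewrite !gt_eqF//; lra.
lra.
Qed.

Lemma stirling_upper_step k : (0 < k)%N ->
  stirling k.+1 - (12 * k.+1%:R)^-1 + (48 * k.+1%:R ^+ 2)^-1 <=
  stirling k - (12 * k%:R)^-1 + (48 * k%:R ^+ 2)^-1.
Proof.
move=> k0; have kR : (1 : R) <= k%:R by rewrite ler1n.
have /andP[+ _] := stirling_step k0; rewrite -(natr1 k); set y := k%:R in kR *.
set s := stirling k; set s' := stirling k.+1 => h.
suff : (12 * y)^-1 - (12 * (y + 1))^-1 - ((48 * y ^+ 2)^-1 - (48 * (y + 1) ^+ 2)^-1)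
   <= (12 * y * (y + 1) + 3)^-1 by lra.
have -> : (12 * y)^-1 - (12 * (y + 1))^-1 - ((48 * y ^+ 2)^-1 - (48 * (y + 1) ^+ 2)^-1) =
   (4 * y * (y + 1) - (2 * y + 1)) / (48 * (y ^+ 2 * (y + 1) ^+ 2)).
  by field; rewrite !gt_eqF//; lra.
have y0 : 0 < y by lra.
have y1 : 0 < y + 1 by lra.
rewrite ler_pdivrMr ?mulr_gt0 ?exprn_gt0// [leRHS]mulrC ler_pdivlMr; last by nra.
set w := y * (y + 1).
have w2 : 2 <= w by rewrite /w; nra.
have -> : 12 * y * (y + 1) + 3 = 12 * w + 3 by rewrite /w; ring.
have -> : 4 * y * (y + 1) - (2 * y + 1) = 4 * w - (2 * y + 1) by rewrite /w; ring.
have -> : 48 * (y ^+ 2 * (y + 1) ^+ 2) = 48 * w ^+ 2 by rewrite /w; ring.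
nra.
Qed.

(** A primitive of [sin ^ n], built by the reduction formula. *)
Fixpoint sin_primitive n : R -> R :=
  match n with
  | 0 => fun x => x
  | 1 => fun x => 1 - cos x
  | (m.+1 as m').+1 => fun x =>
      (m'%:R * sin_primitive m x - sin x ^+ m' * cos x) / m'.+1%:R
  end.

Lemma is_derive_sin_primitive n x : is_derive x 1 (sin_primitive n) (sin x ^+ n).
Proof.
suff : is_derive x 1 (sin_primitive n) (sin x ^+ n) /\
       is_derive x 1 (sin_primitive n.+1) (sin x ^+ n.+1) by case.
elim: n => [|n [IH1 IH2]].
  split; first by rewrite expr0; exact: is_derive_ident.
  by apply: (is_derive_eq (is_derive_sub (is_derive_const 1 x) (is_derive_cos x))); rewrite expr1 sub0r opprK.
split => //=.
have hs := is_derive_expn n.+1 (is_derive_sin x).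
have h := is_derive_sub (is_derive_scale n.+1%:R IH1) (is_derive_mul hs (is_derive_cos x)).
apply: (is_derive_eq (is_derive_mul h (is_derive_const (n.+2%:R)^-1 x))); rewrite mulr0 addr0 /=.
have n2 : n.+2%:R != 0 :> R by rewrite pnatr_eq0.
apply: (mulIf n2); rewrite mulfVK//.
have c2 : cos x ^+ 2 = 1 - sin x ^+ 2 by rewrite cos2sin2.
have -> : n.+1%:R * sin x ^+ n * cos x * cos x = n.+1%:R * sin x ^+ n * cos x ^+ 2 by ring.
rewrite c2 !exprS -(natr1 n.+1); ring.
Qed.

(** Wallis's integral of [sin ^ n] over [[0, pi / 2]]. *)
Definition wallis n : R := sin_primitive n (pi / 2).

Lemma sin_primitive0 n : sin_primitive n 0 = 0.
Proof.
suff : sin_primitive n 0 = 0 /\ sin_primitive n.+1 0 = 0 by case.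
elim: n => [|n [IH1 IH2]]; first by rewrite /= cos0 subrr.
by split => //=; rewrite IH1 sin0 mulr0 expr0n/= mul0r subrr mul0r.
Qed.

Lemma wallis_rec n : wallis n.+2 = n.+1%:R / n.+2%:R * wallis n.
Proof. by rewrite /wallis/= cos_pihalf mulr0 subr0 mulrAC. Qed.

Lemma wallis_decr n : wallis n.+1 <= wallis n.
Proof.
rewrite -subr_ge0 /wallis.
have p0 := @pi_gt0 R.
apply: (@ge0_of_derive (fun y => sin_primitive n y - sin_primitive n.+1 y)
   (fun y => sin y ^+ n - sin y ^+ n.+1)).
- by rewrite divr_ge0// ltW.
- by rewrite !sin_primitive0 subrr.
- by move=> x _; apply: is_derive_sub; exact: is_derive_sin_primitive.
- move=> x /andP[x0 xp].
  have s0 : 0 <= sin x by apply: sin_ge0_pi; rewrite x0/=; lra.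
  rewrite exprS -[X in X - _]mul1r -mulrBl mulr_ge0 ?exprn_ge0//.
Qed.

Definition central_ratio m : R := 4 ^+ m * (m`!%:R) ^+ 2 / ((2 * m)`!%:R).

Lemma central_ratio_gt0 m : 0 < central_ratio m.
Proof. by rewrite divr_gt0 ?mulr_gt0 ?exprn_gt0 ?ltr0n ?fact_gt0. Qed.

Lemma central_ratioS m :
  central_ratio m.+1 = central_ratio m * ((2 * m%:R + 2) / (2 * m%:R + 1)).
Proof.
rewrite /central_ratio (_ : 2 * m.+1 = (2 * m).+2)%N; last by lia.
rewrite !factS !natrM exprS -(natr1 (2 * m).+1) -(natr1 (2 * m)) -(natr1 m) natrM.
have f1 : m`!%:R != 0 :> R by rewrite pnatr_eq0 -lt0n fact_gt0.
have f2 : (2 * m)`!%:R != 0 :> R by rewrite pnatr_eq0 -lt0n fact_gt0.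
field; rewrite f2/= !gt_eqF//; have : (0 : R) <= m%:R by []; lra.
Qed.

Lemma wallis_even m : wallis (2 * m) = pi / 2 / central_ratio m.
Proof.
elim: m => [|m IHm].
  by rewrite muln0 /central_ratio muln0 expr0 fact0 expr1n mul1r !divr1.
rewrite (_ : 2 * m.+1 = (2 * m).+2)%N; last by lia.
rewrite wallis_rec IHm central_ratioS -(natr1 (2 * m).+1) -(natr1 (2 * m)) natrM.
have c0 := central_ratio_gt0 m; have m0 : (0 : R) <= m%:R by [].
move: (pi : R) => p; field; rewrite !gt_eqF//; lra.
Qed.

Lemma wallis_odd m : wallis (2 * m).+1 = central_ratio m / (2 * m%:R + 1).
Proof.
elim: m => [|m IHm].
  rewrite muln0 /wallis/= cos_pihalf subr0 /central_ratio muln0 expr0 fact0 expr1n mul1r.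
  by rewrite mulr0 add0r !divr1.
rewrite (_ : 2 * m.+1 = (2 * m).+2)%N; last by lia.
rewrite wallis_rec IHm central_ratioS -(natr1 (2 * m).+2) -(natr1 (2 * m).+1) -(natr1 (2 * m)) natrM -(natr1 m).
have c0 := central_ratio_gt0 m; have m0 : (0 : R) <= m%:R by [].
field; rewrite !gt_eqF//; lra.
Qed.

(** Wallis's product: the integrals decrease, and those of even and odd exponents
    are [pi / (2 c)] and [c / (2 m + 1)] for the central ratio [c]. *)
Lemma central_ratio_bounds m : (0 < m)%N ->
  pi * m%:R <= central_ratio m ^+ 2 <= pi * (m%:R + 1 / 2).
Proof.
case: m => // k _; set m := k.+1; have mR : (0 : R) < m%:R by rewrite ltr0n.
have c0 := central_ratio_gt0 m; have p0 := @pi_gt0 R.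
have d1 : wallis (2 * m).+1 <= wallis (2 * m) by exact: wallis_decr.
have d2 : wallis (2 * m) <= wallis (2 * k).+1.
  by rewrite (_ : 2 * m = (2 * k).+2)%N ?wallis_decr// /m; lia.
have cE : central_ratio k / (2 * k%:R + 1) = central_ratio m / (2 * m%:R).
  rewrite /m central_ratioS -(natr1 k).
  have q0 : (0 : R) <= k%:R by [].
  have r0 := central_ratio_gt0 k.
  by field; rewrite !gt_eqF//; lra.
rewrite wallis_odd wallis_even in d1; rewrite wallis_even wallis_odd cE in d2.
have h1 : 0 < 2 * m%:R + 1 :> R by lra.
have h2 : 0 < 2 * m%:R :> R by lra.
apply/andP; split.
  move: d2; rewrite ler_pdivrMr// mulrAC ler_pdivlMr// -expr2; lra.
move: d1; rewrite ler_pdivlMr// mulrAC ler_pdivrMr// -expr2; lra.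
Qed.

End Stirling.

(** * Poisson probabilities through Stirling's formula *)

Section PoissonAsymptotics.
Variable R : realType.
Implicit Types (x y s t l A B T : R) (n m k : nat).

(** The limit of [stirling]. *)
Definition stirling_limit : R := ln (2 * pi) / 2.

Lemma stirling_mono k m : (0 < k)%N -> (k <= m)%N ->
  stirling R k - (12 * k%:R)^-1 <= stirling R m - (12 * m%:R)^-1 /\
  stirling R m - (12 * m%:R)^-1 + (48 * m%:R ^+ 2)^-1 <=
  stirling R k - (12 * k%:R)^-1 + (48 * k%:R ^+ 2)^-1.
Proof.
move=> k0; elim: m => [|m IHm]; first by lia.
rewrite leq_eqVlt => /orP[/eqP <- //|]; rewrite ltnS => km.
have [h1 h2] := IHm km; have m0 : (0 < m)%N := leq_trans k0 km.
split; first exact: le_trans h1 (stirling_lower_step R m0).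
exact: le_trans (stirling_upper_step R m0) h2.
Qed.

Lemma ln_fact k : (0 < k)%N -> ln k`!%:R = stirling R k + (k%:R + 1 / 2) * ln k%:R - k%:R.
Proof. by move=> k0; rewrite /stirling; ring. Qed.

(** In this combination the powers of [m] cancel, and the central ratio remains. *)
Lemma stirling_double m : (0 < m)%N ->
  ln (2 * pi) <= 4 * stirling R m - 2 * stirling R (2 * m) <= ln (2 * pi) + (2 * m%:R)^-1.
Proof.
move=> m0; have mR : (0 : R) < m%:R by rewrite ltr0n.
have p0 := @pi_gt0 R; have c0 := central_ratio_gt0 R m.
have /andP[b1 b2] := central_ratio_bounds R m0.
have f1 : (0 : R) < m`!%:R by rewrite ltr0n fact_gt0.
have f2 : (0 : R) < (2 * m)`!%:R by rewrite ltr0n fact_gt0.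
have E : 4 * stirling R m - 2 * stirling R (2 * m) = 2 * ln (central_ratio R m) - ln m%:R + ln 2.
  rewrite /central_ratio ln_div ?posrE ?mulr_gt0 ?exprn_gt0//.
  rewrite lnM ?posrE ?exprn_gt0// !lnXn// -[ln 4 *+ m]mulr_natl.
  have -> : ln (2 * m)`!%:R =
      stirling R (2 * m) + (2 * m%:R + 1 / 2) * (ln 2 + ln m%:R) - 2 * m%:R.
    by rewrite ln_fact ?muln_gt0// natrM lnM ?posrE.
  have -> : ln 4 = 2 * ln 2 :> R by rewrite (_ : 4 = 2 * 2 :> R) ?lnM ?posrE//; ring.
  by rewrite ln_fact//; field.
have c2 : 2 * ln (central_ratio R m) = ln (central_ratio R m ^+ 2) by rewrite lnXn// mulr_natl.
have l2 : ln (2 * pi) = ln 2 + ln pi :> R by rewrite lnM ?posrE.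
rewrite E c2 l2; apply/andP; split.
  have : ln (pi * m%:R) <= ln (central_ratio R m ^+ 2).
    by rewrite ler_ln ?posrE ?exprn_gt0 ?mulr_gt0.
  rewrite lnM ?posrE//; lra.
have m1 : 0 < m%:R + 1 / 2 :> R by lra.
have : ln (central_ratio R m ^+ 2) <= ln (pi * (m%:R + 1 / 2)).
  by rewrite ler_ln ?posrE ?exprn_gt0 ?mulr_gt0.
have i0 : 0 < (2 * m%:R)^-1 :> R by rewrite invr_gt0 mulr_gt0.
have -> : pi * (m%:R + 1 / 2) = pi * (m%:R * (1 + (2 * m%:R)^-1)) :> R.
  by congr (_ * _); field; rewrite gt_eqF.
set i := (2 * m%:R)^-1 in i0 *.
have i1 : 0 < 1 + i by lra.
have -> : ln (pi * (m%:R * (1 + i))) = ln pi + (ln m%:R + ln (1 + i)).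
  by rewrite !lnM ?posrE ?mulr_gt0.
have : ln (1 + i) <= i by apply: le_ln1Dx; lra.
lra.
Qed.

(** The two monotone sequences have a common limit, which [stirling_double]
    identifies. *)
Lemma stirling_bounds k : (0 < k)%N ->
  stirling_limit + (12 * k%:R)^-1 - (48 * k%:R ^+ 2)^-1 <= stirling R k <=
  stirling_limit + (12 * k%:R)^-1.
Proof.
move=> k0; have key e : 0 < e ->
    stirling R k - (12 * k%:R)^-1 <= stirling_limit + e /\
    stirling_limit <= stirling R k - (12 * k%:R)^-1 + (48 * k%:R ^+ 2)^-1 + e.
  move=> e0; pose m := (Num.truncn e^-1 + k)%N.+1.
  have km : (k <= m)%N by rewrite /m leqW// leq_addl.
  have m0 : (0 < m)%N by [].
  have me : m%:R^-1 <= e.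
    rewrite -[leRHS]invrK lef_pV2 ?posrE ?invr_gt0 ?ltr0n//.
    by rewrite (le_trans (ltW (truncnS_gt _)))// ler_nat /m ltnS leq_addr.
  have mR : (0 : R) < m%:R by rewrite ltr0n.
  have i0 : 0 < m%:R^-1 :> R by rewrite invr_gt0.
  have m2 : (m <= 2 * m)%N by lia.
  have [v1 u1] := stirling_mono k0 km.
  have [v2 u2] := stirling_mono m0 m2.
  have /andP[w1 w2] := stirling_double m0.
  have e1 : (2 * m%:R)^-1 = m%:R^-1 / 2 :> R by rewrite invfM mulrC.
  have e2 : (12 * m%:R)^-1 = m%:R^-1 / 12 :> R by rewrite invfM mulrC.
  have e3 : (12 * (2 * m)%:R)^-1 = m%:R^-1 / 24 :> R.
    by rewrite natrM; field; rewrite gt_eqF.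
  have e4 : (48 * m%:R ^+ 2)^-1 = m%:R^-1 * m%:R^-1 / 48 :> R by field; rewrite gt_eqF.
  have e5 : (48 * (2 * m)%:R ^+ 2)^-1 = m%:R^-1 * m%:R^-1 / 192 :> R.
    by rewrite natrM; field; rewrite gt_eqF.
  have i1 : m%:R^-1 <= 1 :> R by rewrite invf_le1// ler1n.
  rewrite e1 in w2; rewrite e2 e3 in v2; rewrite e2 e4 e3 e5 in u2.
  rewrite e2 in v1; rewrite e2 e4 in u1.
  rewrite /stirling_limit.
  by split; move: v1 u1 v2 u2 w1 w2 me i0 i1; set i := m%:R^-1; nra.
apply/andP; split.
  suff : stirling_limit <= stirling R k - (12 * k%:R)^-1 + (48 * k%:R ^+ 2)^-1 by lra.
  by apply/ler_addgt0Pr => e e0; have [] := key e e0.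
suff : stirling R k - (12 * k%:R)^-1 <= stirling_limit by lra.
by apply/ler_addgt0Pr => e e0; have [] := key e e0.
Qed.

(** The Poisson probabilities on the scale of their maximum. *)
Definition npois l k : R := Num.sqrt (2 * pi * l) * pois l k.

Lemma npois_expR l k : 0 < l -> (0 < k)%N ->
  npois l k = expR (stirling_limit - stirling R k + (k%:R - l)
    - (k%:R + 1 / 2) * ln (1 + (k%:R - l) / l)).
Proof.
move=> l0 k0; have kR : (0 : R) < k%:R by rewrite ltr0n.
have p0 := @pi_gt0 R.
have f0 : (0 : R) < k`!%:R by rewrite ltr0n fact_gt0.
have -> : 1 + (k%:R - l) / l = k%:R / l by field; rewrite gt_eqF.
rewrite ln_div ?posrE// /npois.
have -> : Num.sqrt (2 * pi * l) = expR (stirling_limit + ln l / 2).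
  have q0 : 0 < 2 * pi * l by rewrite !mulr_gt0.
  have -> : stirling_limit + ln l / 2 = ln (2 * pi * l) / 2.
    have q1 : 0 < 2 * pi :> R by rewrite mulr_gt0.
    by rewrite /stirling_limit -mulrDl -lnM ?posrE.
  apply/eqP; rewrite -(eqrXn2 (_ : 0 < 2)%N) ?sqrtr_ge0 ?expR_ge0//.
  by rewrite sqr_sqrtr ?(ltW q0)// -expRM_natl mulrCA divff// mulr1 lnK.
have -> : pois l k = expR (- l + k%:R * ln l - ln k`!%:R).
  by rewrite /pois expRB expRD expRM_natl !lnK ?posrE.
by rewrite -expRD; congr expR; rewrite ln_fact //; field.
Qed.

Lemma ln1D_taylor2 s : `|s| <= 1 / 2 -> `|ln (1 + s) - s + s ^+ 2 / 2| <= `|s| ^+ 3.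
Proof.
have [s0|s0] := leP 0 s => hs.
- rewrite (ger0_norm s0) in hs *.
  have e1 : 0 <= ln (1 + s) - (s - s ^+ 2 / 2).
    apply: (@ge0_of_derive _ (fun y => ln (1 + y) - (y - y ^+ 2 / 2))
       (fun y => (1 + y)^-1 - (1 - y)) s s0).
    + by rewrite addr0 ln1 expr0n/= mul0r !subr0.
    + move=> y /andP[y0 ys].
      have h1 : is_derive y 1 (fun y => ln (1 + y)) (1 + y)^-1 by apply: is_derive_ln_onePx; lra.
      have h2 := is_derive_mul (is_derive_expn 2 (is_derive_ident y)) (is_derive_const 2^-1 y).
      apply: (is_derive_eq (is_derive_sub h1 (is_derive_sub (is_derive_ident y) h2))) => /=; field.
      by rewrite gt_eqF//; lra.
    + move=> y /andP[y0 ys].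
      have -> : (1 + y)^-1 - (1 - y) = y ^+ 2 / (1 + y) by field; rewrite gt_eqF//; lra.
      by rewrite divr_ge0 ?sqr_ge0//; lra.
  have e2 : 0 <= s ^+ 3 / 3 - (ln (1 + s) - (s - s ^+ 2 / 2)).
    apply: (@ge0_of_derive _ (fun y => y ^+ 3 / 3 - (ln (1 + y) - (y - y ^+ 2 / 2)))
       (fun y => y ^+ 2 - ((1 + y)^-1 - (1 - y))) s s0).
    + by rewrite addr0 ln1 !expr0n/= !mul0r !subr0.
    + move=> y /andP[y0 ys].
      have h1 : is_derive y 1 (fun y => ln (1 + y)) (1 + y)^-1 by apply: is_derive_ln_onePx; lra.
      have h2 := is_derive_mul (is_derive_expn 2 (is_derive_ident y)) (is_derive_const 2^-1 y).
      have h3 := is_derive_mul (is_derive_expn 3 (is_derive_ident y)) (is_derive_const 3^-1 y).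
      apply: (is_derive_eq (is_derive_sub h3 (is_derive_sub h1 (is_derive_sub (is_derive_ident y) h2)))) => /=; field.
      by rewrite gt_eqF//; lra.
    + move=> y /andP[y0 ys].
      have -> : y ^+ 2 - ((1 + y)^-1 - (1 - y)) = y ^+ 3 / (1 + y) by field; rewrite gt_eqF//; lra.
      by rewrite divr_ge0 ?exprn_ge0//; lra.
  have s3 : 0 <= s ^+ 3 by rewrite exprn_ge0.
  by rewrite ger0_norm; lra.
have [x sE] : exists x, s = - x by exists (- s); rewrite opprK.
have x0 : 0 <= x by rewrite -oppr_le0 -sE ltW.
rewrite sE normrN (ger0_norm x0) sqrrN opprK; rewrite sE normrN (ger0_norm x0) in hs.
have e1 : 0 <= - ln (1 - x) - (x + x ^+ 2 / 2).
  apply: (@ge0_of_derive _ (fun y => - ln (1 - y) - (y + y ^+ 2 / 2))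
     (fun y => (1 - y)^-1 - (1 + y)) x x0).
  + by rewrite subr0 ln1 expr0n/= mul0r oppr0 addr0 subr0.
  + move=> y /andP[y0 ys].
    have h1 : is_derive y 1 (fun y => ln (1 - y)) (- (1 - y)^-1) by apply: is_derive_ln_oneBx; lra.
    have h2 := is_derive_mul (is_derive_expn 2 (is_derive_ident y)) (is_derive_const 2^-1 y).
    have h4 := is_derive_sub (is_derive_const 0 y) h1.
    have := is_derive_sub h4 (is_derive_add (is_derive_ident y) h2).
    have -> : (fun y => 0 - ln (1 - y) - (y + y ^+ 2 / 2)) = (fun y => - ln (1 - y) - (y + y ^+ 2 / 2)) :> (R -> R).
      by apply/funext => z; rewrite sub0r.
    move=> h5; apply: (is_derive_eq h5) => /=; field.
    by rewrite gt_eqF//; lra.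
  + move=> y /andP[y0 ys].
    have -> : (1 - y)^-1 - (1 + y) = y ^+ 2 / (1 - y) by field; rewrite gt_eqF//; lra.
    by rewrite divr_ge0 ?sqr_ge0//; lra.
have e2 : 0 <= x ^+ 3 * (2 / 3) - (- ln (1 - x) - (x + x ^+ 2 / 2)).
  apply: (@ge0_of_derive _ (fun y => y ^+ 3 * (2 / 3) - (- ln (1 - y) - (y + y ^+ 2 / 2)))
     (fun y => 2 * y ^+ 2 - ((1 - y)^-1 - (1 + y))) x x0).
  + by rewrite subr0 ln1 !expr0n/= !mul0r oppr0 addr0 !subr0.
  + move=> y /andP[y0 ys].
    have h1 : is_derive y 1 (fun y => ln (1 - y)) (- (1 - y)^-1) by apply: is_derive_ln_oneBx; lra.
    have h2 := is_derive_mul (is_derive_expn 2 (is_derive_ident y)) (is_derive_const 2^-1 y).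
    have h3 := is_derive_mul (is_derive_expn 3 (is_derive_ident y)) (is_derive_const (2 / 3) y).
    have h4 := is_derive_sub (is_derive_const 0 y) h1.
    have := is_derive_sub h3 (is_derive_sub h4 (is_derive_add (is_derive_ident y) h2)).
    have -> : (fun y => y ^+ 3 * (2 / 3) - (0 - ln (1 - y) - (y + y ^+ 2 / 2))) =
       (fun y => y ^+ 3 * (2 / 3) - (- ln (1 - y) - (y + y ^+ 2 / 2))) :> (R -> R).
      by apply/funext => z; rewrite sub0r.
    move=> h5; apply: (is_derive_eq h5) => /=; field.
    by rewrite gt_eqF//; lra.
  + move=> y /andP[y0 ys].
    have -> : 2 * y ^+ 2 - ((1 - y)^-1 - (1 + y)) = y ^+ 2 * (1 - 2 * y) / (1 - y) by field; rewrite gt_eqF//; lra.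
    by rewrite divr_ge0 ?mulr_ge0 ?sqr_ge0//; lra.
have x3 : 0 <= x ^+ 3 by rewrite exprn_ge0.
rewrite ler0_norm; lra.
Qed.

End PoissonAsymptotics.

(** * Poisson probabilities near and away from the mean *)

Section EdgeworthAsymptotics.
Variable R : realType.
Implicit Types (x y s t l A B T : R) (n m k : nat).

(** Stirling's formula and the expansion of the logarithm to the second order. The
    constant [1 / 6] stems from the term [(12 k)^-1] of Stirling's formula; since
    [t ^ 2 + t + 1 / 6 = (t + 1 / 2) ^ 2 - 1 / 12], it is the origin of the
    constant [1 / 12] in the theorem. *)
Lemma npois_local T : 1 <= T -> exists K l0, [/\ 0 <= K, 1 <= l0 &
  forall l k, l0 <= l -> `|k%:R - l| <= T ->
  `|npois l k - (1 - ((k%:R - l) ^+ 2 + (k%:R - l) + 1 / 6) / (2 * l))| <= K / l ^+ 2].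
Proof.
move=> T1; exists (103 * T ^+ 4), (16 * T ^+ 2).
have T0 : 0 < T by lra.
have T2 : T <= T ^+ 2 by rewrite -{1}(expr1 T) ler_weXn2l.
have T3 : T ^+ 2 <= T ^+ 3 by rewrite ler_weXn2l.
have T4 : T ^+ 3 <= T ^+ 4 by rewrite ler_weXn2l.
split; [by rewrite mulr_ge0// exprn_ge0// ltW|lra|].
move=> l k hl; set t := k%:R - l => tT.
have l0 : 0 < l by lra.
have kE : k%:R = l + t by rewrite /t; ring.
have /ler_normlP[t1 t2] := tT.
have kR : l / 2 <= k%:R by lra.
have k0 : (0 < k)%N by rewrite -(ltr0n R); lra.
rewrite npois_expR// -/t.
pose i := l^-1; have i0 : 0 < i by rewrite invr_gt0.
have li : l * i = 1 by rewrite divff// gt_eqF.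
have Ti : T ^+ 2 * i <= 1 / 16 by rewrite ler_pdivrMr//; lra.
pose s := t * i.
have sT : `|s| <= T * i by rewrite normrM (gtr0_norm i0) ler_wpM2r// ltW.
have Ti1 : T * i <= 1 / 16 by apply: le_trans Ti; rewrite ler_wpM2r// ltW.
have := ln1D_taylor2 (le_trans sT (le_trans Ti1 _)); rewrite -/s => hL.
have {}hL : `|ln (1 + s) - s + s ^+ 2 / 2| <= (T * i) ^+ 3.
  apply: (le_trans (hL _)); first by lra.
  by rewrite lerXn2r ?nnegrE//; exact: le_trans (normr_ge0 _) sT.
set rho := ln (1 + s) - s + s ^+ 2 / 2 in hL.
have LE : ln (1 + s) = s - s ^+ 2 / 2 + rho by rewrite /rho; ring.
have /andP[st1 st2] := stirling_bounds R k0.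
rewrite -/s LE.
have i2 : 0 <= i ^+ 2 by rewrite exprn_ge0// ltW.
have rb : `|(l + t + 1 / 2) * rho| <= 2 * T ^+ 3 * i ^+ 2.
  rewrite normrM; apply: (@le_trans _ _ (2 * l * (T * i) ^+ 3)).
    by apply: ler_pM => //; rewrite ger0_norm; lra.
  have -> : 2 * l * (T * i) ^+ 3 = 2 * T ^+ 3 * i ^+ 2 * (l * i) by ring.
  by rewrite li mulr1.
have kinv : `|(12 * k%:R)^-1 - i / 12| <= T ^+ 3 * i ^+ 2.
  have -> : (12 * k%:R)^-1 - i / 12 = - (t / (12 * k%:R)) * i.
    by rewrite /i kE; field; rewrite !gt_eqF//; lra.
  rewrite normrM normrN normrM (gtr0_norm i0) expr2 mulrA ler_wpM2r ?(ltW i0)//.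
  have k12 : 0 < 12 * k%:R :> R by rewrite mulr_gt0 ?ltr0n.
  rewrite normfV (gtr0_norm k12) ler_pdivrMr//.
  have : T ^+ 3 * i * (12 * (l / 2)) <= T ^+ 3 * i * (12 * k%:R).
    by rewrite ler_wpM2l ?mulr_ge0 ?exprn_ge0 ?ltW//; lra.
  have -> : T ^+ 3 * i * (12 * (l / 2)) = 6 * T ^+ 3 * (l * i) by field.
  rewrite li; lra.
have dinv : (48 * k%:R ^+ 2)^-1 <= T ^+ 3 * i ^+ 2.
  apply: (@le_trans _ _ (1 * i ^+ 2)); last by rewrite ler_wpM2r//; have := T1; lra.
  rewrite mul1r /i exprVn lef_pV2 ?posrE ?mulr_gt0 ?exprn_gt0 ?ltr0n//.
  by rewrite !expr2; nra.
set phi := t ^+ 2 + t + 1 / 6.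
set E := _ - _ * _.
have t2T : t ^+ 2 <= T ^+ 2 by rewrite -(real_normK (num_real t)) lerXn2r ?nnegrE// ltW.
have phib : `|phi| <= 3 * T ^+ 2.
  have t20' := sqr_ge0 t; apply/ler_normlP; rewrite /phi; split; lra.
have Eb : `|E + phi * i / 2| <= 5 * T ^+ 3 * i ^+ 2.
  have -> : E + phi * i / 2 = (stirling_limit R + (12 * k%:R)^-1 - stirling R k)
     - ((12 * k%:R)^-1 - i / 12) + (t ^+ 3 / 2 + t ^+ 2 / 4) * i ^+ 2
     - (l + t + 1 / 2) * rho.
    have -> : (t ^+ 3 / 2 + t ^+ 2 / 4) * i ^+ 2 = t - (l + t + 1 / 2) * (s - s ^+ 2 / 2) + (t ^+ 2 + t) * i / 2.
      rewrite /s; apply/eqP; rewrite -subr_eq0; apply/eqP.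
      transitivity ((l * i - 1) * (t - t ^+ 2 * i / 2)); first by field.
      by rewrite li subrr mul0r.
    by rewrite /E /phi; move: (12 * k%:R)^-1 => v; rewrite kE; field.
  have b1 : `|stirling_limit R + (12 * k%:R)^-1 - stirling R k| <= T ^+ 3 * i ^+ 2.
    by rewrite ger0_norm; lra.
  have b2 : `|(t ^+ 3 / 2 + t ^+ 2 / 4) * i ^+ 2| <= T ^+ 3 * i ^+ 2.
    rewrite normrM (ger0_norm i2) ler_wpM2r//.
    apply: (le_trans (ler_normD _ _)).
    rewrite (normrM (t ^+ 3)) (normrM (t ^+ 2)) !normrX (ger0_norm (x := 2^-1))// (ger0_norm (x := 4^-1))//.
    have : `|t| ^+ 3 <= T ^+ 3 by rewrite lerXn2r ?nnegrE// ltW.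
    have : `|t| ^+ 2 <= T ^+ 2 by rewrite lerXn2r ?nnegrE// ltW.
    lra.
  set a1 := _ - stirling R k in b1 *; set a2 := _ - i / 12 in kinv *.
  set a3 := _ * i ^+ 2 in b2 *; set a4 := _ * rho in rb *.
  have := ler_normB (a1 - a2 + a3) a4; have := ler_normD (a1 - a2) a3; have := ler_normB a1 a2.
  lra.
have Eb2 : `|E| <= 7 * (T ^+ 2 * i).
  have := ler_normB (E + phi * i / 2) (phi * i / 2); rewrite addrK.
  have : `|phi * i / 2| <= 3 * T ^+ 2 * i / 2.
    by rewrite normrM (ger0_norm (x := 2^-1))// normrM (gtr0_norm i0) ler_pM2r// ler_pM2r.
  have : 5 * T ^+ 3 * i ^+ 2 <= 5 * (T ^+ 2 * i) * (1 / 16).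
    have -> : 5 * T ^+ 3 * i ^+ 2 = 5 * (T ^+ 2 * i) * (T * i) by ring.
    by rewrite ler_wpM2l// !mulr_ge0 ?exprn_ge0 ?ltW.
  have : 0 <= T ^+ 2 * i by rewrite mulr_ge0 ?exprn_ge0 ?ltW.
  lra.
have hE : `|E| <= 1 / 2 by lra.
have tE := expR_taylor1 hE.
have E2 : E ^+ 2 <= 49 * (T ^+ 4 * i ^+ 2).
  have : `|E| ^+ 2 <= (7 * (T ^+ 2 * i)) ^+ 2.
    rewrite lerXn2r ?nnegrE//; exact: le_trans (normr_ge0 _) Eb2.
  rewrite real_normK ?num_real//.
  by have -> : (7 * (T ^+ 2 * i)) ^+ 2 = 49 * (T ^+ 4 * i ^+ 2) by ring.
have -> : phi / (2 * l) = phi * i / 2 by rewrite /i; field; rewrite gt_eqF.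
have -> : 103 * T ^+ 4 / l ^+ 2 = 98 * (T ^+ 4 * i ^+ 2) + 5 * (T ^+ 4 * i ^+ 2) by rewrite -exprVn -/i; ring.
have -> : expR E - (1 - phi * i / 2) = (expR E - 1 - E) + (E + phi * i / 2) by ring.
apply: (le_trans (ler_normD _ _)).
have : T ^+ 3 * i ^+ 2 <= T ^+ 4 * i ^+ 2 by rewrite ler_wpM2r.
lra.
Qed.

(** The right side is the rate function of the large deviations of the Poisson
    law. *)
Lemma entropy_ge s : `|s| <= 1 / 8 -> s ^+ 2 / 4 <= (1 + s) * ln (1 + s) - s.
Proof.
move=> hs; have h2 : `|s| <= 1 / 2 by lra.
have := ln1D_taylor2 h2; move=> /ler_normlP[h _].
have L : s - s ^+ 2 / 2 - `|s| ^+ 3 <= ln (1 + s) by lra.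
have /ler_normlP[s1 s2] := hs.
apply: (@le_trans _ _ ((1 + s) * (s - s ^+ 2 / 2 - `|s| ^+ 3) - s)).
  have s20 := sqr_ge0 s.
  have -> : `|s| ^+ 3 = `|s| * s ^+ 2 by rewrite exprS real_normK ?num_real.
  have -> : (1 + s) * (s - s ^+ 2 / 2 - `|s| * s ^+ 2) - s =
     s ^+ 2 * (1 / 2 - s / 2 - `|s| - s * `|s|) by field.
  have : 0 <= 1 / 4 - s / 2 - `|s| - s * `|s|.
    have : s * `|s| <= 1 / 64.
      apply: (le_trans (ler_norm _)); rewrite normrM normr_id.
      by have := normr_ge0 s; nra.
    by lra.
  nra.
by rewrite lerD2r ler_wpM2l//; lra.
Qed.

Lemma npois_upper l k : 0 < l -> (0 < k)%N -> let s := (k%:R - l) / l in `|s| <= 1 / 8 ->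
  npois l k <= expR (- (l * s ^+ 2 / 4) + `|s|).
Proof.
move=> l0 k0 s hs; rewrite npois_expR// -/s ler_expR.
have kE : k%:R = l * (1 + s) by rewrite /s; field; rewrite gt_eqF.
have h := entropy_ge hs; have h2 : `|s| <= 1 / 2 by lra.
clearbody s.
have := ln1D_taylor2 h2; move=> /ler_normlP[hL _].
have L : s - s ^+ 2 / 2 - `|s| ^+ 3 <= ln (1 + s) by lra.
have kR : (1 : R) <= k%:R by rewrite ler1n.
have /andP[_ st2] := stirling_bounds R k0.
have /andP[st1 _] := stirling_bounds R k0.
have st0 : stirling_limit R - stirling R k <= 0.
  have : (48 * k%:R ^+ 2)^-1 <= (12 * k%:R)^-1 :> R.
    by rewrite lef_pV2 ?posrE ?mulr_gt0 ?exprn_gt0//; try lra; rewrite expr2; nra.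
  lra.
have s3 : `|s| ^+ 3 <= `|s| / 64.
  rewrite exprS; have := normr_ge0 s; rewrite expr2 => s0; nra.
have s2 : s ^+ 2 <= `|s| / 8.
  by rewrite -(real_normK (num_real s)) expr2; have := normr_ge0 s; nra.
have lh : l * (s ^+ 2 / 4) <= l * ((1 + s) * ln (1 + s) - s) by rewrite ler_wpM2l// ltW.
have := ler_norm (- s); rewrite normrN => sn.
have -> : k%:R - l = l * s by rewrite kE; ring.
rewrite kE; set M := ln (1 + s) in h hL L lh *.
have : l * (1 + s) * M - l * s >= l * s ^+ 2 / 4 by lra.
have := normr_ge0 s; lra.
Qed.

(** Chernoff's bound for a single probability: the term of index [k] of the
    exponential series at [l * (1 + s)] is at most the sum. *)
Lemma pois_chernoff l k s : 0 < l -> `|s| <= 1 / 8 ->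
  (0 <= s /\ l * (1 + s) <= k%:R) \/ (s <= 0 /\ k%:R <= l * (1 + s)) ->
  pois l k <= expR (- (l * (s ^+ 2 / 4))).
Proof.
move=> l0 hs hk; have /ler_normlP[s1 s2] := hs.
have z0 : 0 < 1 + s by lra.
have f0 : (0 : R) < k`!%:R by rewrite ltr0n fact_gt0.
have zl : 0 <= l * (1 + s) by rewrite mulr_ge0// ltW.
have term x : 0 <= x -> x ^+ k / k`!%:R <= expR x.
  move=> x0; case: k {hk f0} => [|k]; first by rewrite expr0 fact0 divr1 -[leLHS]expR0 ler_expR.
  by apply: le_trans (expR_ge1Dxn k x0); rewrite lerDr.
have hln : l * ((1 + s) * ln (1 + s)) <= k%:R * ln (1 + s).
  rewrite mulrA; case: hk => [[s0 hk]|[s0 hk]].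
    by rewrite ler_wpM2r// ln_ge0//; lra.
  by rewrite ler_wnM2r// ln_le0//; lra.
have h := entropy_ge hs.
apply: (@le_trans _ _ (expR (- l + l * (1 + s) - k%:R * ln (1 + s)))); last first.
  have lh : l * (s ^+ 2 / 4) <= l * ((1 + s) * ln (1 + s) - s) by rewrite ler_wpM2l// ltW.
  by rewrite ler_expR; lra.
rewrite expRB expRD expRM_natl lnK ?posrE// /pois -!mulrA ler_wpM2l ?expR_ge0//.
rewrite ler_pdivlMr ?exprn_gt0//.
have -> : l ^+ k / k`!%:R * (1 + s) ^+ k = (l * (1 + s)) ^+ k / k`!%:R by rewrite exprMn mulrAC.
exact: term.
Qed.

End EdgeworthAsymptotics.

(** * The corrected Poisson probabilities near and away from the mean *)

Section EdgeworthExtremes.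
Variable R : realType.
Implicit Types (x y s t l A B T : R) (n m k : nat).

Lemma pois_ge0 l k : 0 <= l -> 0 <= pois l k.
Proof. by move=> l0; rewrite divr_ge0 ?mulr_ge0 ?expR_ge0 ?exprn_ge0. Qed.

Lemma edgeworth_factor l A B k : 0 < l -> let t := k.+2%:R - l in
  edgeworth l A B k = pois l k.+2 * (1 + A * (t / l) + B * ((t ^+ 2 - k.+2%:R) / l ^+ 2)).
Proof.
move=> l0 t; rewrite /edgeworth.
have f0 m : (0 : R) < m`!%:R by rewrite ltr0n fact_gt0.
have E m : pois l m = pois l m.+1 * (m.+1%:R / l).
  rewrite /pois factS natrM exprS; field.
  by rewrite !gt_eqF// ltr0n.
rewrite (E k) (E k.+1) /t -(natr1 k.+1) -(natr1 k); field.
by rewrite gt_eqF.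
Qed.

(** The quadratic polynomial of [npois_local], with the corrections from
    [edgeworth_factor]: the coefficient [A] shifts the vertex of the parabola. *)
Lemma edgeworth_local T KA : 1 <= T -> 1 <= KA -> exists K l0, [/\ 0 <= K, 1 <= l0 &
  forall l A B k, l0 <= l -> `|A| <= KA -> `|B| <= KA -> let t := k.+2%:R - l in `|t| <= T ->
  `|Num.sqrt (2 * pi * l) * edgeworth l A B k
    - (1 - (t ^+ 2 + t + 1 / 6 - 2 * A * t + 2 * B) / (2 * l))| <= K / l ^+ 2].
Proof.
move=> T1 KA1; have [K [l0 [K0 l01 hK]]] := npois_local T1.
have T2 : T <= T ^+ 2 by rewrite -{1}(expr1 T) ler_weXn2l.
have T3 : T ^+ 2 <= T ^+ 3 by rewrite ler_weXn2l.
have T0 : 0 <= T by lra.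
have KA0 : 0 <= KA by lra.
exists (3 * KA * T ^+ 3 + (1 + 3 / 2 * T ^+ 2) * (2 * KA * T ^+ 2) + K * (5 * KA * T ^+ 2)), l0.
have T20 : 0 <= T ^+ 2 by rewrite exprn_ge0.
have T30 : 0 <= T ^+ 3 by rewrite exprn_ge0.
split => //.
  rewrite !addr_ge0 ?mulr_ge0//; lra.
move=> l A B k hl hA hB t ht; have lp : 0 < l by lra.
rewrite edgeworth_factor// [Num.sqrt _ * _]mulrA -/(npois l k.+2) -/t.
have := hK l k.+2 hl ht; rewrite -/t.
pose i := l^-1; have i0 : 0 < i by rewrite invr_gt0.
have i1 : i <= 1 by rewrite invf_le1//; lra.
have li : l * i = 1 by rewrite divff// gt_eqF.
set phi := t ^+ 2 + t + 1 / 6; set p := npois _ _ => hp.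
have {hp} : `|p - (1 - phi * i / 2)| <= K * i ^+ 2.
  by move: hp; rewrite -exprVn -/i invfM -/i mulrCA [2^-1 * _]mulrC mulrA.
set e := p - _ => he.
have pE : p = 1 - phi * i / 2 + e by rewrite /e; ring.
have t2T : t ^+ 2 <= T ^+ 2 by rewrite -(real_normK (num_real t)) lerXn2r ?nnegrE.
have t20 := sqr_ge0 t.
have /ler_normlP[t1 t2] := ht.
have phib : `|phi| <= 3 * T ^+ 2.
  have t20' := sqr_ge0 t; apply/ler_normlP; rewrite /phi; split; lra.
have -> : 1 + A * (t / l) + B * ((t ^+ 2 - k.+2%:R) / l ^+ 2) =
    1 + (A * t - B) * i + B * (t ^+ 2 - t) * i ^+ 2.
  have -> : k.+2%:R = l + t by rewrite /t; ring.
  by rewrite /i; field; rewrite gt_eqF.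
set c := A * t - B; set g := B * (t ^+ 2 - t).
have cb : `|c| <= 2 * KA * T.
  apply: (le_trans (ler_normB _ _)); rewrite normrM.
  have : `|A| * `|t| <= KA * T by apply: ler_pM.
  have : KA * 1 <= KA * T by rewrite ler_wpM2l.
  lra.
have gb : `|g| <= 2 * KA * T ^+ 2.
  rewrite normrM [2 * KA]mulrC -mulrA; apply: ler_pM => //.
  by apply: (le_trans (ler_normB _ _)); rewrite ger0_norm//; lra.
have -> : (phi - 2 * A * t + 2 * B) / (2 * l) = phi * i / 2 - c * i.
  by rewrite /c /i; field; rewrite gt_eqF.
have -> : p * (1 + c * i + g * i ^+ 2) - (1 - (phi * i / 2 - c * i)) =
   - (phi / 2 * c) * i ^+ 2 + (1 - phi * i / 2) * g * i ^+ 2 + e * (1 + c * i + g * i ^+ 2).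
  by rewrite pE; ring.
have i20 : 0 <= i ^+ 2 by rewrite exprn_ge0// ltW.
have -> : forall a, a / l ^+ 2 = a * i ^+ 2 by move=> a; rewrite -exprVn.
have i2 : i ^+ 2 <= 1 by rewrite exprn_ile1// ltW.
have b1 : `|phi / 2 * c| <= 3 * KA * T ^+ 3.
  rewrite normrM [`|phi / 2|]normrM (ger0_norm (x := 2^-1))//.
  have -> : 3 * KA * T ^+ 3 = (3 / 2 * T ^+ 2) * (2 * KA * T) by field.
  by apply: ler_pM => //; lra.
have b2 : `|(1 - phi * i / 2) * g| <= (1 + 3 / 2 * T ^+ 2) * (2 * KA * T ^+ 2).
  rewrite normrM; apply: ler_pM => //.
  apply: (le_trans (ler_normB _ _)); rewrite normr1 lerD2l.
  rewrite normrM (ger0_norm (x := 2^-1))// normrM (gtr0_norm i0).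
  have : `|phi| * i <= `|phi| * 1 by rewrite ler_wpM2l.
  lra.
have b3 : `|1 + c * i + g * i ^+ 2| <= 5 * KA * T ^+ 2.
  apply: (le_trans (ler_normD _ _)).
  have : `|1 + c * i| <= 1 + `|c|.
    apply: (le_trans (ler_normD _ _)); rewrite normr1 lerD2l normrM (gtr0_norm i0).
    by rewrite ler_piMr.
  have : `|g * i ^+ 2| <= `|g| by rewrite normrM (ger0_norm i20) ler_piMr.
  have : KA * T <= KA * T ^+ 2 by rewrite ler_wpM2l.
  have : 1 <= KA * T ^+ 2 by apply: mulr_ege1 => //; lra.
  lra.
apply: (le_trans (ler_normD _ _)); rewrite [leRHS]mulrDl [X in _ <= X + _]mulrDl; apply: lerD.
  apply: (le_trans (ler_normD _ _)); apply: lerD.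
    by rewrite normrM normrN (ger0_norm i20) ler_wpM2r.
  by rewrite normrM (ger0_norm i20) ler_wpM2r.
rewrite normrM [leRHS]mulrAC; apply: ler_pM => //.
Qed.

Lemma expRN_le_half x : 0 <= x -> x <= 1 -> expR (- x) <= 1 - x / 2.
Proof.
move=> x0 x1; have x10 : 0 < 1 + x by lra.
apply: (@le_trans _ _ (1 + x)^-1).
  by rewrite expRN lef_pV2 ?posrE ?expR_gt0// expR_ge1Dx.
rewrite -[leLHS]mul1r ler_pdivrMr//; nra.
Qed.

(** Up to the distance [l / 8] the Gaussian decay [t ^ 2 / (4 l)] exceeds the
    correction, which is linear in [t / l]; beyond that distance the probabilities
    are exponentially small in [l]. *)
Lemma edgeworth_far La KA : 1 <= La -> 1 <= KA -> exists T l0, [/\ 1 <= T, 1 <= l0 &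
  forall l A B k, l0 <= l -> `|A| <= KA -> `|B| <= KA -> T < `|k.+2%:R - l| ->
  Num.sqrt (2 * pi * l) * edgeworth l A B k <= 1 - La / l].
Proof.
move=> La1 KA1; pose T := 12 * KA + 4 * (La + 1).
pose c : R := (1 / 16) ^+ 2 / 4.
have c0 : 0 < c by rewrite divr_gt0// exprn_gt0.
have KA0 : 0 < KA by lra.
pose l0 := 32 + 2 * La + 224 * KA / c ^+ 2.
have k0' : 0 <= 224 * KA / c ^+ 2 by rewrite divr_ge0 ?exprn_ge0 ?mulr_ge0// ltW.
exists T, l0; split; [by rewrite /T; lra|by rewrite /l0; lra|].
move=> l A B k hl hA hB; set t := k.+2%:R - l => hT.
have l32 : 32 + 2 * La <= l by move: hl; rewrite /l0; lra.
have lp : 0 < l by lra.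
pose i := l^-1; have i0 : 0 < i by rewrite invr_gt0.
have li : l * i = 1 by rewrite divff// gt_eqF.
have Lai : 2 * La * i <= 1 by rewrite ler_pdivrMr//; lra.
pose s := t / l.
have sl : `|t| = l * `|s| by rewrite /s normrM normfV (gtr0_norm lp) mulrCA divff ?mulr1// gt_eqF.
rewrite -[La / l]/(La * i).
have [hs|hs] := leP `|s| (1 / 8).
  rewrite edgeworth_factor// [Num.sqrt _ * _]mulrA -/(npois l k.+2) -/t -/s.
  set F := 1 + _ + _.
  have n0 : 0 <= npois l k.+2.
    by rewrite mulr_ge0 ?sqrtr_ge0 ?pois_ge0 ?(ltW lp).
  have FE : F <= expR (F - 1) by apply: le_trans (expR_ge1Dx _); lra.
  apply: (le_trans (ler_wpM2l n0 FE)).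
  have hu := npois_upper lp (isT : (0 < k.+2)%N) hs; rewrite -/s in hu.
  apply: (le_trans (ler_wpM2r (expR_ge0 _) hu)); rewrite -expRD.
  apply: (@le_trans _ _ (expR (- (2 * La * i)))); last first.
    have x0 : 0 <= 2 * La * i by rewrite mulr_ge0 ?(ltW i0)//; lra.
    have := expRN_le_half x0 Lai; lra.
  rewrite ler_expR.
  have -> : l * s ^+ 2 / 4 = `|t| ^+ 2 / 4 * i.
    by rewrite real_normK ?num_real// /s /i; field; rewrite gt_eqF.
  have -> : F - 1 = A * s + B * (s ^+ 2 - (1 + s) * i).
    have -> : s ^+ 2 - (1 + s) * i = (t ^+ 2 - k.+2%:R) / l ^+ 2.
      have -> : k.+2%:R = l + t by rewrite /t; ring.
      by rewrite /s /i; field; rewrite gt_eqF.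
    by rewrite /F -/s; ring.
  have sE : `|s| = `|t| * i by rewrite sl mulrAC li mul1r.
  have As : A * s <= KA * `|s|.
    by apply: (le_trans (ler_norm _)); rewrite normrM ler_wpM2r.
  have Bs : B * (s ^+ 2 - (1 + s) * i) <= KA * (`|s| / 8 + 2 * i).
    apply: (le_trans (ler_norm _)); rewrite normrM; apply: ler_pM => //.
    apply: (le_trans (ler_normB _ _)); apply: lerD.
      by rewrite normrX expr2 ler_wpM2l//; lra.
    rewrite normrM (gtr0_norm i0) ler_wpM2r ?(ltW i0)//.
    by apply: (le_trans (ler_normD _ _)); rewrite normr1; lra.
  apply: (@le_trans _ _ (- (`|t| ^+ 2 / 4 * i) + `|s| + (KA * `|s| + KA * (`|s| / 8 + 2 * i)))).
    by lra.
  rewrite sE -subr_ge0.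
  have -> : - (2 * La * i) - (- (`|t| ^+ 2 / 4 * i) + `|t| * i + (KA * (`|t| * i) + KA * (`|t| * i / 8 + 2 * i))) =
    i * (`|t| ^+ 2 / 4 - `|t| * (1 + KA + KA / 8) - 2 * KA - 2 * La) by field.
  rewrite mulr_ge0 ?(ltW i0)//.
  have h1 : `|t| * (1 + KA + KA / 8) <= `|t| * (3 * KA) by rewrite ler_wpM2l//; lra.
  have h2 : T * (La + 1) <= `|t| * (`|t| / 4 - 3 * KA).
    by apply: ler_pM; move: hT; rewrite /T; lra.
  have h3 : 2 * KA + 2 * La <= T * (La + 1) by rewrite /T; nra.
  rewrite expr2; lra.
have l16 : 2 <= l / 16 by lra.
have pb m : (k <= m)%N -> (m <= k.+2)%N -> pois l m <= expR (- (l * c)).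
  move=> km mk.
  have km' : k%:R <= m%:R :> R by rewrite ler_nat.
  have mk' : m%:R <= k.+2%:R :> R by rewrite ler_nat.
  have kk : k.+2%:R = k%:R + 2 :> R by rewrite -addn2 natrD.
  have ls8 : l * (1 / 8) < l * `|s| by rewrite ltr_pM2l.
  have tl8 : l / 8 < `|t| by rewrite sl; lra.
  have [t0|t0] := leP 0 t.
    rewrite ger0_norm// in tl8.
    apply: (@pois_chernoff R l m (1 / 16)) => //; first by rewrite ger0_norm; lra.
    by left; split; move: tl8; rewrite /t; lra.
  rewrite ltr0_norm// in tl8.
  have -> : c = (- (1 / 16)) ^+ 2 / 4 by rewrite /c sqrrN.
  apply: (@pois_chernoff R l m (- (1 / 16))) => //; first by rewrite normrN ger0_norm; lra.
  by right; split; move: tl8; rewrite /t; lra.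
set E := expR _ in pb.
have E0 : 0 <= E by exact: expR_ge0.
have p0 m : 0 <= pois l m by rewrite pois_ge0// ltW.
have eb : edgeworth l A B k <= 7 * KA * E.
  have term a m : (k <= m)%N -> (m <= k.+2)%N -> a * pois l m <= `|a| * E.
    by move=> km mk; apply: (@le_trans _ _ (`|a| * pois l m)); [rewrite ler_wpM2r// ler_norm|rewrite ler_wpM2l// pb].
  rewrite /edgeworth; have h1 := term (1 - A + B) k.+2; have h2 := term (A - 2 * B) k.+1.
  have h3 := term B k.
  have {}h1 := h1 (leqW (leqnSn _)) (leqnn _).
  have {}h2 := h2 (leqnSn _) (leqnSn _).
  have {}h3 := h3 (leqnn _) (leqW (leqnSn _)).
  have n1 := ler_normD (1 - A) B; have n2 := ler_normB 1 A; have n3 := ler_normB A (2 * B).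
  rewrite normr1 in n2; rewrite normrM (ger0_norm (x := 2))// in n3.
  have : (`|1 - A + B| + `|A - 2 * B| + `|B|) * E <= 7 * KA * E by rewrite ler_wpM2r//; lra.
  lra.
have sq : Num.sqrt (2 * pi * l) <= 8 * l.
  rewrite -[leRHS]ger0_norm; last by lra.
  rewrite -sqrtr_sqr ler_wsqrtr//; have := @pihalf_lt2 R; have := @pi_gt0 R.
  rewrite expr2; move: (pi : R) => q; nra.
apply: (@le_trans _ _ (8 * l * (7 * KA * E))).
  apply: (le_trans (ler_wpM2l (sqrtr_ge0 _) eb)).
  by rewrite ler_wpM2r// !mulr_ge0// ltW.
apply: (@le_trans _ _ (1 / 2)); last by lra.
have lc : 0 < l * c by rewrite mulr_gt0.
have hE := expRN_le lc; rewrite -/E in hE.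
apply: (@le_trans _ _ (8 * l * (7 * KA * (2 / (l * c) ^+ 2)))).
  by rewrite ler_wpM2l ?mulr_ge0 ?(ltW lp)// ler_wpM2l// mulr_ge0// ltW.
have -> : 8 * l * (7 * KA * (2 / (l * c) ^+ 2)) = 224 * KA / c ^+ 2 / 2 / l.
  by field; rewrite !gt_eqF.
rewrite ler_pdivrMr//.
move: hl; rewrite /l0; lra.
Qed.

End EdgeworthExtremes.

(** * The width as a minimum over the levels *)

Section WidthOfControlledTrees.
Variable R : realType.
Implicit Types (x y s l A B T : R) (n m k : nat).

Lemma profile_le_pow2 (t : bst) k : (profile t k <= 2 ^ k)%N.
Proof.
elim: t k => [|l IHl r IHr] [|k]; rewrite /profile/=.
- by [].
- exact: leq0n.
- rewrite count_cat !count_map /= !(eq_count (a2 := pred0)) ?count_pred0//; by move=> [].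
- rewrite count_cat !count_map /= expnS mul2n -addnn.
  by apply: leq_add; [exact: IHl|exact: IHr].
Qed.

Lemma profile_eq0 (t : bst) k : (size (externals t) <= k)%N -> profile t k = 0%N.
Proof.
move=> tk; apply/eqP; rewrite -leqn0 leqNgt -has_count; apply/hasPn => v vt.
by rewrite neq_ltn (leq_trans (depth_lt_size vt) tk).
Qed.

Lemma dist_int_le_half x : dist_int x <= 1 / 2.
Proof.
have [h _] := dist_int_min x; have := h (Num.floor x); have := h (Num.floor x + 1).
have /andP[f1 f2] := floor_itv x; rewrite intrD1 in f2 *.
rewrite [`|x - (_ + 1)|]ler0_norm ?ger0_norm; lra.
Qed.

Lemma dist_int_ge0 x : 0 <= dist_int x.
Proof. by have [_ [k ->]] := dist_int_min x. Qed.

Lemma dist_int_lipschitz x y : `|dist_int x - dist_int y| <= `|x - y|.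
Proof.
wlog xy : x y / dist_int y <= dist_int x => [hw|].
  have [/hw//|/ltW /hw] := leP (dist_int y) (dist_int x).
  by rewrite distrC (distrC y).
rewrite ger0_norm ?subr_ge0//; have [_ [k ->]] := dist_int_min y.
have [/(_ k) h _] := dist_int_min x.
by have := ler_distD y x k%:~R; lra.
Qed.

(** The quantity that [Mtilde] would be if the width were the number of nodes at
    depth [k]; hence [Mtilde] is its minimum over [k]. *)
Definition level_deficit n (t : bst) k : R :=
  2 * lam R n * (1 - Num.sqrt (2 * pi * lam R n) * (profile t k)%:R / n%:R).

Lemma Mtilde_width n (t : bst) : Mtilde R n t =
  2 * lam R n * (1 - Num.sqrt (2 * pi * lam R n) * (width t)%:R / n%:R).
Proof.
rewrite /Mtilde (_ : 2 * pi * lam R n = 4 * pi * ln n%:R); last by rewrite /lam; ring.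
by rewrite /lam; ring.
Qed.

Lemma Mtilde_le_deficit n (t : bst) k : (0 < n)%N -> 0 <= lam R n ->
  Mtilde R n t <= level_deficit n t k.
Proof.
move=> n0 l0; rewrite Mtilde_width /level_deficit.
apply: ler_wpM2l; first by rewrite mulr_ge0.
rewrite lerD2l lerN2 ler_pM2r ?invr_gt0 ?ltr0n// ler_wpM2l ?sqrtr_ge0// ler_nat.
by have [h _] := width_max t; exact: h.
Qed.

Lemma Mtilde_deficit n (t : bst) : exists k, Mtilde R n t = level_deficit n t k.
Proof. by have [_ [k hk]] := width_max t; exists k; rewrite Mtilde_width /level_deficit hk. Qed.

Lemma sqrt_2pi_le l : 0 <= l -> Num.sqrt (2 * pi * l) <= 3 * Num.sqrt l.
Proof.
move=> l0; rewrite mulrC sqrtrM// mulrC ler_wpM2r ?sqrtr_ge0//.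
rewrite -[leRHS]ger0_norm// -sqrtr_sqr ler_wsqrtr//.
by have := @pihalf_lt2 R; rewrite expr2; lra.
Qed.

(** At the two uppermost levels there are at most two nodes. *)
Lemma deficit_extreme n (t : bst) k : 1 <= lam R n -> 12 * lam R n <= n%:R ->
  (k <= 1)%N \/ profile t k = 0%N -> lam R n <= level_deficit n t k.
Proof.
move=> l1 ln hk; have nR : (0 : R) < n%:R by lra.
have p2 : (profile t k)%:R <= 2 :> R.
  case: hk => [k1|->]; last by [].
  by rewrite (ler_nat _ _ 2) (leq_trans (profile_le_pow2 _ _))// (@leq_pexp2l 2 k 1).
rewrite /level_deficit; set S := Num.sqrt _.
have Sl : S <= 3 * lam R n.
  have l0 : 0 <= lam R n by lra.
  have s1 : 1 <= Num.sqrt (lam R n) by rewrite -[leLHS]sqrtr1 ler_wsqrtr.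
  apply: (le_trans (sqrt_2pi_le l0)); rewrite ler_wpM2l// -[leRHS](sqr_sqrtr l0).
  by rewrite expr2 ler_peMl// sqrtr_ge0.
have h : S * (profile t k)%:R / n%:R <= 1 / 2.
  rewrite ler_pdivrMr//.
  have : S * (profile t k)%:R <= 3 * lam R n * 2 by rewrite ler_pM// sqrtr_ge0.
  lra.
have : 2 * lam R n * (1 / 2) <= 2 * lam R n * (1 - S * (profile t k)%:R / n%:R).
  by rewrite ler_wpM2l//; lra.
lra.
Qed.

(** If the deficits follow the parabola with vertex [x] near [lam n] and exceed
    its values elsewhere, then their minimum is attained at an integer next to
    [x], whence the distance from [x] to the integers. *)
Lemma Mtilde_of_parabola n (t : bst) x c e T : size (externals t) = n.+1 ->
  `|x - lam R n| + 1 / 2 <= T -> T + 2 <= lam R n -> 12 * lam R n <= n%:R ->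
  1 / 4 + c - e <= lam R n ->
  (forall k, (k.+2 <= n)%N -> `|k.+2%:R - lam R n| <= T ->
     `|level_deficit n t k.+2 - ((k.+2%:R - x) ^+ 2 + c)| <= e) ->
  (forall k, (k.+2 <= n)%N -> T < `|k.+2%:R - lam R n| -> 1 / 4 + c - e <= level_deficit n t k.+2) ->
  `|Mtilde R n t - (dist_int x ^+ 2 + c)| <= e.
Proof.
move=> sz xT Tl ln cl near far.
have T0 : 1 / 2 <= T by have := normr_ge0 (x - lam R n); lra.
have nR : (0 : R) < n%:R by lra.
have n0 : (0 < n)%N by rewrite -(ltr0n R).
have d0 := dist_int_ge0 x; have dh := dist_int_le_half x.
have sq (m : R) : dist_int x <= `|x - m| -> dist_int x ^+ 2 <= (m - x) ^+ 2.
  move=> h; rewrite -[leRHS]sqrrN opprB -[leRHS]real_normK ?num_real//.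
  by rewrite lerXn2r ?nnegrE.
have d2 : dist_int x ^+ 2 <= 1 / 4.
  have -> : 1 / 4 = (1 / 2) ^+ 2 :> R by field.
  by rewrite lerXn2r// nnegrE.
have upper : Mtilde R n t <= dist_int x ^+ 2 + c + e.
  have [_ [m hm]] := dist_int_min x.
  rewrite hm in dh; have /ler_normlP[m1 m2] := dh.
  have := xT; rewrite -lerBrDr => /ler_normlP[x1 x2].
  have mZ : (2 <= m)%R by rewrite -(ler_int R); lra.
  case: m mZ hm {dh} m1 m2 => // -[|[|k]]// _ hm m1 m2.
  have mE : (Posz k.+2)%:~R = k.+2%:R :> R by [].
  rewrite mE in hm m1 m2.
  have kn : (k.+2 <= n)%N by rewrite -(ler_nat R); lra.
  have kT : `|k.+2%:R - lam R n| <= T by apply/ler_normlP; split; lra.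
  have := near k kn kT.
  rewrite -[(k.+2%:R - x) ^+ 2]sqrrN opprB -[(x - _) ^+ 2]real_normK ?num_real// -hm.
  move=> /ler_normlP[_ h].
  have l0 : 0 <= lam R n by lra.
  by have := Mtilde_le_deficit t k.+2 n0 l0; lra.
have [k hk] := Mtilde_deficit n t.
have lower : dist_int x ^+ 2 + c - e <= Mtilde R n t.
  rewrite hk {hk}; have [k1|k1] := leqP k 1.
    have := @deficit_extreme n t k _ ln (or_introl k1); lra.
  case: k k1 => [|[|k]]// _; have [kn|nk] := leqP k.+2 n; last first.
    have k0 : profile t k.+2 = 0%N by rewrite profile_eq0// sz.
    have := @deficit_extreme n t k.+2 _ ln (or_intror k0); lra.
  have [kT|kT] := leP `|k.+2%:R - lam R n| T; last by have := far k kn kT; lra.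
  have /ler_normlP[h _] := near k kn kT.
  have [/(_ (Posz k.+2)) /sq h' _] := dist_int_min x.
  have : dist_int x ^+ 2 <= (k.+2%:R - x) ^+ 2 := h'.
  lra.
by apply/ler_normlP; split; lra.
Qed.

Lemma deficit_local_expansion n (t : bst) l v K : l = lam R n -> 0 < l ->
  forall k, `|(profile t k)%:R / n%:R - v| <= K / l ^+ 2 ->
  `|level_deficit n t k - 2 * l * (1 - Num.sqrt (2 * pi * l) * v)| <= 6 * K / Num.sqrt l.
Proof.
move=> lE l0 k; rewrite /level_deficit -lE; set S := Num.sqrt (2 * pi * l) => h.
have s0 : 0 < Num.sqrt l by rewrite sqrtr_gt0.
have S0 : 0 <= S := sqrtr_ge0 _.
have -> : 2 * l * (1 - S * (profile t k)%:R / n%:R) - 2 * l * (1 - S * v) =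
    2 * l * (S * - ((profile t k)%:R / n%:R - v)) by ring.
have l20 : 0 <= 2 * l by rewrite mulr_ge0// ltW.
rewrite normrM (ger0_norm l20) normrM normrN (ger0_norm S0).
have K0 : 0 <= K / l ^+ 2 := le_trans (normr_ge0 _) h.
apply: (@le_trans _ _ (2 * l * (3 * Num.sqrt l * (K / l ^+ 2)))).
  by rewrite ler_wpM2l// ler_pM// sqrt_2pi_le// ltW.
have sl : l = Num.sqrt l ^+ 2 by rewrite sqr_sqrtr// ltW.
set s := Num.sqrt l in s0 sl *; rewrite sl le_eqVlt; apply/orP; left; apply/eqP.
by field; rewrite gt_eqF.
Qed.

(** The deficits of a controlled sequence of trees: with [c] for
    [2 * B + A - A ^ 2 - 1 / 12], the quadratic polynomial of
    [edgeworth_local] is [(k - (lam n + A - 1 / 2)) ^ 2 + c]. *)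
Lemma Mtilde_approx t (p : nat -> {poly R}) r M a q Mf n1 :
  controlled t p r M a q Mf n1 -> forall e, 0 < e -> exists n0, forall n, (n0 <= n)%N ->
  let A := lin_coef (p n) in let B := quad_coef (p n) in
  `|Mtilde R n (t n) - (dist_int (lam R n + A - 1 / 2) ^+ 2 + (2 * B + A - A ^+ 2 - 1 / 12))| <= e.
Proof.
move=> ctl e e0; have [K1 [n2 [K10 hK1]]] := local_expansion ctl.
case: ctl => t0 tg r0 _ _ _ pM _ _ _.
have M0 : 0 <= M by apply: le_trans (cabs_ge0 _) (pM n1 (leqnn _) 0 _); rewrite cabs0 ltW.
pose KA := 1 + M / r + M / r ^+ 2.
have Mr : 0 <= M / r by rewrite divr_ge0// ltW.
have Mr2 : 0 <= M / r ^+ 2 by rewrite divr_ge0 ?exprn_ge0// ltW.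
have KA1 : 1 <= KA by rewrite /KA; lra.
have AB n : (n1 <= n)%N -> `|lin_coef (p n)| <= KA /\ `|quad_coef (p n)| <= KA.
  move=> nn; have b1 := coef_bound 1 r0 (pM n nn); have b2 := coef_bound 2 r0 (pM n nn).
  rewrite expr1 in b1; rewrite /lin_coef /quad_coef /KA; split; first by lra.
  have := ler_normB (p n)`_2 ((p n)`_1 / 2); rewrite normrM (ger0_norm (x := 2^-1))//.
  have := normr_ge0 (p n)`_1; lra.
clear pM Mr Mr2; move: KA KA1 AB => KA KA1 AB; clear M M0.
pose La := 3 + 3 * KA + KA ^+ 2.
have KA2 : 0 <= KA ^+ 2 by rewrite exprn_ge0//; lra.
have La1 : 1 <= La by rewrite /La; lra.
have [T [l1 [T1 l11 far]]] := edgeworth_far La1 KA1.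
pose T' := T + KA + 1.
have T'1 : 1 <= T' by rewrite /T'; lra.
have [K2 [l2 [K20 l21 loc]]] := edgeworth_local T'1 KA1.
have [m1 hm1] := lam_ge (l1 + l2 + T' + 2 + La + 4 * K2 / e + (12 * K1 / e) ^+ 2 : R).
have [m2 hm2] := lam_pow_le (12 : R) 1.
exists (maxn (maxn n1 n2) (maxn m1 m2)) => n.
rewrite !geq_max => /andP[/andP[/AB[hA hB] /hK1 hn] /andP[/hm1 hl /hm2 hn12]] /=.
have sz : size (externals (t n)) = n.+1 by exact: size_growing.
move: (lin_coef (p n)) (quad_coef (p n)) hA hB hn => A B hA hB hn.
rewrite expr1 in hn12; have [l lE] : exists l, l = lam R n by exists (lam R n).
rewrite -lE in hl hn12 hn *; clear hK1 hm1 hm2 AB n1 n2 t0 tg r0.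
have ee1 : 0 <= 4 * K2 / e by rewrite divr_ge0 ?mulr_ge0// ltW.
have ee2 : 0 <= (12 * K1 / e) ^+ 2 by rewrite sqr_ge0.
have [l1l l2l] : l1 <= l /\ l2 <= l by split; lra.
have [Tl Lal] : T' + 2 <= l /\ La <= l by split; lra.
have l0 : 0 < l by lra.
have err1 : 6 * K1 / Num.sqrt l <= e / 2.
  have s0 : 0 < Num.sqrt l by rewrite sqrtr_gt0.
  have h : 12 * K1 / e <= Num.sqrt l.
    rewrite -[leLHS]ger0_norm ?divr_ge0 ?mulr_ge0 ?(ltW e0)// -sqrtr_sqr ler_wsqrtr//.
    lra.
  rewrite ler_pdivrMr//; move: h; rewrite ler_pdivrMr//; lra.
have err2 : 2 * K2 / l <= e / 2.
  have h : 4 * K2 / e <= l by lra.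
  rewrite ler_pdivrMr//; move: h; rewrite ler_pdivrMr//; lra.
clear hl ee1 ee2.
have /ler_normlP[A1 A2] := hA.
have cb : 2 * B + A - A ^+ 2 <= La - 3.
  have := sqr_ge0 A; have /ler_normlP[_ B2] := hB; rewrite /La; lra.
have D k kn := @deficit_local_expansion n (t n) l _ K1 lE l0 k.+2 (hn k kn).
apply: (@Mtilde_of_parabola n (t n) _ _ e T' sz); rewrite -?lE//.
- have -> : l + A - 1 / 2 - l = A - 1 / 2 by ring.
  by rewrite -lerBrDr; apply/ler_normlP; rewrite /T'; split; lra.
- lra.
- move=> k kn kT; have h := loc l A B k l2l hA hB kT; have {D} := D k kn.
  set X := Num.sqrt _ * _ in h * => D.
  apply: (le_trans (ler_distD (2 * l * (1 - X)) _ _)).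
  rewrite (_ : e = e / 2 + e / 2); last by field.
  apply: lerD; first exact: le_trans D err1.
  apply: le_trans err2.
  rewrite /= in h; set t' := k.+2%:R - l in h.
  have -> : 2 * l * (1 - X) - ((k.+2%:R - (l + A - 1 / 2)) ^+ 2 + (2 * B + A - A ^+ 2 - 1 / 12)) =
     2 * l * - (X - (1 - (t' ^+ 2 + t' + 1 / 6 - 2 * A * t' + 2 * B) / (2 * l))).
    by rewrite /t'; field; rewrite gt_eqF.
  have -> : 2 * K2 / l = 2 * l * (K2 / l ^+ 2) by field; rewrite gt_eqF.
  have l20 : 0 <= 2 * l by rewrite mulr_ge0// ltW.
  by rewrite normrM (ger0_norm l20) ler_wpM2l// normrN.
- move=> k kn kT.
  have lT : T < `|k.+2%:R - l| by rewrite /T' in kT; lra.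
  have h := far l A B k l1l hA hB lT.
  have /ler_normlP[D1 _] := le_trans (D k kn) err1.
  have l20 : 0 <= 2 * l by rewrite mulr_ge0// ltW.
  have h' : La / l <= 1 - Num.sqrt (2 * pi * l) * edgeworth l A B k by lra.
  have := ler_wpM2l l20 h'.
  have -> : 2 * l * (La / l) = 2 * La by field; rewrite gt_eqF.
  lra.
Qed.

End WidthOfControlledTrees.

(** * Subsequential limits *)

Section LimitsOfMtilde.
Variable R : realType.
Implicit Types (x y l A B T : R) (n m k : nat).

Lemma Mtilde_limit t (p : nat -> {poly R}) r M a q Mf n1 (chi chi' : R) :
  controlled t p r M a q Mf n1 ->
  (forall e, 0 < e -> exists n0, forall n, (n0 <= n)%N -> `|lin_coef (p n) - chi| <= e) ->
  (forall e, 0 < e -> exists n0, forall n, (n0 <= n)%N ->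
     `|2 * quad_coef (p n) + lin_coef (p n) - lin_coef (p n) ^+ 2 - chi'| <= e) ->
  (Mtilde R n (t n) - dist_int (2 * ln n%:R + chi - 1 / 2) ^+ 2) @[n --> \oo] --> chi' - 1 / 12.
Proof.
move=> ctl hA hB; apply/cvgrPdist_le => e e0; have e3 : 0 < e / 3 by rewrite divr_gt0.
have [k1 h1] := Mtilde_approx ctl e3; have [k2 h2] := hA _ e3; have [k3 h3] := hB _ e3.
exists (maxn k1 (maxn k2 k3)) => // n /=; rewrite !geq_max => /andP[/h1 {}h1 /andP[/h2 {}h2 /h3 {}h3]].
move: h1 h2 h3 => /=; set A := lin_coef _; set B := quad_coef _; rewrite -/(lam R n).
set x := lam R n; set d := dist_int (x + A - 1 / 2); set d' := dist_int (x + chi - 1 / 2).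
move=> h1 h2 h3.
have hd : `|d - d'| <= `|A - chi|.
  by apply: (le_trans (dist_int_lipschitz _ _)); rewrite (_ : x + A - 1 / 2 - _ = A - chi)//; ring.
have d0 : 0 <= d := dist_int_ge0 _; have d0' : 0 <= d' := dist_int_ge0 _.
have d1 : d <= 1 / 2 := dist_int_le_half _; have d1' : d' <= 1 / 2 := dist_int_le_half _.
have hd2 : `|d ^+ 2 - d' ^+ 2| <= e / 3.
  rewrite subr_sqr normrM; apply: (@le_trans _ _ (`|A - chi| * 1)); last by rewrite mulr1.
  by apply: ler_pM => //; rewrite ger0_norm; lra.
move: h1 h3 hd2 => /ler_normlP[u1 u2] /ler_normlP[v1 v2] /ler_normlP[w1 w2].
by apply/ler_normlP; split; lra.
Qed.

Lemma subseq_limitsP (u : nat -> R) l :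
  (forall N e, 0 < e -> exists n, (N <= n)%N /\ `|u n - l| <= e) -> subseq_limits u l.
Proof.
move=> h.
have hc (Nj : nat * nat) : {n | (Nj.1 <= n)%N /\ `|u n - l| <= (Nj.2.+1%:R)^-1}.
  by apply: cid; apply: h; rewrite invr_gt0.
pose phi := fix phi j := if j is j'.+1 then sval (hc ((phi j').+1, j)) else sval (hc (0%N, 0%N)).
exists phi; split=> [j|]; first by case: (svalP (hc ((phi j).+1, j.+1))).
apply/cvgrPdist_le => e e0; exists (Num.truncn e^-1).+1 => // j /= hj.
have : `|u (phi j) - l| <= (j.+1%:R)^-1.
  case: j hj => [|j] _; first by case: (svalP (hc (0%N, 0%N))).
  by case: (svalP (hc ((phi j).+1, j.+1))).
rewrite distrC => /le_trans; apply; rewrite -[leRHS]invrK lef_pV2 ?posrE ?invr_gt0 ?ltr0n//.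
by rewrite (le_trans (ltW (truncnS_gt _)))// ler_nat ltnW.
Qed.

(** The sequence [2 ln n + b] is dense modulo 1, since it tends to infinity with
    increments tending to zero. *)
Lemma dist_int_log_dense b y N e : 0 <= y <= 1 / 2 -> 0 < e ->
  exists n, (N <= n)%N /\ `|dist_int (2 * ln n%:R + b) - y| <= e.
Proof.
move=> /andP[y0 y1] e0.
have dy (k : nat) : dist_int (k%:R + y) = y.
  apply/eqP; rewrite eq_le; apply/andP; split.
    have [h _] := dist_int_min (k%:R + y); have := h k.
    by rewrite addrC addrK ger0_norm.
  have [_ [j ->]] := dist_int_min (k%:R + y).
  have -> : k%:R + y - j%:~R = y - (j - k%:Z)%:~R by rewrite intrB; ring.
  have [jk|jk] := leP (j - k%:Z)%R 0.
    have : (j - k%:Z)%:~R <= 0 :> R by rewrite lerz0.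
    by move=> h; rewrite ger0_norm; lra.
  have : 1 <= (j - k%:Z)%:~R :> R by rewrite ler1z.
  by move=> h; rewrite ler0_norm; lra.
pose m := (Num.truncn (2 / e + N%:R)).+1.
have hm : 2 / e + N%:R <= m%:R by rewrite ltW// truncnS_gt.
have m0 : (0 : R) < m%:R by rewrite ltr0n.
pose k := (Num.truncn (2 * ln m%:R + b)).+1 + (Num.truncn `|b|).+1.
have hk : 2 * ln m%:R + b <= k%:R.
  by rewrite (le_trans (ltW (truncnS_gt _)))// ler_nat leq_addr.
pose w := expR ((k%:R + y - b) / 2).
have wm : m%:R <= w.
  rewrite -[leLHS]lnK ?posrE// ler_expR ler_pdivlMr//; lra.
have w0 : 0 < w := expR_gt0 _.
pose n := (Num.truncn w).+1.
have nw : w <= n%:R by rewrite ltW// truncnS_gt.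
have nw1 : n%:R <= w + 1.
  by rewrite /n -natr1 lerD2r truncn_le ltW.
have Nn : (N <= n)%N.
  rewrite -(ler_nat R); have : 0 < 2 / e by rewrite divr_gt0.
  lra.
exists n; split => //.
rewrite -[X in _ - X](dy k); apply: (le_trans (dist_int_lipschitz _ _)).
have lw : 2 * ln w + b = k%:R + y by rewrite /w expRK; field.
rewrite -lw (_ : _ - _ = 2 * (ln n%:R - ln w)); last by ring.
have n0 : 0 < n%:R :> R by rewrite ltr0n.
have lnw : ln w <= ln n%:R by rewrite ler_ln ?posrE.
rewrite ger0_norm; last by rewrite mulr_ge0// subr_ge0.
rewrite -ln_div ?posrE//.
have -> : n%:R / w = 1 + (n%:R - w) / w by field; rewrite gt_eqF.
have h : ln (1 + (n%:R - w) / w) <= (n%:R - w) / w.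
  by apply: le_ln1Dx; apply: lt_le_trans (_ : 0 <= _); [lra|rewrite divr_ge0 ?subr_ge0// ltW].
have : (n%:R - w) / w <= e / 2.
  rewrite ler_pdivrMr//; have : 2 / e <= w by have : (0 : R) <= N%:R by []; lra.
  by rewrite ler_pdivrMr//; lra.
lra.
Qed.

(** The squared distance to the integers has the range [[0, 1 / 4]], and
    [1 / 4 - 1 / 12 = 1 / 6]. *)
Lemma subseq_limits_Mtilde (u : nat -> R) (b c : R) :
  (u n - dist_int (2 * ln n%:R + b) ^+ 2) @[n --> \oo] --> c - 1 / 12 ->
  subseq_limits u = [set x : R | c - 1 / 12 <= x <= c + 1 / 6].
Proof.
move=> hu; pose d n := dist_int (2 * ln n%:R + b : R).
have d0 n : 0 <= d n := dist_int_ge0 _.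
have d1 n : d n ^+ 2 <= 1 / 4.
  by have := dist_int_le_half (2 * ln n%:R + b); have := d0 n; rewrite -/(d n) expr2; nra.
apply/seteqP; split => [x [phi [hphi hx]]|x /andP[x1 x2]] /=.
  have phij j : (j <= phi j)%N by elim: j => // j IHj; exact: leq_ltn_trans IHj (hphi j).
  move/cvgrPdist_le : hu => hu; move/cvgrPdist_le : hx => hx.
  have key e : 0 < e -> c - 1 / 12 - e <= x <= c + 1 / 6 + e.
    move=> e0; have e2 : 0 < e / 2 by rewrite divr_gt0.
    have [N1 _ h1] := hu _ e2; have [N2 _ h2] := hx _ e2.
    pose j := maxn N1 N2.
    have /h2 /ler_normlP[a1 a2] : (N2 <= j)%N by rewrite leq_maxr.
    have /h1 /ler_normlP[b1 b2] : (N1 <= phi j)%N by rewrite (leq_trans _ (phij j))// leq_maxl.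
    have := d1 (phi j); have := sqr_ge0 (d (phi j)); rewrite -/(d _) in b1 b2.
    by move=> ? ?; apply/andP; split; lra.
  apply/andP; split; apply/ler_addgt0Pr => e e0; have /andP[] := key e e0; lra.
apply: subseq_limitsP => N e e0.
pose y := Num.sqrt (x - (c - 1 / 12)).
have x0 : 0 <= x - (c - 1 / 12) by lra.
have y2 : y ^+ 2 = x - (c - 1 / 12) by rewrite sqr_sqrtr.
have y0 : 0 <= y := sqrtr_ge0 _.
have y1 : y <= 1 / 2 by rewrite -(@ler_pXn2r _ 2) ?nnegrE// y2 expr_div_n expr1n (expr2 2); lra.
have e2 : 0 < e / 2 by rewrite divr_gt0.
move/cvgrPdist_le : hu => /(_ _ e2)[N1 _ h1].
have yr : 0 <= y <= 1 / 2 by rewrite y0.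
have [n [Nn hn]] := dist_int_log_dense b (maxn N N1) yr e2.
move: Nn; rewrite geq_max => /andP[Nn /h1 /ler_normlP[b1 b2]].
exists n; split => //; rewrite -/(d n) in hn b1 b2.
have hd : `|d n ^+ 2 - y ^+ 2| <= e / 2.
  rewrite subr_sqr normrM; apply: (@le_trans _ _ (e / 2 * 1)); last by rewrite mulr1.
  apply: ler_pM => //; rewrite ger0_norm ?addr_ge0//.
  have := dist_int_le_half (2 * ln n%:R + b); rewrite -/(d n); lra.
move: hd => /ler_normlP[c1 c2].
by apply/ler_normlP; split; lra.
Qed.

End LimitsOfMtilde.

(** * The width of binary search trees *)

Section WidthOfBinarySearchTrees.
Variable R : realType.
Local Notation C := R[i].

(** The two equations give [expR (bp - bm) = (1 - bm) / (1 - bp)], which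
    [1 + x <= expR x] makes impossible for two points on the same side of 0. *)
Lemma zero_in_interval (bm bp : R) : bm < bp ->
  2 * expR bm * (1 - bm) = 1 -> 2 * expR bp * (1 - bp) = 1 -> bm < 0 < bp.
Proof.
have ne0 (b : R) : 2 * expR b * (1 - b) = 1 -> b != 0 /\ 0 < 1 - b.
  move=> hb; have eb := expR_gt0 b; split; last by nra.
  by apply/eqP => b0; move: hb; rewrite b0 expR0; lra.
have eE (b b' : R) : 2 * expR b * (1 - b) = 1 -> 2 * expR b' * (1 - b') = 1 ->
    expR (b' - b) * (1 - b') = 1 - b.
  move=> hb hb'; apply: (mulfI (lt0r_neq0 (expR_gt0 b))).
  by rewrite mulrA -expRD addrC subrK; lra.
move=> bb hm hp; have [m0 m1] := ne0 _ hm; have [p0 p1] := ne0 _ hp.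
have e1 := eE _ _ hm hp; have e2 := eE _ _ hp hm.
have g1 := expR_ge1Dx (bp - bm); have g2 := expR_ge1Dx (bm - bp).
by apply/andP; split; rewrite lt_neqAle ?m0 1?eq_sym ?p0/=; rewrite leNgt; apply/negP => h; nra.
Qed.

Lemma continuous_complex_of_pair : continuous (fun x : R * R => (x.1 +i* x.2)%C : C^o).
Proof.
move=> x; apply/cvgrPdist_lt => e; rewrite ltcE/= => /andP[/eqP ei e0].
have e2 : 0 < complex.Re e / 2 by rewrite divr_gt0.
have h1 : \forall y \near x, `|x.1 - y.1| < complex.Re e / 2.
  have : fst y @[y --> x] --> x.1 by exact: cvg_fst.
  by move=> /cvgrPdist_lt /(_ _ e2).
have h2 : \forall y \near x, `|x.2 - y.2| < complex.Re e / 2.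
  have : snd y @[y --> x] --> x.2 by exact: cvg_snd.
  by move=> /cvgrPdist_lt /(_ _ e2).
near=> y.
have y1 : `|x.1 - y.1| < complex.Re e / 2 by near: y.
have y2 : `|x.2 - y.2| < complex.Re e / 2 by near: y.
rewrite cabsE ltcE/= ei eqxx/=; apply: (le_lt_trans (cabs_le_ReIm _)) => /=.
lra.
Unshelve. all: by end_near.
Qed.

Lemma compact_square (rho : R) :
  compact [set z : C^o | `|complex.Re z| <= rho /\ `|complex.Im z| <= rho].
Proof.
rewrite (_ : [set _ | _] = (fun x : R * R => (x.1 +i* x.2)%C : C^o) @`
  (`[- rho, rho]%classic `*` `[- rho, rho]%classic)).
  apply: continuous_compact.
    by apply: continuous_subspaceT; exact: continuous_complex_of_pair.
  by apply: compact_setX; exact: segment_compact.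
apply/seteqP; split=> [[x y] /= [hx hy]|_ [[x y] /= [hx hy]] <-] /=.
  by exists (x, y) => //=; rewrite !in_itv/= -!ler_norml.
by move: hx hy; rewrite !in_itv/= -!ler_norml.
Qed.

Lemma square_in_open (D : set C^o) : open D -> D 0 -> exists2 rho : R, 0 < rho &
  [set z : C^o | `|complex.Re z| <= rho /\ `|complex.Im z| <= rho] `<=` D.
Proof.
move=> oD D0; have /nbhs_ballP[e /=] : nbhs (0 : C^o) D by exact: open_nbhs_nbhs.
rewrite ltcE/= => /andP[/eqP ei e0] eD.
exists (complex.Re e / 4) => [|z /= [z1 z2]]; first by rewrite divr_gt0.
apply: eD; rewrite -ball_normE/= sub0r normrN cabsE ltcE/= ei eqxx/=.
apply: (le_lt_trans (cabs_le_ReIm _)); lra.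
Qed.

Lemma uniform_cabs (K : set C^o) (f : nat -> C^o -> C^o) (g : C^o -> C^o) :
  {uniform K, f @ \oo --> g} -> forall e : R, 0 < e ->
  exists N, forall n, (N <= n)%N -> forall z, K z -> cabs (f n z - g z) <= e.
Proof.
move=> fg e e0.
have eC : 0 < (e%:C)%C :> C by rewrite ltcR.
have : nbhs (g : {uniform` K -> C^o}) [set h | forall z, K z -> cabs (h z - g z) <= e].
  apply/uniform_nbhs; exists [set xy : C^o * C^o | ball xy.1 (e%:C)%C xy.2]; split.
    exact: (entourage_ball _ (PosNum eC)).
  move=> h hE z Kz; have := hE z Kz.
  by rewrite -ball_normE/= cabsE ltcR cabsBC => /ltW.
by move=> /fg[N _ hN]; exists N => n Nn; exact: hN.
Qed.

(** The derivatives at 0 of the limit are the limits of those of the real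
    polynomials, which are real. *)
Lemma coef_limits (f : C^o -> C^o) (p : nat -> {poly R}) (rho : R) : 0 < rho ->
  unif_on rho (fun n => map_poly (real_complex R) (p n)) f ->
  (forall e, 0 < e -> exists n0, forall n, (n0 <= n)%N -> `|lin_coef (p n) - chi1 f| <= e) /\
  (forall e, 0 < e -> exists n0, forall n, (n0 <= n)%N ->
     `|2 * quad_coef (p n) + lin_coef (p n) - lin_coef (p n) ^+ 2 - chi2 f| <= e).
Proof.
move=> rho0 pf.
have r2 : 0 < rho / 2 by rewrite divr_gt0.
have r4 : 0 < rho / 2 / 2 by rewrite divr_gt0.
have pf1 : unif_on (rho / 2) (fun n => (map_poly (real_complex R) (p n))^`()) (derive1 f).
  by apply: derive1_unif => //; rewrite mulrC divfK// pnatr_eq0.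
have pf2 : unif_on (rho / 2 / 2) (fun n => (map_poly (real_complex R) (p n))^`()^`()) (derive1 (derive1 f)).
  by apply: derive1_unif => //; rewrite mulrC divfK// pnatr_eq0.
have z0 r : 0 < r -> cabs (0 : C) <= r by move=> h; rewrite cabs0 ltW.
have lim1 e : 0 < e -> exists n0, forall n, (n0 <= n)%N ->
    cabs (((p n)`_1)%:C%C - derive1 f 0) <= e.
  move=> e0; have [N hN] := pf1 e e0; exists N => n /hN /(_ 0 (z0 _ r2)).
  by rewrite horner_coef0 coef_deriv mulr1n coef_map.
have lim2 e : 0 < e -> exists n0, forall n, (n0 <= n)%N ->
    cabs ((2 * (p n)`_2)%:C%C - derive1 (derive1 f) 0) <= e.
  move=> e0; have [N hN] := pf2 e e0; exists N => n /hN /(_ 0 (z0 _ r4)).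
  rewrite horner_coef0 !coef_deriv mulr1n coef_map/=.
  by rewrite -[(_ *+ 2)%R]mulr_natl rmorphM rmorph_nat.
set f1 := derive1 f 0 in lim1 *; set f2 := derive1 (derive1 f) 0 in lim2.
have imE (x : R) (z : C) : complex.Im (x%:C%C - z) = - complex.Im z.
  by case: z => u v /=; rewrite sub0r.
have im1 : complex.Im f1 = 0.
  apply/eqP; rewrite -normr_le0; apply/ler_addgt0Pr => e /lim1[N /(_ N (leqnn N))].
  by rewrite add0r; apply: le_trans; apply: le_trans (le_cabs_Im _); rewrite imE normrN.
have lin e : 0 < e -> exists n0, forall n, (n0 <= n)%N -> `|lin_coef (p n) - chi1 f| <= e.
  move=> /lim1[N hN]; exists N => n /hN; apply: le_trans.
  by apply: le_trans (le_cabs_Re _); rewrite ReB.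
have c2 : chi2 f = complex.Re f2 - chi1 f ^+ 2.
  by rewrite /chi2 /chi1 -/f1 ReB expr2 ReM im1 mulr0 subr0 -expr2.
have quad e : 0 < e -> exists n0, forall n, (n0 <= n)%N ->
    `|2 * (p n)`_2 - complex.Re f2| <= e.
  move=> /lim2[N hN]; exists N => n /hN; apply: le_trans.
  by apply: le_trans (le_cabs_Re _); rewrite ReB.
split => // e e0; rewrite c2.
move: (chi1 f) (complex.Re f2) lin quad => x1 x2 lin quad; clear -lin quad e0.
have b0 : 0 < 2 * `|x1| + 1 by rewrite ltr_wpDl// mulr_ge0.
have e2 : 0 < e / 2 by rewrite divr_gt0.
have e3 : 0 < Num.min 1 (e / 2 / (2 * `|x1| + 1)) by rewrite lt_min ltr01 divr_gt0.
have [N1 h1] := lin _ e3; have [N2 h2] := quad _ e2.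
exists (maxn N1 N2) => n; rewrite geq_max => /andP[/h1 {}h1 /h2 {}h2].
move: h1; rewrite le_min ler_pdivlMr// => /andP[h1 h3].
have sq : `|lin_coef (p n) ^+ 2 - x1 ^+ 2| <= e / 2.
  apply: le_trans h3; rewrite subr_sqr normrM ler_wpM2l//.
  have -> : lin_coef (p n) + x1 = (lin_coef (p n) - x1) + 2 * x1 by ring.
  have := ler_normD (lin_coef (p n) - x1) (2 * x1).
  rewrite normrM (ger0_norm (x := 2))//; lra.
rewrite (_ : _ - _ = (2 * (p n)`_2 - x2) - (lin_coef (p n) ^+ 2 - x1 ^+ 2)).
  by have := ler_normB (2 * (p n)`_2 - x2) (lin_coef (p n) ^+ 2 - x1 ^+ 2); lra.
by rewrite /quad_coef /lin_coef; field.
Qed.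

(** Polynomials that approximate [W_ n (t n)] with an error below [n.+1^-1] satisfy
    the hypotheses of [controlled]. *)
Lemma Mtilde_converges (t : nat -> bst) (f : C^o -> C^o) rho a q Mf :
  t 0%N = External -> growing t -> 0 < rho -> 0 < a -> a <= rho / 2 -> 4 * expR 1 * a <= 1 ->
  (0 < q)%N ->
  (forall j, far_mean_square q (cos a) j (t (j.+1 ^ q)%N) <= Mf * ((j.+1 ^ q)%:R / j.+1%:R) ^+ 2) ->
  (forall e : R, 0 < e -> exists N, forall n, (N <= n)%N -> forall z : C, cabs z <= rho ->
     cabs (W_ n (t n) z - f z) <= e) ->
  (Mtilde R n (t n) - dist_int (2 * ln n%:R + chi1 f - 1 / 2) ^+ 2) @[n --> \oo]
    --> chi2 f - 1 / 12.
Proof.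
move=> t0 tg rho0 a0 ar a1 q0 far Wf.
have hp n : {p : {poly R} | forall z, cabs z <= rho ->
    cabs (evalC p z - W_ n (t n) z) <= (n.+1%:R)^-1}.
  by apply: cid; apply: papprox_W; rewrite invr_gt0 ltr0n.
pose p n := sval (hp n); have pW n := svalP (hp n); rewrite -/(p _) in pW.
have pf : unif_on rho (fun n => map_poly (real_complex R) (p n)) f.
  move=> e e0; have e2 : 0 < e / 2 by rewrite divr_gt0.
  have [N hN] := Wf _ e2; exists (maxn N (Num.truncn (e / 2)^-1)) => n.
  rewrite geq_max => /andP[/hN {}hN ne] z zr; rewrite -/(evalC (p n) z).
  apply: (le_trans (cabs_dist _ (W_ n (t n) z) _)).
  rewrite (_ : e = e / 2 + e / 2); last by field.
  apply: lerD (hN z zr); apply: (le_trans (pW n z zr)).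
  rewrite -[leRHS]invrK lef_pV2 ?posrE ?invr_gt0 ?ltr0n//.
  by rewrite (le_trans (ltW (truncnS_gt _)))// ler_nat.
have [M [n1 pM]] := unif_on_bounded pf.
have [lin quad] := coef_limits rho0 pf.
by apply: (@Mtilde_limit R t p rho M a q Mf n1) => //; split => // n _; exact: pW.
Qed.

End WidthOfBinarySearchTrees.

Theorem theorem1p7 (R : realType) (d : measure_display)
    (Omega : measurableType d) (P : probability Omega R)
    (T : nat -> Omega -> bst) (V : nat -> Omega -> node)
    (hT : bst_process P T V)
    (bm bp : R) (hb : bm < bp)
    (hbm : 2 * expR bm * (1 - bm) = 1) (hbp : 2 * expR bp * (1 - bp) = 1)
    (D : set R[i]^o) (Winf : Omega -> R[i]^o -> R[i]^o)
    (hW : W_limit P T bm bp D Winf) :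
  {ae P, forall w,
    subseq_limits (fun n => Mtilde R n (T n w))
    = [set x : R | chi2 (Winf w) - 1 / 12 <= x <= chi2 (Winf w) + 1 / 6]}
  /\
  {ae P, forall w,
    (Mtilde R n (T n w) - theta n (Winf w) ^+ 2) @[n --> \oo]
      --> chi2 (Winf w) - 1 / 12}.
Proof.
have D0 : D 0 by apply: (W_itv hW (b := 0)); exact: zero_in_interval.
have [rho rho0 rhoD] := square_in_open (W_open hW) D0.
have e1 := @expR_gt0 R 1.
pose a := Num.min (rho / 2) (4 * expR 1)^-1.
have a0 : 0 < a by rewrite lt_min divr_gt0// invr_gt0 mulr_gt0.
have ar : a <= rho / 2 by rewrite ge_min lexx.
have a1 : 4 * expR 1 * a <= 1.
  rewrite mulrC -ler_pdivlMr ?mulr_gt0// mul1r ge_min lexx orbT//.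
have cosa : cos a < 1.
  have := @cosB1_le R a; rewrite ger0_norm ?(ltW a0)// => /(_ a1).
  by have : 0 < a ^+ 2 by [exact: exprn_gt0]; lra.
pose q := (Num.truncn (1 - cos a)^-1 + 8)%N.
have q8 : (8 <= q)%N by rewrite leq_addl.
have q0 : (0 < q)%N by rewrite (leq_trans _ q8).
have hq : 4 * cos a - 2 <= 2 - 4 / q%:R.
  have : q%:R^-1 <= 1 - cos a.
    rewrite -[leRHS]invrK lef_pV2 ?posrE ?invr_gt0 ?subr_gt0 ?ltr0n//.
    by rewrite (le_trans (ltW (truncnS_gt _)))// ler_nat /q addnS ltnS leq_addr.
  lra.
have lim : {ae P, forall w, (Mtilde R n (T n w) - theta n (Winf w) ^+ 2) @[n --> \oo]
    --> chi2 (Winf w) - 1 / 12}.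
  have far := far_mean_square_ae hT q8 hq.
  apply: filterS2 far (W_cvg hW) => w [Mf far] Wcvg.
  apply: (@Mtilde_converges R _ _ rho a q Mf) => //.
  - exact: bst_init hT w.
  - by move=> n; exists (V n w); [exact: bst_pick hT n w|exact: bst_step hT n w].
  - move=> e e0.
    have [N hN] := uniform_cabs (Wcvg _ (@compact_square R rho) rhoD) e0.
    exists N => n Nn z zr; apply: hN => //=.
    by rewrite (le_trans (le_cabs_Re _) zr) (le_trans (le_cabs_Im _) zr).
split => //; apply: filterS lim => w hw.
apply: (@subseq_limits_Mtilde R _ (chi1 (Winf w) - 1 / 2)).
rewrite (_ : (fun n => _) = (fun n => Mtilde R n (T n w) - theta n (Winf w) ^+ 2))//.
by apply/funext => n; rewrite /theta addrA.
Qed.
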